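(* Let $\phi$ satisfy $(\phi_1)$, $(\phi_2)$, $(\phi_3)$. Let $g:\Omega\times\mathbb{R}\to\mathbb{R}$ be a Carathéodory function, let $\alpha\in\{\ell,m\}$ and $\alpha^*=\frac{\alpha N}{N-\alpha}$, and suppose that there is $C>0$ such that either (subcritical) for some $r$ with $\alpha<r<\alpha^*$, $|g(x,t)|\le C(|t|^{\alpha-1}+|t|^{r-1})$ for all $(x,t)\in\Omega\times\mathbb{R}$; or (critical) $|g(x,t)|\le C(|t|^{\alpha-1}+|t|^{\alpha^*-1})$ for all $(x,t)\in\Omega\times\mathbb{R}$. Assume that one of the following holds: (i) $\Phi\not\approx t^m$ and $\alpha=\ell$; (ii) $\Phi\approx t^m$ and $\alpha=m$. Let $u\in W^{1,\Phi}_0(\Omega)$ be a weak solution of $$-\Delta_\Phi u=g(x,u)\ \text{ in }\Omega,\qquad u=0\ \text{ on }\partial\Omega.$$ Then $u\in L^\infty(\Omega)$.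
   Context: Let $N\ge 2$ and let $\Omega\subset\mathbb{R}^N$ be a bounded domain with smooth boundary. Let $\phi:\mathbb{R}\to\mathbb{R}$ be a $C^1$-function and let $\Phi:\mathbb{R}\to\mathbb{R}$ be the even function given by $\Phi(t)=\int_0^t s\phi(s)\,ds$. The conditions are: $(\phi_1)$ $t\phi(t)\to 0$ as $t\to 0$ and $t\phi(t)\to\infty$ as $t\to\infty$; $(\phi_2)$ $t\phi(t)$ is strictly increasing in $(0,\infty)$; $(\phi_3)$ there exist $\ell\in[1,N)$ and $m\in(1,N)$ such that $\ell-1\le \frac{(t\phi(t))'}{\phi(t)}\le m-1<\ell^*-1$ for all $t>0$, where $\ell^*=\frac{\ell N}{N-\ell}$. The $\Phi$-Laplacian is $\Delta_\Phi u=\mathrm{div}(\phi(|\nabla u|)\nabla u)$. An $N$-function is a convex, continuous, even function $\Theta:\mathbb{R}\to[0,\infty)$ with $\Theta(t)/t\to0$ as $t\to0$, $\Theta(t)/t\to\infty$ as $t\to\infty$, and $\Theta(t)>0$ for $t>0$. For $N$-functions $\Phi,\Psi$ write $\Phi\approx\Psi$ if there exist $c_1,c_2>0$ and $t_0\ge0$ such that $c_1\Psi(t)\le\Phi(t)\le c_2\Psi(t)$ for all $t\ge t_0$; write $\Phi\not\approx\Psi$ otherwise. Here $t^m$ denotes the $N$-function $t\mapsto|t|^m$. The Orlicz space is $L_\Phi(\Omega)=\{u:\Omega\to\mathbb{R}\text{ measurable}:\int_\Omega\Phi(|u|/\lambda)\,dx<\infty\text{ for some }\lambda>0\}$ with Luxemburg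 norm $\|u\|_\Phi=\inf\{\lambda>0:\int_\Omega\Phi(|u|/\lambda)\,dx\le1\}$. The Orlicz-Sobolev space $W^{1,\Phi}(\Omega)$ consists of $u\in L_\Phi(\Omega)$ whose weak first derivatives lie in $L_\Phi(\Omega)$, with norm $\|u\|_{1,\Phi}=\|u\|_\Phi+\sum_{i=1}^N\|\partial u/\partial x_i\|_\Phi$, and $W^{1,\Phi}_0(\Omega)$ is the closure of $C_0^\infty(\Omega)$ in $W^{1,\Phi}(\Omega)$. A function $u\in W^{1,\Phi}_0(\Omega)$ is a weak solution of $-\Delta_\Phi u=g(x,u)$ in $\Omega$, $u=0$ on $\partial\Omega$, if $\int_\Omega\phi(|\nabla u|)\nabla u\cdot\nabla v\,dx=\int_\Omega g(x,u)v\,dx$ for all $v\in W^{1,\Phi}_0(\Omega)$. *)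

(* Defs.v *)
From HB Require Import structures.
From mathcomp Require Import all_boot all_order all_algebra.
From mathcomp Require Import all_classical all_reals all_analysis.

Set Implicit Arguments.
Unset Strict Implicit.
Unset Printing Implicit Defensive.

Import Order.TTheory GRing.Theory Num.Theory.
Import numFieldNormedType.Exports.

Local Open Scope classical_set_scope.
Local Open Scope ring_scope.

(** Lebesgue measure on R^n.  Points of R^n are row vectors 'rV[R]_n.  The n-fold
    product of the one-dimensional Lebesgue measure is built on the Borel sets
    of n.-tuple (measurableTypeR R), and its completion is transported to 'rV[R]_n along the
    bijection row_of_tuple.  Measurability on 'rV[R]_n is thus Lebesgue
    measurability. *)

Section lebesgue_tuple.
Context {R : realType}.

Let split_tuple n (t : n.+1.-tuple (measurableTypeR R)) : measurableTypeR R * n.-tuple (measurableTypeR R) :=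
  (tnth t ord0, [tuple of behead t]).

Definition cons_pair n (p : measurableTypeR R * n.-tuple (measurableTypeR R)) : n.+1.-tuple (measurableTypeR R) :=
  [tuple of p.1 :: p.2].

Lemma measurable_cons_pair n : measurable_fun [set: measurableTypeR R * n.-tuple (measurableTypeR R)] (@cons_pair n).
Proof. exact: measurable_cons. Qed.

Definition cons_measure n (mu : {sigma_finite_measure set (n.-tuple (measurableTypeR R)) -> \bar R})
    : set (n.+1.-tuple (measurableTypeR R)) -> \bar R :=
  pushforward (@lebesgue_measure R \x mu)%E (@cons_pair n).

Section cons_measure.
Variables (n : nat) (mu : {sigma_finite_measure set (n.-tuple (measurableTypeR R)) -> \bar R}).

Let cons_measure0 : cons_measure mu set0 = 0%E.
Proof. by rewrite /cons_measure /pushforward preimage_set0 measure0. Qed.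

Let cons_measure_ge0 A : (0 <= cons_measure mu A)%E.
Proof.
pose m := measure_function_pushforward__canonical__measure_function_Measure
  (@lebesgue_measure R \x mu)%E (@measurable_cons_pair n).
exact: (@measure_ge0 _ _ _ m).
Qed.

Let cons_measure_sigma_additive : semi_sigma_additive (cons_measure mu).
Proof.
pose m := measure_function_pushforward__canonical__measure_function_Measure
  (@lebesgue_measure R \x mu)%E (@measurable_cons_pair n).
exact: (@measure_semi_sigma_additive _ _ _ m).
Qed.

HB.instance Definition _ := isMeasure.Build _ _ _ (cons_measure mu)
  cons_measure0 cons_measure_ge0 cons_measure_sigma_additive.

Let cons_measure_sigma_finite : sigma_finite setT (cons_measure mu).
Proof.
have [F TF Foo] : sigma_finite setT (@lebesgue_measure R \x mu)%E.
  have /sigma_finiteP[F [TF ndF Foo]] := sigma_finiteT (@lebesgue_measure R).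
  have /sigma_finiteP[G [TG ndG Goo]] := sigma_finiteT mu.
  exists (fun k => F k `*` G k).
    rewrite -setXTT TF TG predeqE => -[x y]; split.
      move=> [/= [k _ Fkx] [l _ Gly]]; exists (maxn k l) => //; split.
      - by move: x Fkx; exact/subsetPset/ndF/leq_maxl.
      - by move: y Gly; exact/subsetPset/ndG/leq_maxr.
    by move=> [k _ []/= ? ?]; split; exists k.
  move=> k; have [? ?] := Foo k; have [? ?] := Goo k.
  split; first exact: measurableX.
  by rewrite product_measure1E// lte_mul_pinfty// ge0_fin_numE.
have msplit : measurable_fun setT (@split_tuple n).
  apply/measurable_fun_pairP; split; first exact: measurable_tnth.
  exact: measurable_behead.
exists (fun k => @split_tuple n @^-1` F k).
  by rewrite -preimage_bigcup -TF preimage_setT.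
move=> k; have [mF Fk] := Foo k; split.
  by rewrite -[X in measurable X]setTI; exact: msplit.
rewrite /cons_measure /pushforward -comp_preimage.
rewrite (_ : _ \o _ = id)//; apply/funext => -[x t] /=.
by rewrite /split_tuple /cons_pair tnth0; congr pair; apply/val_inj.
Qed.

HB.instance Definition _ := Measure_isSigmaFinite.Build _ _ _ (cons_measure mu)
  cons_measure_sigma_finite.

End cons_measure.

Fixpoint lebesgue_tuple n : {sigma_finite_measure set (n.-tuple (measurableTypeR R)) -> \bar R} :=
  if n is k.+1 then cons_measure (lebesgue_tuple k)
  else \d_([tuple] : 0.-tuple (measurableTypeR R)).

End lebesgue_tuple.

Section lebesgue_rV.
Context {R : realType}.
Variable n : nat.

Definition row_of_tuple (t : n.-tuple (measurableTypeR R)) : 'rV[R]_n :=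
  \row_i tnth t i.

Let lambda := @completed_measure_extension _ _ _ (@lebesgue_tuple R n).
Let dom := caratheodory_type ((@lebesgue_tuple R n)^*)%mu.

Definition lebesgue_rV_measurable : set (set 'rV[R]_n) :=
  [set A | measurable (row_of_tuple @^-1` A : set dom)].

Let lebesgue_rV_measurable0 : lebesgue_rV_measurable set0.
Proof. by rewrite /lebesgue_rV_measurable /= preimage_set0; exact: measurable0. Qed.

Let lebesgue_rV_measurableC A :
  lebesgue_rV_measurable A -> lebesgue_rV_measurable (~` A).
Proof.
by rewrite /lebesgue_rV_measurable /= -preimage_setC; exact: measurableC.
Qed.

Let lebesgue_rV_measurable_bigcup (F : (set 'rV[R]_n)^nat) :
  (forall k, lebesgue_rV_measurable (F k)) ->
  lebesgue_rV_measurable (\bigcup_k F k).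
Proof.
move=> mF; rewrite /lebesgue_rV_measurable /= preimage_bigcup.
by apply: bigcup_measurable => k _; exact: mF.
Qed.

HB.instance Definition _ := @isMeasurable.Build default_measure_display
  'rV[R]_n lebesgue_rV_measurable lebesgue_rV_measurable0
  lebesgue_rV_measurableC lebesgue_rV_measurable_bigcup.

Definition lebesgue_rV (A : set 'rV[R]_n) : \bar R :=
  lambda (row_of_tuple @^-1` A).

Let lebesgue_rV0 : lebesgue_rV set0 = 0%E.
Proof. by rewrite /lebesgue_rV preimage_set0; exact: (measure0 lambda). Qed.

Let lebesgue_rV_ge0 A : (0 <= lebesgue_rV A)%E.
Proof. exact: (measure_ge0 lambda). Qed.

Let lebesgue_rV_sigma_additive : semi_sigma_additive lebesgue_rV.
Proof.
move=> F mF tF mUF; rewrite /lebesgue_rV preimage_bigcup.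
apply: (@measure_semi_sigma_additive _ _ _ lambda) => //.
apply/trivIsetP => /= i j _ _ ij; rewrite -preimage_setI.
by move/trivIsetP : tF => /(_ _ _ _ _ ij) ->//; rewrite preimage_set0.
Qed.

HB.instance Definition _ := isMeasure.Build _ _ _ lebesgue_rV
  lebesgue_rV0 lebesgue_rV_ge0 lebesgue_rV_sigma_additive.

End lebesgue_rV.

Section smooth_functions.
Context {R : realType}.
Variable n : nat.
Implicit Types f : 'rV[R]_n -> R.

Definition partial (i : 'I_n) f (x : 'rV[R]_n) : R := 'D_(delta_mx 0 i) f x.

Definition grad f (x : 'rV[R]_n) : 'rV[R]_n := \row_i partial i f x.

Fixpoint Ck (k : nat) f : Prop :=
  continuous f /\
  if k is j.+1 then
    forall i, (forall x, derivable f x (delta_mx 0 i)) /\ Ck j (partial i f)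
  else True.

Definition smooth f : Prop := forall k, Ck k f.

Definition test_function (Om : set 'rV[R]_n) f : Prop :=
  [/\ smooth f, compact (closure [set x | f x != 0]) &
    closure [set x | f x != 0] `<=` Om].

Definition dot (v w : 'rV[R]_n) : R := \sum_i v 0 i * w 0 i.

(* The library norm `|v| on 'rV[R]_n is the sup norm, not the Euclidean one. *)
Definition enorm (v : 'rV[R]_n) : R := Num.sqrt (dot v v).

End smooth_functions.

Section domains.
Context {R : realType}.
Variable n : nat.
Implicit Types Om : set 'rV[R]_n.

Definition bounded_domain Om : Prop :=
  [/\ Om !=set0, open Om, connected Om & bounded_set Om].

(* Near each boundary point, Om is, for some coordinate i and some orientation s
   of the i-th axis, the region strictly above the graph of a smooth function of
   the remaining coordinates (col' i x is x with its i-th entry removed). *)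
Definition smooth_boundary Om : Prop :=
  forall x0, (closure Om `\` interior Om) x0 ->
  exists (i : 'I_n) (s : bool) (gamma : 'rV[R]_n.-1 -> R), smooth gamma /\
    \forall x \near x0, Om x <-> 0 < (-1) ^+ s * (x 0 i - gamma (col' i x)).

End domains.

Section orlicz_sobolev.
Context {R : realType}.
Variables (N : nat) (Phi : R -> R) (Om : set 'rV[R]_N).
Implicit Types (u v w : 'rV[R]_N -> R) (Du Dv : 'rV[R]_N -> 'rV[R]_N).

Let mu := @lebesgue_rV R N.

Definition modular u (lambda : R) : \bar R :=
  (\int[mu]_(x in Om) (Phi (`|u x| / lambda))%:E)%E.

Definition orlicz u : Prop :=
  measurable_fun Om u /\ exists2 lambda, 0 < lambda & (modular u lambda < +oo)%E.

Definition luxemburg u : \bar R :=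
  ereal_inf [set lambda%:E | lambda in
    [set lambda : R | 0 < lambda /\ (modular u lambda <= 1)%E]].

Definition loc_integrable u : Prop :=
  measurable_fun Om u /\
  forall K, K `<=` Om -> compact K -> (\int[mu]_(x in K) `|u x|%:E < +oo)%E.

Definition weak_partial (i : 'I_N) u w : Prop :=
  [/\ loc_integrable u, loc_integrable w &
    forall psi, test_function Om psi ->
      \int[mu]_(x in Om) (u x * partial i psi x) =
      - \int[mu]_(x in Om) (w x * psi x)].

(* Weak derivatives are only determined almost everywhere, so the gradient is
   carried along: sobolev u Du means that u belongs to W^{1,Phi}(Om) and that Du
   is a weak gradient of u. *)
Definition sobolev u Du : Prop :=
  orlicz u /\
  forall i, weak_partial i u (fun x => Du x 0 i) /\ orlicz (fun x => Du x 0 i).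

Definition sobolev_norm u Du : \bar R :=
  (luxemburg u + \sum_(i < N) luxemburg (fun x => Du x 0%R i))%E.

(* The closure of the test functions in W^{1,Phi}(Om). *)
Definition sobolev0 u Du : Prop :=
  sobolev u Du /\
  forall eps : R, 0 < eps -> exists2 psi, test_function Om psi &
    (sobolev_norm (fun x => u x - psi x)%R
       (fun x => Du x - grad psi x)%R < eps%:E)%E.

Definition Linfty u : Prop :=
  measurable_fun Om u /\ exists M : R, {ae mu, forall x, Om x -> `|u x| <= M}.

Definition caratheodory_function (g : 'rV[R]_N -> R -> R) : Prop :=
  (forall t, measurable_fun Om (g ^~ t)) /\
  {ae mu, forall x, Om x -> continuous (g x)}.

End orlicz_sobolev.

Section phi_laplacian.
Context {R : realType}.
Implicit Types (phi Phi Psi : R -> R).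

(* The upper bound `|t| makes this the even function that is given by the
   integral of s * phi s over [0, t] for t >= 0. *)
Definition PhiF phi (t : R) : R :=
  \int[lebesgue_measure]_(s in `[0, `|t|]) (s * phi s).

Definition C1 phi : Prop :=
  (forall t, derivable phi t 1) /\ continuous (derive1 phi).

Definition phi1 phi : Prop :=
  (t * phi t @[t --> 0^'] --> 0) /\ (t * phi t @[t --> +oo] --> +oo).

Definition phi2 phi : Prop :=
  forall s t, 0 < s -> s < t -> s * phi s < t * phi t.

Definition sobolev_conj (N : nat) (a : R) : R := a * N%:R / (N%:R - a).

Definition phi3 (N : nat) phi (l m : R) : Prop :=
  [/\ 1 <= l < N%:R, 1 < m < N%:R, m - 1 < sobolev_conj N l - 1 &
    forall t, 0 < t ->
      l - 1 <= derive1 (fun s => s * phi s) t / phi t <= m - 1].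

Definition Nequiv Phi Psi : Prop :=
  exists c1 c2 t0 : R, [/\ 0 < c1, 0 < c2, 0 <= t0 &
    forall t, t0 <= t -> c1 * Psi t <= Phi t <= c2 * Psi t].

Definition weak_solution (N : nat) (Om : set 'rV[R]_N) phi
    (g : 'rV[R]_N -> R -> R) (u : 'rV[R]_N -> R) : Prop :=
  exists2 Du, sobolev0 (PhiF phi) Om u Du &
    forall v Dv, sobolev0 (PhiF phi) Om v Dv ->
      \int[@lebesgue_rV R N]_(x in Om) (phi (enorm (Du x)) * dot (Du x) (Dv x)) =
      \int[@lebesgue_rV R N]_(x in Om) (g x (u x) * v x).

End phi_laplacian.

(* Main.v *)
Require Import Defs.
From HB Require Import structures.
From mathcomp Require Import all_boot all_order all_algebra.
From mathcomp Require Import all_classical all_reals all_analysis measurable_realfun.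
From mathcomp Require Import ring lra.

Set Implicit Arguments.
Unset Strict Implicit.
Unset Printing Implicit Defensive.

Import Order.TTheory GRing.Theory Num.Theory.
Import numFieldNormedType.Exports.

Local Open Scope classical_set_scope.
Local Open Scope ring_scope.

(** Let [astar] be the Sobolev conjugate of [alpha].  The growth of [g] is at most
    critical with respect to [alpha], because a power strictly between
    [alpha - 1] and [astar - 1] is bounded by the sum of these two
    ([powR_le_add]).  Conversely, [PhiF phi] grows at least like the power [alpha]:
    for [alpha = l] because of the lower bound on the logarithmic derivative of
    [t * phi t], for [alpha = m] because [PhiF phi] is then equivalent to the power
    [m].  Thus the gradient of a solution is integrable to the power [alpha], the
    solution to the power [astar], and De Giorgi's method applies.

    Put [A k] for the set where [k <= u] and [V k] for the integral of
    [`|u| `^ astar] over [A k].  The weak formulation is tested with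
    the truncation of [u] at level [k >= 1].  As [PhiF phi t] is at most
    [phi t * t ^ 2], this bounds the modular of the gradient over [A k] by the
    integral of [`|g x u| * (u - k)], hence by a multiple of [V k]
    ([energy_level]).  Then the gradient to the power [alpha] has an integral over
    [A k] of order [V k] too, and the Sobolev inequality for the positive part of
    [u - k] ([sobolev_level]) gives an estimate of order [V k `^ (astar / alpha)] for
    the integral of [(u - k) `^ astar] over [A k].  The exponent exceeds [1], which
    makes [V] vanish at some finite level ([bounded_of_level_estimate]), that is,
    [u] is bounded above almost everywhere.  The same holds for [- u].

    Three points need care.  First, the truncation has to be an admissible test,
    that is, a limit of test functions together with its gradient; this is proved
    for a smooth truncation, the softplus function ([sobolev0_softplus]), and the
    doubling property of [PhiF phi] lets one work with modulars instead of norms.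
    Second, the Sobolev inequality is needed above a level, with only the gradient
    over [A k] on the right.  For test functions it follows from the
    Gagliardo-Nirenberg inequality ([gagliardo]), applied to a power of the
    truncation, and Hoelder's inequality ([sobolev_test]).  Third, Lebesgue measure
    on row vectors is a completed product measure, so that Tonelli's theorem is used
    on tuples and transported ([ge0_integral_rV]). *)

(** * Real powers and integrals of nonnegative functions *)

Section real_powers.
Context {R : realType}.

Lemma measurable_funpow d (T : measurableType d) (D : set T) (f : T -> R) (a : R) :
  measurable_fun D f -> measurable_fun D (fun x => f x `^ a).
Proof. exact: (@measurableT_comp _ _ _ _ _ _ (@powR R ^~ a)). Qed.

(** The integral of a nonnegative function is a supremum over the simple
    functions below it, whether or not the function is measurable; so integrands
    need only be compared pointwise. *)
Lemma le_integral_nonneg d (T : measurableType d) (mu : {measure set T -> \bar R})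
    (D : set T) (f g : T -> \bar R) :
  (forall x, D x -> 0 <= f x)%E -> (forall x, D x -> f x <= g x)%E ->
  (\int[mu]_(x in D) f x <= \int[mu]_(x in D) g x)%E.
Proof.
move=> f0 fg; have g0 x : D x -> (0 <= g x)%E.
  by move=> Dx; exact: le_trans (f0 x Dx) (fg x Dx).
rewrite !ge0_integralE//; apply: ereal_sup_le => _ [h hf <-].
exists h => // x; apply: (le_trans (hf x)).
by rewrite !patchE; case: ifPn => //; rewrite inE => /fg.
Qed.

Lemma measurable_if_ge d (T : measurableType d) (D : set T) (k : R) (f g : T -> R) :
  measurable D -> measurable_fun D f -> measurable_fun D g ->
  measurable_fun D (fun x => if k <= f x then g x else 0).
Proof.
move=> mD mf mg; apply: measurable_fun_if => //; first exact: measurable_fun_ler.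
by apply: (measurable_funS mD) => //; exact: subIsetl.
Qed.

Lemma ge0_hoelder d (T : measurableType d) (mu : {measure set T -> \bar R})
    (f g : T -> R) (p q : R) :
  measurable_fun setT f -> measurable_fun setT g ->
  (forall x, 0 <= f x) -> (forall x, 0 <= g x) ->
  0 < p -> 0 < q -> p^-1 + q^-1 = 1 ->
  (\int[mu]_x (f x * g x)%:E <=
    (\int[mu]_x (f x `^ p)%:E) `^ p^-1 * (\int[mu]_x (g x `^ q)%:E) `^ q^-1)%E.
Proof.
move=> mf mg f0 g0 p0 q0 pq.
have E (h : T -> R) r : (forall x, 0 <= h x) ->
    (\int[mu]_x (`|(h x)%:E| `^ r) = \int[mu]_x (h x `^ r)%:E)%E.
  by move=> h0; apply: eq_integral => x _; rewrite abse_EFin ger0_norm ?poweR_EFin.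
have := hoelder mu mf mg p0 q0 pq; rewrite Lnorm1 unlock /Lnorm !E//.
by under eq_integral do rewrite abse_EFin normrM !ger0_norm//.
Qed.

Lemma le_poweR (a : R) (x y : \bar R) : 0 <= a -> (0 <= x)%E -> (x <= y)%E ->
  (x `^ a <= y `^ a)%E.
Proof.
move=> a0 x0 xy; apply: gt0_ler_poweR => //; rewrite in_itv/= leey andbT//.
exact: le_trans xy.
Qed.

(** Exponents add up also when [D] is infinite, as [a] is positive. *)
Lemma poweR_mulDr (D : \bar R) (a : R) : (0 <= D)%E -> 0 < a ->
  (D * D `^ a = D `^ (1 + a))%E.
Proof.
move=> D0 a0; case: D D0 => [r| |]//.
- rewrite lee_fin => r0; rewrite /poweR -EFinM; congr (_%:E).
  have [->|r1] := eqVneq r 0; first by rewrite mul0r powR0// gt_eqF// addr_gt0.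
  by rewrite powRD ?powRr1//; apply/implyP.
- by move=> _; rewrite !poweRyr ?gt_eqF ?addr_gt0// mulyy.
Qed.

Lemma le_powR (r x y : R) : 0 <= r -> 0 <= x -> x <= y -> x `^ r <= y `^ r.
Proof.
by move=> r0 x0 xy; apply: ge0_ler_powR; rewrite ?nnegrE// (le_trans x0).
Qed.

Lemma powR_add_le (a x y : R) : 0 <= a -> 0 <= x -> 0 <= y ->
  (x + y) `^ a <= 2 `^ a * (x `^ a + y `^ a).
Proof.
move=> a0 x0 y0; wlog xy : x y x0 y0 / x <= y.
  move=> H; have [xy|yx] := leP x y; first exact: H.
  by rewrite addrC [_ `^ a + _]addrC; apply: H => //; exact: ltW.
apply: (@le_trans _ _ ((2 * y) `^ a)).
  by apply: le_powR; rewrite ?a0 ?addr_ge0//; lra.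
by rewrite powRM// ler_pM2l ?powR_gt0// lerDr powR_ge0.
Qed.

Lemma powR_le1D (p q t : R) : 0 <= p -> p <= q -> 0 <= t -> t `^ p <= 1 + t `^ q.
Proof.
move=> p0 pq t0; have [t1|t1] := leP 1 t.
  by apply: (le_trans (ler_powR t1 pq)); rewrite lerDr.
have := le_powR p0 t0 (ltW t1); rewrite powR1 => /le_trans; apply.
by rewrite lerDl powR_ge0.
Qed.

(** On [[0, 1]] the lower power [p] dominates, above [1] the upper power [q]
    does.  This reduces subcritical growth to critical growth. *)
Lemma powR_le_add (p q r t : R) : 0 <= p -> p < r -> r <= q -> 0 <= t ->
  t `^ r <= t `^ p + t `^ q.
Proof.
move=> p0 pr rq; rewrite le_eqVlt => /predU1P[<-|t0].
  by rewrite (@powR0 _ r) ?addr_ge0 ?powR_ge0// gt_eqF// (le_lt_trans p0).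
have [t1|t1] := leP 1 t.
  by apply: (le_trans (ler_powR t1 rq)); rewrite lerDr powR_ge0.
have t01 : 0 < t <= 1 by rewrite t0 ltW.
by apply: (le_trans (ger_powR t01 (ltW pr))); rewrite lerDl powR_ge0.
Qed.

End real_powers.

(** * The Gagliardo-Nirenberg inequality on tuples *)

Section tuple_measure.
Context {R : realType}.
Local Notation tup n := (n.-tuple (measurableTypeR R)).
Local Notation leb n := (@lebesgue_tuple R n).

Definition set_entry n (x : tup n) (i : 'I_n) (s : R) : tup n :=
  [tuple if j == i then (s : measurableTypeR R) else tnth x j | j < n].

Lemma set_entry_cons0 n (t s : R) (y : tup n) :
  set_entry (cons_pair (t, y)) ord0 s = cons_pair ((s : measurableTypeR R), y).
Proof.
apply: eq_from_tnth => j; rewrite tnth_mktuple /cons_pair.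
have [->|] := eqVneq j ord0; first by rewrite tnth0.
by rewrite eq_sym => /unlift_some[k -> _]; rewrite !tnthS.
Qed.

Lemma set_entry_consS n (t s : R) (y : tup n) (i : 'I_n) :
  set_entry (cons_pair ((t : measurableTypeR R), y)) (lift ord0 i) s = cons_pair ((t : measurableTypeR R), set_entry y i s).
Proof.
apply: eq_from_tnth => j; rewrite tnth_mktuple /cons_pair.
have [->|] := eqVneq j ord0; first by rewrite !tnth0.
rewrite eq_sym => /unlift_some[k -> _]; rewrite !tnthS tnth_mktuple.
by rewrite (inj_eq (@lift_inj _ _)).
Qed.

Lemma ge0_integral_cons n (F : tup n.+1 -> \bar R) :
  measurable_fun [set: tup n.+1] F -> (forall x, 0 <= F x)%E ->
  (\int[leb n.+1]_x F x =
   \int[lebesgue_measure]_t \int[leb n]_y F (cons_pair ((t : measurableTypeR R), y)))%E.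
Proof.
move=> mF F0 /=.
rewrite ge0_integral_pushforward//; last exact: measurable_cons_pair.
rewrite preimage_setT fubini_tonelli1//; last by move=> z; exact: F0.
by apply: measurableT_comp => //; exact: measurable_cons_pair.
Qed.

Lemma ge0_integral_cons_swap n (F : tup n.+1 -> \bar R) :
  measurable_fun [set: tup n.+1] F -> (forall x, 0 <= F x)%E ->
  (\int[leb n.+1]_x F x =
   \int[leb n]_y \int[lebesgue_measure]_t F (cons_pair ((t : measurableTypeR R), y)))%E.
Proof.
move=> mF F0; rewrite ge0_integral_cons//.
apply: (fubini_tonelli (fun z => F (cons_pair z))) => //.
by apply: measurableT_comp => //; exact: measurable_cons_pair.
Qed.

Lemma measurable_section n (F : tup n.+1 -> R) (t : R) :
  measurable_fun [set: tup n.+1] F ->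
  measurable_fun setT (fun y : tup n => F (cons_pair ((t : measurableTypeR R), y))).
Proof.
move=> mF; apply: (measurableT_comp mF).
by apply: (measurableT_comp (@measurable_cons_pair R n)); exact: measurable_pair1.
Qed.

(** Tonelli along the [i]-th axis.  It is meant for the positive and the negative
    part of a derivative in the direction [i], whose line integrals are equal by
    the fundamental theorem of calculus. *)
Lemma eq_integral_lines n (F1 F2 : tup n -> \bar R) (i : 'I_n) :
  measurable_fun [set: tup n] F1 -> measurable_fun [set: tup n] F2 ->
  (forall x, 0 <= F1 x)%E -> (forall x, 0 <= F2 x)%E ->
  (forall x, \int[lebesgue_measure]_s F1 (set_entry x i s) =
             \int[lebesgue_measure]_s F2 (set_entry x i s))%E ->
  (\int[leb n]_x F1 x = \int[leb n]_x F2 x)%E.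
Proof.
elim: n => [|n IH] in F1 F2 i *; first by case: i.
move=> mF1 mF2 F10 F20 F12.
have [i0|] := eqVneq i ord0.
  rewrite !ge0_integral_cons_swap//; apply: eq_integral => y _.
  have := F12 (cons_pair ((0 : measurableTypeR R), y)).
  by rewrite i0; under eq_integral do rewrite set_entry_cons0;
    under [in X in _ = X -> _]eq_integral do rewrite set_entry_cons0.
rewrite eq_sym => /unlift_some[k ik _].
rewrite !ge0_integral_cons//; apply: eq_integral => t _.
have mc : measurable_fun setT (fun y : tup n => cons_pair ((t : measurableTypeR R), y)).
  by apply: (measurableT_comp (@measurable_cons_pair R n)); exact: measurable_pair1.
apply: (IH _ _ k) => //; [exact: (measurableT_comp mF1 mc)|exact: (measurableT_comp mF2 mc)|].
move=> x; have := F12 (cons_pair ((t : measurableTypeR R), x)).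
by rewrite ik; under eq_integral do rewrite set_entry_consS;
    under [in X in _ = X -> _]eq_integral do rewrite set_entry_consS.
Qed.

(** When [f] is compactly supported and of class C^1, one takes for [p i] the
    modulus of the [i]-th partial derivative.  Line integrals, unlike derivatives,
    restrict to slices at once, which suits an induction on the dimension. *)
Definition line_bounded n (f : tup n -> R) (p : 'I_n -> tup n -> R) : Prop :=
  [/\ measurable_fun [set: tup n] f,
      (forall i, measurable_fun [set: tup n] (p i)),
      (forall x, 0 <= f x), (forall i x, 0 <= p i x) &
      forall i x, ((f x)%:E <= \int[lebesgue_measure]_s (p i (set_entry x i s))%:E)%E].

Definition total_integral n (p : 'I_n -> tup n -> R) : \bar R :=
  (\sum_i \int[leb n]_x (p i x)%:E)%E.

Lemma total_integral_ge0 n (p : 'I_n -> tup n -> R) :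
  (forall i x, 0 <= p i x) -> (0 <= total_integral p)%E.
Proof.
by move=> p0; apply: sume_ge0 => i _; apply: integral_ge0 => x _; rewrite lee_fin.
Qed.

Lemma line_bounded_section n (f : tup n.+1 -> R) p (t : R) :
  line_bounded f p ->
  line_bounded (fun y : tup n => f (cons_pair ((t : measurableTypeR R), y)))
    (fun i y => p (lift ord0 i) (cons_pair ((t : measurableTypeR R), y))).
Proof.
move=> [mf mp f0 p0 fp]; split => //.
- exact: measurable_section.
- by move=> i; exact: measurable_section.
- move=> i y; apply: (le_trans (fp (lift ord0 i) _)).
  by under eq_integral do rewrite set_entry_consS.
Qed.

(** Slice along the first axis and apply the inequality of the lower dimension on
    each slice.  Its last factor is bounded uniformly in the slice, because [f] is
    at most its line integral along the first axis; the first factor integrates to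
    the other terms of [total_integral p]. *)
Lemma gagliardo_step n (f : tup n.+2 -> R) (p : 'I_n.+2 -> tup n.+2 -> R) :
  (forall (g : tup n.+1 -> R) q, line_bounded g q ->
    (\int[leb n.+1]_x (g x `^ (1 + n.+1%:R^-1))%:E <=
     total_integral q * (\int[leb n.+1]_x (g x)%:E) `^ n.+1%:R^-1)%E) ->
  line_bounded f p ->
  (\int[leb n.+2]_x (f x `^ (1 + n.+1%:R^-1))%:E <=
    total_integral p `^ (1 + n.+1%:R^-1))%E.
Proof.
move=> IH fp; have [mf mp f0 p0 fple] := fp.
have a0 : (0 : R) < n.+1%:R^-1 by rewrite invr_gt0.
set a := n.+1%:R^-1 in IH a0 *.
rewrite -poweR_mulDr ?total_integral_ge0//.
have mfa : measurable_fun [set: tup n.+2] (fun x => (f x `^ (1 + a))%:E).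
  by apply/measurable_EFinP; exact: measurable_funpow.
rewrite ge0_integral_cons//; last by move=> x; rewrite lee_fin powR_ge0.
pose Dt (t : measurableTypeR R) := total_integral (fun i (y : tup n.+1) => p (lift ord0 i) (cons_pair (t, y))).
pose D0 := (\int[leb n.+2]_x (p ord0 x)%:E)%E.
have D00 : (0 <= D0)%E by apply: integral_ge0 => x _; rewrite lee_fin.
have secle t : (\int[leb n.+1]_y (f (cons_pair ((t : measurableTypeR R), y)))%:E <= D0)%E.
  rewrite /D0 [leRHS]ge0_integral_cons_swap//; last 2 first.
  - exact/measurable_EFinP.
  - by move=> x; rewrite lee_fin.
  apply: ge0_le_integral => //.
  - by move=> y _; rewrite lee_fin.
  - by apply/measurable_EFinP; exact: measurable_section.
  - apply: (measurable_fun_fubini_tonelli_G (m1 := lebesgue_measure) (fun z => (p ord0 (cons_pair z))%:E)).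
      apply/measurable_EFinP; apply: (measurableT_comp (mp _)).
      exact: measurable_cons_pair.
    by move=> z; rewrite lee_fin.
  - move=> y _; apply: (le_trans (fple ord0 _)).
    by under eq_integral do rewrite set_entry_cons0.
have mDt : measurable_fun setT Dt.
  apply: emeasurable_sum => i.
  apply: (measurable_fun_fubini_tonelli_F (m2 := leb n.+1) (fun z => (p (lift ord0 i) (cons_pair z))%:E)).
    apply/measurable_EFinP; apply: (measurableT_comp (mp _)).
    exact: measurable_cons_pair.
  by move=> z; rewrite lee_fin.
have Dt0 t : (0 <= Dt t)%E by apply: total_integral_ge0.
have intDt : (\int[lebesgue_measure]_t Dt t <= total_integral p)%E.
  rewrite /Dt /total_integral big_ord_recl ge0_integral_sum//; last 2 first.
  - move=> i; apply: (measurable_fun_fubini_tonelli_F (m2 := leb n.+1) (fun z => (p (lift ord0 i) (cons_pair z))%:E)).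
      apply/measurable_EFinP; apply: (measurableT_comp (mp _)).
      exact: measurable_cons_pair.
    by move=> z; rewrite lee_fin.
  - by move=> i t _; apply: integral_ge0 => y _; rewrite lee_fin.
  rewrite -[leLHS]add0e; apply: leeD => //; apply: lee_sum => i _.
  rewrite ge0_integral_cons//; first exact/measurable_EFinP.
  by move=> x; rewrite lee_fin.
apply: (@le_trans _ _ (\int[lebesgue_measure]_t (Dt t * D0 `^ a))%E).
  apply: ge0_le_integral => //.
  - by move=> t _; apply: integral_ge0 => y _; rewrite lee_fin powR_ge0.
  - apply: (measurable_fun_fubini_tonelli_F (m2 := leb n.+1) (fun z => (f (cons_pair z) `^ (1 + a))%:E)).
      by apply: (measurableT_comp mfa); exact: measurable_cons_pair.
    by move=> z; rewrite lee_fin powR_ge0.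
  - by apply: emeasurable_funM => //; exact: measurable_cst.
  - move=> t _; apply: (le_trans (IH _ _ (line_bounded_section t fp))).
    apply: lee_wpmul2l; first exact: Dt0.
    apply: le_poweR => //; first exact: ltW.
    by apply: integral_ge0 => y _; rewrite lee_fin.
rewrite ge0_integralZr ?poweR_ge0//.
apply: lee_pmul => //; [by apply: integral_ge0 => t _; exact: Dt0|exact: poweR_ge0|].
apply: le_poweR => //; first exact: ltW.
rewrite /total_integral (bigD1 ord0)//= leeDl//.
by apply: sume_ge0 => i _; apply: integral_ge0 => x _; rewrite lee_fin.
Qed.

(** The form of the inequality that is stable under slicing.  From one dimension
    to the next, write [f `^ (1 + d^-1) = f * f `^ d^-1] with [d = n.+2] and apply
    Hoelder's inequality, the conjugate exponent of [d] being the one of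
    [gagliardo_step]. *)
Lemma gagliardo_interpolation n (f : tup n.+1 -> R) p : line_bounded f p ->
  (\int[leb n.+1]_x (f x `^ (1 + n.+1%:R^-1))%:E <=
   total_integral p * (\int[leb n.+1]_x (f x)%:E) `^ n.+1%:R^-1)%E.
Proof.
elim: n => [|n IH] in f p *.
  move=> [mf mp f0 p0 fp]; rewrite invr1 poweRe1; last first.
    by apply: integral_ge0 => x _; rewrite lee_fin.
  have D_E : total_integral p = (\int[leb 1]_x (p ord0 x)%:E)%E.
    by rewrite /total_integral big_ord1.
  (* On the line [f] is bounded by [total_integral p], a number. *)
  have fD x : ((f x)%:E <= total_integral p)%E.
    rewrite D_E ge0_integral_cons_swap//; last 2 first.
    - exact/measurable_EFinP.
    - by move=> y; rewrite lee_fin.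
    rewrite integral_dirac//=; last first.
      apply: (measurable_fun_fubini_tonelli_G (m1 := lebesgue_measure) (fun z => (p ord0 (cons_pair z))%:E)).
        apply/measurable_EFinP; apply: (measurableT_comp (mp _)).
        exact: measurable_cons_pair.
      by move=> z; rewrite lee_fin.
    rewrite diracE in_setT mul1e.
    apply: (le_trans (fp ord0 x)); rewrite le_eqVlt; apply/orP; left; apply/eqP.
    apply: eq_integral => s _; congr (p _ _)%:E.
    apply: eq_from_tnth => j; rewrite tnth_mktuple (ord1 j).
    by rewrite tnth0.
  rewrite -ge0_integralZl//; last 3 first.
  - exact/measurable_EFinP.
  - by move=> x _; rewrite lee_fin.
  - exact: total_integral_ge0.
  apply: ge0_le_integral => //.
  - by move=> x _; rewrite lee_fin powR_ge0.
  - by apply/measurable_EFinP; exact: measurable_funpow.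
  - apply: emeasurable_funM; [exact: measurable_cst|exact/measurable_EFinP].
  - move=> x _; rewrite (_ : 1 + 1 = 2%:R :> R)// powR_mulrn// expr2 EFinM.
    by apply: lee_wpmul2r => //; rewrite lee_fin.
move=> fp; have [mf mp f0 p0 fple] := fp.
have Q := gagliardo_step IH fp.
set D := total_integral p in Q *.
have D0 : (0 <= D)%E by exact: total_integral_ge0.
pose q : R := 1 + n.+1%:R^-1; pose d : R := n.+2%:R.
have q0 : 0 < q by rewrite addr_gt0// invr_gt0.
have d0 : 0 < d by [].
have qd : q^-1 + d^-1 = 1.
  have aux (x : R) : 0 < x -> (1 + x^-1)^-1 + (x + 1)^-1 = 1.
    by move=> x0; field; rewrite !gt_eqF//= addr_gt0.
  by rewrite /q /d -(natr1 n.+1) aux.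
under eq_integral => x _.
  have -> : f x `^ (1 + d^-1) = f x * f x `^ d^-1.
    have [->|fx] := eqVneq (f x) 0; first by rewrite mul0r powR0// gt_eqF// addr_gt0// invr_gt0.
    by rewrite powRD ?powRr1//; apply/implyP.
  over.
have mfd : measurable_fun setT (fun x => f x `^ d^-1).
  exact: measurable_funpow.
apply: (le_trans (ge0_hoelder (leb n.+2) mf mfd f0 _ q0 d0 qd)).
  by move=> x; exact: powR_ge0.
apply: lee_pmul; rewrite ?poweR_ge0//.
  apply: (@le_trans _ _ ((D `^ q) `^ q^-1)%E).
    apply: le_poweR => //; first by rewrite invr_ge0 ltW.
    by apply: integral_ge0 => x _; rewrite lee_fin powR_ge0.
  by rewrite -poweRrM mulfV ?gt_eqF// poweRe1.
rewrite le_eqVlt; apply/orP; left; apply/eqP; congr (_ `^ _)%E.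
by apply: eq_integral => x _; rewrite -powRrM mulVf ?gt_eqF// powRr1.
Qed.

(** The Gagliardo-Nirenberg inequality in dimension [N = n.+2]: here
    [1 + n.+1%:R^-1] is [N / (N - 1)]. *)
Lemma gagliardo n (f : tup n.+2 -> R) p : line_bounded f p ->
  (\int[leb n.+2]_x (f x `^ (1 + n.+1%:R^-1))%:E <=
    total_integral p `^ (1 + n.+1%:R^-1))%E.
Proof. by move=> fp; apply: gagliardo_step fp => g q; exact: gagliardo_interpolation. Qed.

End tuple_measure.

(** * Lebesgue measure on row vectors *)

Section lebesgue_row.
Context {R : realType}.
Local Notation tup n := (n.-tuple (measurableTypeR R)).
Local Notation leb n := (@lebesgue_tuple R n).
Local Notation mu n := (@lebesgue_rV R n).

Definition tuple_of_row n (x : 'rV[R]_n) : tup n :=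
  [tuple (x 0 i : measurableTypeR R) | i < n].

Lemma row_of_tupleK n : cancel (@row_of_tuple R n) (@tuple_of_row n).
Proof.
by move=> t; apply: eq_from_tnth => i; rewrite tnth_mktuple mxE.
Qed.

Lemma tuple_of_rowK n : cancel (@tuple_of_row n) (@row_of_tuple R n).
Proof. by move=> x; apply/rowP => i; rewrite mxE tnth_mktuple. Qed.

Lemma preimage_row_tuple n (A : set (tup n)) :
  @row_of_tuple R n @^-1` (@tuple_of_row n @^-1` A) = A.
Proof.
by rewrite -comp_preimage (_ : _ \o _ = id)//; apply/funext => t /=;
  rewrite row_of_tupleK.
Qed.

Lemma measurable_tuple_of_row n : measurable_fun [set: 'rV[R]_n] (@tuple_of_row n).
Proof.
move=> _ A mA; rewrite setTI; rewrite /measurable/= /lebesgue_rV_measurable /=.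
by rewrite preimage_row_tuple; exact: caratheodory_measurable_mu_ext.
Qed.

Lemma lebesgue_rV_preimage n (A : set (tup n)) : measurable A ->
  mu n (@tuple_of_row n @^-1` A) = leb n A.
Proof.
move=> mA; rewrite /lebesgue_rV preimage_row_tuple.
exact: measurable_mu_extE.
Qed.

(** The measure on row vectors is a completion, but on the preimages of Borel sets
    it is the product measure.  Integrals of Borel functions can thus be computed
    on tuples, where Tonelli's theorem applies. *)
Lemma ge0_integral_rV n (F : 'rV[R]_n -> \bar R) :
  measurable_fun [set: tup n] (F \o @row_of_tuple R n) ->
  (forall x, 0 <= F x)%E ->
  (\int[mu n]_x F x = \int[leb n]_t F (row_of_tuple t))%E.
Proof.
move=> mF F0.
have -> : (\int[leb n]_t F (row_of_tuple t) =
    \int[pushforward (mu n) (@tuple_of_row n)]_t F (row_of_tuple t))%E.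
  apply: eq_measure_integral; first exact: measurable_tuple_of_row.
  by move=> mF' A mA _; rewrite /= /pushforward lebesgue_rV_preimage.
rewrite [RHS]ge0_integral_pushforward//; last exact: measurable_tuple_of_row.
rewrite preimage_setT; apply: eq_integral => x _ /=.
by rewrite tuple_of_rowK.
Qed.

Definition rational_box n (q : 'rV[rat]_n * nat) : set (tup n) :=
  \bigcap_(i in [set: 'I_n]) [set t | `|ratr (q.1 0 i) - tnth t i| < q.2.+1%:R^-1].

(** An open set is the union of the countably many rational boxes inside it. *)
Lemma measurable_row_of_tuple_open n (U : set 'rV[R]_n) : open U ->
  measurable (@row_of_tuple R n @^-1` U : set (tup n)).
Proof.
move=> oU.
pose F q := if `[< rational_box q `<=` @row_of_tuple R n @^-1` U >]
  then rational_box q else set0.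
have -> : @row_of_tuple R n @^-1` U = \bigcup_(q in [set: 'rV[rat]_n * nat]) F q.
  apply/seteqP; split => [t Ut|t [q _]]; last first.
    by rewrite /F; case: ifPn => // /asboolP /[apply].
  have /nbhs_ballP[e /= e0 eU] : nbhs (row_of_tuple t) U by exact: open_nbhs_nbhs.
  have [k ke] : exists k : nat, k.+1%:R^-1 < e / 2.
    have e20 : 0 < e / 2 by rewrite divr_gt0.
    have := cvgr_lt 0 (@cvg_harmonic R) _ e20.
    by case=> k _ /(_ k (leqnn _)); exists k.
  have k0 : (0 : R) < k.+1%:R^-1 by rewrite invr_gt0.
  have /choice[q qP] : forall i : 'I_n, exists q : rat, `|ratr q - tnth t i| < k.+1%:R^-1 :> R.
    move=> i; have [|q] := @rat_in_itvoo R (tnth t i - k.+1%:R^-1) (tnth t i + k.+1%:R^-1).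
      by rewrite ltrD2l (lt_trans _ k0)// oppr_lt0.
    by rewrite in_itv/= => qi; exists q; rewrite ltr_distl.
  exists (\row_i q i, k) => //; rewrite /F; case: ifPn => [_|/asboolP]; last first.
    move=> nb; exfalso; apply: nb => s /= sb; apply: eU.
    split => // i j; rewrite (ord1 i) !mxE.
    have := sb j I; rewrite /= mxE => sj; have tj := qP j.
    rewrite /ball/= (_ : _ - _ = - (ratr (q j) - tnth t j) + (ratr (q j) - tnth s j)); last by rewrite opprB addrA subrK.
    rewrite (le_lt_trans (ler_normD _ _))// normrN.
    by rewrite (splitr e) ltrD// (lt_trans _ ke).
  by move=> i _ /=; rewrite mxE.
apply: countable_bigcupT_measurable => [|q].
  exact: countableP.
rewrite /F; case: ifPn => _ //.
apply: fin_bigcap_measurable => [|i _]; first exact: finite_finset.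
have mt := @measurable_tnth _ (measurableTypeR R) n i.
rewrite -[X in measurable X]setTI.
apply: (mt measurableT [set s | `|ratr (q.1 0 i) - s| < q.2.+1%:R^-1]).
rewrite (_ : [set s | _] = ball (ratr (q.1 0 i) : R) (q.2.+1%:R^-1))//.
exact: open_measurable (ball_open _ _).
Qed.

Lemma open_measurable_rV n (U : set 'rV[R]_n) : open U -> measurable U.
Proof.
move=> oU; have := @measurable_tuple_of_row n measurableT _ (measurable_row_of_tuple_open oU).
by rewrite setTI -comp_preimage (_ : _ \o _ = id)//; apply/funext => x /=;
  rewrite tuple_of_rowK.
Qed.

Lemma continuous_measurable_tuple n (f : 'rV[R]_n -> R) : continuous f ->
  measurable_fun [set: tup n] (f \o @row_of_tuple R n).
Proof.
move=> cf; apply: (measurability _ (RGenOpens.measurableE R)).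
move=> _ [_ [a [b ->] <-]]; rewrite setTI comp_preimage.
by apply: measurable_row_of_tuple_open; apply: open_comp => // x _; exact: cf.
Qed.

Lemma continuous_measurable_rV n (f : 'rV[R]_n -> R) : continuous f ->
  measurable_fun [set: 'rV[R]_n] f.
Proof.
move=> cf; rewrite (_ : f = (f \o @row_of_tuple R n) \o @tuple_of_row n).
  exact: measurableT_comp (continuous_measurable_tuple cf) (@measurable_tuple_of_row n).
by apply/funext => x /=; rewrite tuple_of_rowK.
Qed.

Definition cube n (M : R) : set (tup n) := [set t | forall i, `|tnth t i| <= M].

Lemma measurable_cube n M : measurable (@cube n M).
Proof.
rewrite (_ : @cube n M = \bigcap_(i in [set: 'I_n]) [set t | `|tnth t i| <= M]).
  apply: fin_bigcap_measurable => [|i _]; first exact: finite_finset.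
  have mt := @measurable_tnth _ (measurableTypeR R) n i.
  rewrite -[X in measurable X]setTI.
  apply: (mt measurableT [set s | `|s| <= M]).
  rewrite (_ : [set s | _] = `[- M, M]%classic); first exact: measurable_itv.
  by apply/seteqP; split => s /=; rewrite in_itv/= ler_norml.
by apply/seteqP; split => t /= tM i; [move=> _|]; exact: tM.
Qed.

Lemma lebesgue_cube_lty n M : (leb n (@cube n M) < +oo)%E.
Proof.
elim: n => [|n IH]; first by rewrite /= diracE ltry.
rewrite /= /cons_measure /pushforward.
rewrite (_ : _ @^-1` _ = `[- M, M]%classic `*` @cube n M); last first.
  apply/seteqP; split => -[s t] /=.
    move=> stM; split; first by have := stM ord0; rewrite tnth0 in_itv/= ler_norml.
    by move=> i; have := stM (lift ord0 i); rewrite tnthS.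
  move=> [sM tM] i; have [->|] := eqVneq i ord0.
    by rewrite tnth0 ler_norml; move: sM; rewrite in_itv.
  by rewrite eq_sym => /unlift_some[k -> _]; rewrite tnthS.
rewrite product_measure1E//; last exact: measurable_cube.
rewrite lte_mul_pinfty// ?ge0_fin_numE//.
have := lebesgue_measure_itv `[- M, M]; rewrite /= => ->.
by case: ifPn => _; rewrite ltry.
Qed.

Lemma bounded_lebesgue_lty n (A : set 'rV[R]_n) : measurable A ->
  bounded_set A -> (mu n A < +oo)%E.
Proof.
move=> mA [M [_ /(_ (M + 1))]]; rewrite ltrDl ltr01 => /(_ isT) AM.
apply: (@le_lt_trans _ _ (mu n (@tuple_of_row n @^-1` @cube n (M + 1)))).
  apply: le_measure; rewrite ?inE//.
    by have := @measurable_tuple_of_row n measurableT _ (@measurable_cube n (M + 1)); rewrite setTI.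
  move=> x /AM xM i; rewrite /= tnth_mktuple; apply: le_trans xM.
  rewrite [leRHS]/Num.Def.normr/= mx_normrE.
  by apply: (le_trans _ (le_bigmax _ _ (0, i))).
by rewrite lebesgue_rV_preimage ?lebesgue_cube_lty//; exact: measurable_cube.
Qed.

End lebesgue_row.

(** * Functions of class C^k and the softplus truncation *)

Section directional.
Context {R : realType} {V : normedModType R}.
Implicit Types (f g : V -> R) (x v : V).

Lemma is_derive_line f x v (s : R) : derivable f (s *: v + x) v ->
  is_derive s 1 (fun r : R => f (r *: v + x)) ('D_v f (s *: v + x)).
Proof.
move=> df.
have E : (fun h : R => h^-1 *: (((fun r : R => f (r *: v + x)) \o shift s) (h *: 1) -
      f (s *: v + x))) =
    (fun h => h^-1 *: ((f \o shift (s *: v + x)) (h *: v) - f (s *: v + x))).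
  apply/funext => h /=; congr (_ *: (f _ - _)).
  by rewrite [h%:A]mulr1 scalerDl addrA.
split; first by rewrite /derivable E.
by rewrite /derive E.
Qed.

(** The inner function is only known to be derivable in the direction [v], so the
    chain rule is applied on the line through [x] in that direction. *)
Lemma is_derive_comp1 (G : R -> R) f x v (dG df : R) :
  is_derive (f x) 1 G dG -> is_derive x v f df ->
  is_derive x v (G \o f) (dG * df).
Proof.
move=> dGf [dfx <-].
have dl : is_derive (0 : R) 1 (fun r : R => f (r *: v + x)) ('D_v f x).
  have := @is_derive_line f x v 0; rewrite scale0r add0r; exact.
have := @is_derive1_comp _ G (fun r : R => f (r *: v + x)) 0 dG ('D_v f x).
rewrite scale0r add0r => /(_ dGf dl) [dc vc].
split; first exact: ((@derivable1P _ _ _ (G \o f) x v).2 dc).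
rewrite -vc /derive; set q1 := fun h => h^-1 *: _; set q2 := fun h => h^-1 *: _.
suff -> : q1 = q2 by [].
by apply/funext => h; rewrite /q1 /q2 /= addr0 scale0r add0r [h%:A]mulr1.
Qed.

Lemma is_derive_mul f g x v (df dg : R) : is_derive x v f df ->
  is_derive x v g dg -> is_derive x v (f \* g) (f x * dg + df * g x).
Proof.
move=> [Df <-] [Dg <-]; split; first exact: derivableM.
by rewrite (deriveM Df Dg) [_ *: _]mulrC [g x *: _]mulrC mulrC.
Qed.

End directional.

Section Ck_calculus.
Context {R : realType} (n : nat).
Implicit Types f g : 'rV[R]_n -> R.

Lemma Ck_continuous k f : Ck k f -> continuous f.
Proof. by case: k => [[]|k []]. Qed.

Lemma Ck_derivable k f : Ck k.+1 f -> forall i x, derivable f x (delta_mx 0 i).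
Proof. by move=> [_ +] i x => /(_ i)[]. Qed.

Lemma Ck_partial k f i : Ck k.+1 f -> Ck k (partial i f).
Proof. by move=> [_ /(_ i)[]]. Qed.

Lemma CkW k f : Ck k.+1 f -> Ck k f.
Proof.
elim: k f => [|k IH] f [cf df]; first by [].
by split=> // i; have [di Ci] := df i; split=> //; exact: IH.
Qed.

Lemma CkS k f (Df : 'I_n -> 'rV[R]_n -> R) : continuous f ->
  (forall i x, is_derive x (delta_mx 0 i) f (Df i x)) ->
  (forall i, Ck k (Df i)) -> Ck k.+1 f.
Proof.
move=> cf dDf CDf; split=> // i; split=> [x|]; first by case: (dDf i x).
by rewrite (_ : partial i f = Df i)//; apply/funext => x; case: (dDf i x).
Qed.

Lemma Ck_cst k (c : R) : Ck k (cst c : 'rV[R]_n -> R).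
Proof.
elim: k c => [|k IH] c; first by split=> //; exact: cst_continuous.
by apply: (@CkS _ _ (fun=> cst 0)) => [|i]; [exact: cst_continuous|exact: IH].
Qed.

Lemma CkD k f g : Ck k f -> Ck k g -> Ck k (f \+ g).
Proof.
elim: k f g => [|k IH] f g.
  by move=> [cf _] [cg _]; split=> // x; apply: continuousD; [exact: cf|exact: cg].
move=> Cf Cg; apply: (@CkS _ _ (fun i => partial i f \+ partial i g)) => [x|i x|i].
- by apply: continuousD; [exact: (Ck_continuous Cf)|exact: (Ck_continuous Cg)].
- by apply: is_deriveD; apply/derivableP/Ck_derivable; eassumption.
- by apply: IH; exact: Ck_partial.
Qed.

Lemma CkM k f g : Ck k f -> Ck k g -> Ck k (f \* g).
Proof.
elim: k f g => [|k IH] f g.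
  by move=> [cf _] [cg _]; split=> // x; apply: continuousM; [exact: cf|exact: cg].
move=> Cf Cg; apply: (@CkS _ _ (fun i => (f \* partial i g) \+ (partial i f \* g))) => [x|i x|i].
- by apply: continuousM; [exact: (Ck_continuous Cf)|exact: (Ck_continuous Cg)].
- by apply: is_derive_mul; apply/derivableP/Ck_derivable; eassumption.
- by apply: CkD; apply: IH => //; by [exact: CkW|exact: Ck_partial].
Qed.

End Ck_calculus.

Section softplus.
Context {R : realType}.
Variables (k e : R).
Hypothesis e0 : 0 < e.

(** [softplus k e] is a smooth stand-in for the truncation [Num.max (t - k) 0], to
    which it tends as [e] tends to [0]; [sigmoid k e] is its derivative.  Being
    smooth, it maps test functions to test functions once its value at [0] is
    subtracted. *)
Definition softexp (t : R) : R := expR ((t - k) / e).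
Definition sigmoid (t : R) : R := 1 - (1 + softexp t)^-1.
Definition softplus (t : R) : R := e * ln (1 + softexp t).

Let softexp1_gt0 t : 0 < 1 + softexp t.
Proof. by rewrite addr_gt0 ?expR_gt0. Qed.

Lemma is_derive_softexp t : is_derive t (1 : R) softexp (softexp t / e).
Proof.
have H : is_derive t (1 : R) (fun t : R => (t - k) / e) e^-1.
  rewrite (_ : (fun t : R => (t - k) / e) = e^-1 \*: (id \- cst k)); last first.
    by apply/funext => s /=; rewrite mulrC.
  by apply: is_derive_eq; rewrite subr0 /GRing.scale/= mulr1.
exact: is_derive1_comp.
Qed.

Lemma is_derive_softexp1 t : is_derive t (1 : R) (fun s => 1 + softexp s) (softexp t / e).
Proof.
have := is_derive_softexp t => H.
by rewrite -[X in is_derive _ _ _ X]add0r; exact: is_deriveD.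
Qed.

Lemma is_derive_sigmoid t : is_derive t (1 : R) sigmoid (sigmoid t * (1 - sigmoid t) / e).
Proof.
have H := is_derive_softexp1 t.
have n0 := lt0r_neq0 (softexp1_gt0 t).
have HV := @is_deriveV _ (fun s => 1 + softexp s) t _ 1 n0 H.
have := is_deriveB (is_derive_cst (1 : R) (t : R) (1 : R)) HV.
move/is_derive_eq; apply.
rewrite /sigmoid sub0r scaleNr opprK [_ *: _]mulrC -exprVn.
have := e0; move: n0; generalize (softexp t) => z n0 ?; field.
by rewrite n0 gt_eqF.
Qed.

Lemma is_derive_softplus t : is_derive t (1 : R) softplus (sigmoid t).
Proof.
have H := is_derive_softexp1 t.
have Hl := @is_derive1_comp _ (@ln R) (fun s => 1 + softexp s) t _ _ (is_derive1_ln (softexp1_gt0 t)) H.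
have := is_deriveZ e Hl; move/is_derive_eq; apply.
rewrite /sigmoid /GRing.scale/=.
have := e0; have := lt0r_neq0 (softexp1_gt0 t); generalize (softexp t) => z n0 ?; field.
by rewrite n0 gt_eqF.
Qed.

Lemma continuous_sigmoid : continuous sigmoid.
Proof.
move=> t; apply: differentiable_continuous; apply/derivable1_diffP.
by case: (is_derive_sigmoid t).
Qed.

Lemma continuous_softplus : continuous softplus.
Proof.
move=> t; apply: differentiable_continuous; apply/derivable1_diffP.
by case: (is_derive_softplus t).
Qed.

Lemma sigmoid_ge0 t : 0 <= sigmoid t.
Proof. by rewrite subr_ge0 invf_le1// lerDl ltW// expR_gt0. Qed.

Lemma sigmoid_le1 t : sigmoid t <= 1.
Proof. by rewrite gerBl invr_ge0 ltW. Qed.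

Lemma sigmoid_ge_half t : k <= t -> 2^-1 <= sigmoid t.
Proof.
move=> kt; rewrite lerBrDr -lerBrDl (_ : 1 - 2^-1 = 2^-1 :> R); last by field.
rewrite lef_pV2 ?posrE// -[2]/(1 + 1) lerD2l.
by rewrite -expR0 ler_expR divr_ge0 ?subr_ge0// ltW.
Qed.

Lemma softplus_ge0 t : 0 <= softplus t.
Proof. by rewrite mulr_ge0 ?ln_ge0 ?lerDl ?ltW ?expR_gt0. Qed.

Lemma softplus_le t : softplus t <= Num.max (t - k) 0 + e * ln 2.
Proof.
have E0 : 0 < softexp t by exact: expR_gt0.
have [kt|tk] := leP k t.
  rewrite max_l ?subr_ge0//.
  have E1 : 1 <= softexp t by rewrite -expR0 ler_expR divr_ge0 ?subr_ge0// ltW.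
  apply: (@le_trans _ _ (e * ln (softexp t * 2))).
    rewrite /softplus ler_pM2l// ler_ln ?posrE ?mulr_gt0//; lra.
  by rewrite lnM ?posrE// mulrDr expRK mulrC divfK// gt_eqF.
rewrite max_r ?subr_le0 ?(ltW tk)// add0r /softplus ler_pM2l// ler_ln ?posrE//.
rewrite -[2]/(1 + 1) lerD2l -expR0 ler_expR.
by rewrite pmulr_lle0 ?invr_gt0// subr_le0 ltW.
Qed.

Lemma softplus_lipschitz s t : `|softplus s - softplus t| <= `|s - t|.
Proof.
wlog st : s t / s <= t.
  by move=> H; have [/H//|/ltW/H] := leP s t; rewrite distrC (distrC t).
have [||c _ E] := @MVT_segment _ softplus sigmoid s t st.
- by move=> x _; exact: is_derive_softplus.
- by apply: continuous_subspaceT; exact: continuous_softplus.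
rewrite distrC E normrM (distrC s t) ger0_norm ?sigmoid_ge0//.
by rewrite -[leRHS]mul1r ler_wpM2r ?sigmoid_le1.
Qed.

Variable n : nat.
Implicit Types f : 'rV[R]_n -> R.

(** All derivatives of the sigmoid are polynomials in the sigmoid itself; this
    makes the induction on the order of smoothness go through. *)
Lemma Ck_sigmoid_poly j (p : {poly R}) f : Ck j f ->
  Ck j (fun x => p.[sigmoid (f x)]).
Proof.
elim: j p f => [|j IH] p f Cf.
  split=> // x; apply: (continuous_comp (f := sigmoid \o f) (g := horner p)).
    apply: continuous_comp; first exact: (Ck_continuous Cf).
    exact: continuous_sigmoid.
  exact: continuous_horner.
pose q : {poly R} := p^`() * ('X * (1 - 'X)) * (e^-1)%:P.
apply: (@CkS _ _ _ _ (fun i => (fun x => q.[sigmoid (f x)]) \* partial i f)).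
- move=> x; apply: (continuous_comp (f := sigmoid \o f) (g := horner p)).
    apply: continuous_comp; first exact: (Ck_continuous Cf).
    exact: continuous_sigmoid.
  exact: continuous_horner.
- move=> i x.
  have H1 : is_derive (sigmoid (f x)) 1 (horner p) (p^`()).[sigmoid (f x)].
    by split; [exact: derivable_horner|rewrite -derive1E derivE].
  have H2 := is_derive1_comp H1 (is_derive_sigmoid (f x)).
  apply: (is_derive_eq (is_derive_comp1 H2 (derivableP (@Ck_derivable _ _ _ _ Cf i x)))).
  by rewrite /= /q !(hornerM, hornerD, hornerN, hornerC, hornerX) /partial; ring.
- by move=> i; apply: CkM; [apply: IH; exact: CkW|exact: Ck_partial].
Qed.

Lemma Ck_softplus j f : Ck j f -> Ck j (softplus \o f).
Proof.
case: j => [|j] Cf.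
  split=> // x; apply: continuous_comp; first exact: (Ck_continuous Cf).
  exact: continuous_softplus.
apply: (@CkS _ _ _ _ (fun i => (sigmoid \o f) \* partial i f)).
- move=> x; apply: continuous_comp; first exact: (Ck_continuous Cf).
  exact: continuous_softplus.
- move=> i x; apply: is_derive_comp1; first exact: is_derive_softplus.
  exact/derivableP/(Ck_derivable Cf).
- move=> i; apply: CkM; last exact: Ck_partial.
  rewrite (_ : _ \o _ = fun x => 'X.[sigmoid (f x)]).
    by apply: Ck_sigmoid_poly; exact: CkW.
  by apply/funext => x; rewrite hornerX.
Qed.

End softplus.

(** * Calculus on the line *)

Section one_dimension.
Context {R : realType}.
Local Notation lam := (@lebesgue_measure R).
Implicit Types (f df : R -> R).

Lemma continuous_pospow (a : R) : 0 <= a ->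
  continuous (fun t : R => Num.max t 0 `^ a).
Proof.
rewrite le_eqVlt => /predU1P[<-|a0] t.
  under eq_fun do rewrite powRr0; exact: cvg_cst.
have [t0|t0] := ltP 0 t.
  have ct : {for t, continuous (@powR R ^~ a)}.
    apply: differentiable_continuous; apply/derivable1_diffP.
    by case: (@is_derive1_powR R a t t0).
  rewrite /continuous_at max_l ?(ltW t0)//; apply: cvg_trans ct; apply: near_eq_cvg.
  by near=> s; rewrite max_l// ltW//; near: s; exact: lt_nbhsr.
rewrite /continuous_at max_r// powR0 ?gt_eqF//; apply/cvgrPdist_lt => e e0.
near=> s; rewrite sub0r normrN ger0_norm ?powR_ge0//.
have -> : e = (e `^ a^-1) `^ a by rewrite -powRrM mulVf ?gt_eqF// powRr1 ?ltW.
apply: gt0_ltr_powR => //; rewrite ?nnegrE ?powR_ge0 ?le_max ?lexx ?orbT//.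
rewrite gt_max powR_gt0// andbT.
near: s; apply: lt_nbhsl; apply: le_lt_trans t0 _; exact: powR_gt0.
Unshelve. all: by end_near. Qed.

Lemma is_derive_pospow (a t : R) : 0 < t ->
  is_derive t (1 : R) (fun s : R => Num.max s 0 `^ a) (a * Num.max t 0 `^ (a - 1)).
Proof.
move=> t0; rewrite max_l ?(ltW t0)//.
apply: (near_eq_is_derive (f := @powR R ^~ a)); last exact: is_derive1_powR.
by near=> s; rewrite max_l// ltW//; near: s; exact: lt_nbhsr.
Unshelve. all: by end_near. Qed.

Lemma is_derive_continuous f df :
  (forall s : R, is_derive s (1 : R) f (df s)) -> continuous f.
Proof.
by move=> fdf s; apply: differentiable_continuous; apply/derivable1_diffP; case: (fdf s).
Qed.

Lemma FTC_is_derive f df a b : a < b ->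
  (forall s : R, s \in `]a, b[ -> is_derive s (1 : R) f (df s)) -> continuous f -> continuous df ->
  (\int[lam]_(s in `[a, b]) (df s)%:E = (f b)%:E - (f a)%:E)%E.
Proof.
move=> ab fdf cf cdf.
apply: continuous_FTC2 => //; first exact: continuous_subspaceT.
  split => [s sab||]; first by case: (fdf s sab).
    by apply: cvg_at_right_filter; exact: cf.
  by apply: cvg_at_left_filter; exact: cf.
by move=> s sab; rewrite derive1E; case: (fdf s sab).
Qed.

(** Integrating back from [s0] to the last time [f] was at most [k] avoids
    differentiating the positive part at its kink. *)
Lemma pospow_le_integral f df (k a s0 : R) :
  (forall s : R, is_derive s (1 : R) f (df s)) -> continuous df -> 1 <= a ->
  (exists2 s, s <= s0 & f s <= k) ->
  ((Num.max (f s0 - k) 0 `^ a)%:E <= \int[lam]_s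
    (if k <= f s then a * Num.max (f s - k) 0 `^ (a - 1) * `|df s| else 0)%:E)%E.
Proof.
move=> fdf cdf a1 [sk sks0 fsk].
have a0 : 0 < a by exact: lt_le_trans a1.
have cf := is_derive_continuous fdf.
pose p (s : R) := if k <= f s then a * Num.max (f s - k) 0 `^ (a - 1) * `|df s| else 0.
rewrite -[leRHS]/(\int[lam]_s (p s)%:E)%E.
have p0 s : (0 <= (p s)%:E)%E.
  by rewrite lee_fin /p; case: ifPn => // _; rewrite !mulr_ge0 ?powR_ge0// ltW.
have [fs0|fs0] := leP (f s0) k.
  rewrite max_r ?subr_le0// powR0 ?gt_eqF//.
  by apply: integral_ge0 => s _; exact: p0.
pose S := [set s | s <= s0 /\ f s <= k].
have supS : has_sup S by split; [exists sk|exists s0 => s []].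
pose s1 := sup S.
have fs1 : f s1 <= k.
  rewrite leNgt; apply/negP => kf.
  have /nbhs_ballP[e /= e0 eb] : \forall s \near s1, k < f s.
    by apply: (cvgr_gt _ (cf s1)).
  have [s [ss0 fs] ss1] := sup_adherent e0 supS.
  have ss : s <= s1 by apply: sup_upper_bound.
  have : k < f s.
    by apply: eb; rewrite /ball/= ger0_norm ?subr_ge0// ltrBlDr addrC -ltrBlDr.
  by rewrite ltNge fs.
have s1s0 : s1 < s0.
  rewrite lt_neqAle; apply/andP; split; last by apply: ge_sup => [|s []//]; exists sk.
  by apply: contraTneq fs1 => ->; rewrite -ltNge.
have fk s : s1 < s -> s <= s0 -> k < f s.
  move=> s1s ss0; rewrite ltNge; apply/negP => fs; move: s1s; rewrite ltNge => /negP; apply.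
  by apply: sup_upper_bound.
have cfk : continuous (fun s => f s - k) by move=> s; apply: cvgB; [exact: cf|exact: cvg_cst].
have cpow b : 0 <= b -> continuous (fun s => Num.max (f s - k) 0 `^ b).
  move=> b0 s; apply: (continuous_comp (f := fun s => f s - k) (g := fun t => Num.max t 0 `^ b)).
    exact: cfk.
  exact: continuous_pospow.
pose q s := a * Num.max (f s - k) 0 `^ (a - 1) * df s.
have cq : continuous q.
  move=> s; apply: cvgM; last exact: cdf.
  by apply: cvgM; [exact: cvg_cst|apply: cpow; rewrite subr_ge0].
have dF s : s \in `]s1, s0[ -> is_derive s (1 : R) (fun s => Num.max (f s - k) 0 `^ a) (q s).
  rewrite in_itv/= => /andP[s1s ss0].
  have fs : 0 < f s - k by rewrite subr_gt0; apply: fk => //; exact: ltW.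
  have H : is_derive s (1 : R) (fun s => f s - k) (df s).
    by rewrite -[df s]subr0; apply: is_deriveB.
  exact: (@is_derive1_comp _ (fun t : R => Num.max t 0 `^ a) (fun s : R => f s - k) s _ _ (is_derive_pospow a fs) H).
have := FTC_is_derive s1s0 dF (cpow a (ltW a0)) cq.
rewrite [X in (_ - X%:E)%E](_ : _ = 0); last by rewrite max_r ?subr_le0// powR0// gt_eqF.
rewrite sube0 => <-.
have mq : measurable_fun setT q by exact: continuous_measurable_fun.
have mp : measurable_fun setT p.
  apply: measurable_fun_ifT => //.
  - by apply: measurable_fun_ler => //; exact: continuous_measurable_fun.
  - apply: measurable_funM; last by apply: measurableT_comp => //; exact: continuous_measurable_fun.
    apply: measurable_funM => //; apply: continuous_measurable_fun; apply: cpow.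
    by rewrite subr_ge0.
rewrite -(@integral_itv_obnd_cbnd _ s1 (BRight s0)); last first.
  by apply/measurable_EFinP; exact: measurable_funTS.
apply: (@le_trans _ _ (\int[lam]_(s in `]s1, s0]) (p s)%:E)%E); last first.
  by apply: ge0_subset_integral => //; exact/measurable_EFinP.
have -> : (\int[lam]_(s in `]s1, s0]) (p s)%:E = \int[lam]_(s in `]s1, s0]) `|(q s)%:E|)%E.
  apply: eq_integral => s; rewrite inE/= in_itv/= => /andP[s1s ss0].
  rewrite /p ltW ?fk//= /q normrM [in RHS](ger0_norm (x := a * _))//.
  by rewrite mulr_ge0 ?powR_ge0// ltW.
apply: (le_trans (lee_abs _)); apply: le_abse_integral => //.
by apply/measurable_EFinP; exact: measurable_funTS.
Qed.

(** The integral of the derivative of a compactly supported function vanishes;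
    the two parts are separated because Tonelli's theorem is about nonnegative
    functions. *)
Lemma integral_derive_parts f df (M : R) :
  (forall s : R, is_derive s (1 : R) f (df s)) -> continuous df ->
  (forall s, M <= `|s| -> f s = 0) -> (forall s, M <= `|s| -> df s = 0) -> 0 < M ->
  (\int[lam]_s (Num.max (df s) 0)%:E = \int[lam]_s (Num.max (- df s) 0)%:E)%E.
Proof.
move=> fdf cdf fM dfM M0.
have cf := is_derive_continuous fdf.
have ab : - M < M by lra.
have := FTC_is_derive ab (fun s _ => fdf s) cf cdf.
rewrite !fM ?normrN ?ger0_norm ?(ltW M0)// subee//.
have out (h : R -> R) : (forall s, M <= `|s| -> h s = 0) ->
    (\int[lam]_s (h s)%:E = \int[lam]_(s in `[(- M)%R, M]) (h s)%:E)%E.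
  move=> hM; rewrite [RHS]integral_mkcond; apply: eq_integral => s _.
  rewrite patchE; case: ifPn => // /negP; rewrite inE/= in_itv/= => /negP.
  by rewrite -ler_norml -ltNge => /ltW/hM ->.
rewrite out => [|s /dfM ->]; last by rewrite maxxx.
rewrite [in X in _ -> _ = X]out => [|s /dfM ->]; last by rewrite oppr0 maxxx.
rewrite integralE => /eqP.
have fin : lam.-integrable `[- M, M] (EFin \o df).
  apply: continuous_compact_integrable; first exact: segment_compact.
  exact: continuous_subspaceT.
have /integrable_pos_fin_num fp := fin.
have /integrable_neg_fin_num fn := fin.
rewrite sube_eq//; last exact: fp.
rewrite [X in _ == X -> _]add0e => /eqP E.
transitivity (\int[lam]_(s in `[(- M)%R, M]) (EFin \o df)^\+ s)%E.
  by apply: eq_integral => s _; rewrite funeposE/= EFin_max.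
rewrite E; apply: eq_integral => s _; by rewrite funenegE/= EFin_max.
Qed.

End one_dimension.

(** * Test functions and integration by parts *)

Section test_functions.
Context {R : realType} (n : nat) (Om : set 'rV[R]_n).
Implicit Types f g : 'rV[R]_n -> R.
Local Notation tup n := (n.-tuple (measurableTypeR R)).
Local Notation mu := (@lebesgue_rV R n).

Lemma test_eq0 f x : ~ closure [set x | f x != 0] x -> f x = 0.
Proof.
by move=> cx; apply/eqP; apply: contra_notT cx => fx; exact: subset_closure.
Qed.

Lemma test_partial_eq0 f i x : ~ closure [set x | f x != 0] x -> partial i f x = 0.
Proof.
move=> cx; rewrite /partial (@near_eq_derive _ _ _ f (cst 0)) ?derive_cst//.
have oc : open (~` closure [set x | f x != 0]).
  by apply: closed_openC; exact: closed_closure.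
have := open_nbhs_nbhs (conj oc cx).
by apply: filterS => y /test_eq0.
Qed.

Lemma test_out f x : test_function Om f -> ~ Om x -> f x = 0.
Proof. by move=> [_ _ sub] nx; apply: test_eq0 => /sub. Qed.

Lemma test_partial_out f i x : test_function Om f -> ~ Om x -> partial i f x = 0.
Proof. by move=> [_ _ sub] nx; apply: test_partial_eq0 => /sub. Qed.

Lemma test_smooth f k : test_function Om f -> Ck k f.
Proof. by move=> [+ _ _] => /(_ k). Qed.

Lemma test_continuous f : test_function Om f -> continuous f.
Proof. by move=> /(test_smooth 0)/Ck_continuous. Qed.

Lemma test_partial_continuous f i : test_function Om f -> continuous (partial i f).
Proof. by move=> /(test_smooth 1)/(@Ck_partial _ _ _ _ i)/Ck_continuous. Qed.

Lemma test_is_derive f i x : test_function Om f ->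
  is_derive x (delta_mx 0 i) f (partial i f x).
Proof. by move=> /(test_smooth 1) Cf; exact/derivableP/(Ck_derivable Cf). Qed.

Lemma compact_support_bounded (K : set 'rV[R]_n) f : compact K -> continuous f ->
  (forall x, ~ K x -> f x = 0) -> exists2 B : R, 0 < B & forall x, `|f x| <= B.
Proof.
move=> cK cf f0; have : compact (f @` K).
  by apply: continuous_compact => //; exact: continuous_subspaceT.
move=> /compact_bounded[B [_ /(_ (`|B| + 1))]].
have B1 : B < `|B| + 1 by rewrite (le_lt_trans (ler_norm _))// ltrDl.
move=> /(_ B1) KB; exists (`|B| + 1) => [|x]; first by rewrite ltr_wpDl.
have [Kx|/f0 ->] := pselect (K x); first by apply: KB; exists x.
by rewrite normr0 addr_ge0.
Qed.

Lemma test_bounded f : test_function Om f -> exists2 B : R, 0 < B & forall x, `|f x| <= B.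
Proof.
move=> tf; have [_ cK _] := tf.
apply: (compact_support_bounded cK (test_continuous tf)) => x; exact: test_eq0.
Qed.

Lemma test_partial_bounded f i : test_function Om f ->
  exists2 B : R, 0 < B & forall x, `|partial i f x| <= B.
Proof.
move=> tf; have [_ cK _] := tf.
apply: (compact_support_bounded cK (test_partial_continuous (i := i) tf)) => x.
exact: test_partial_eq0.
Qed.

Lemma test_support_radius f : test_function Om f -> exists2 M : R, 0 < M &
  forall x, M <= `|x| -> f x = 0 /\ forall i, partial i f x = 0.
Proof.
move=> [_ cK _]; have /compact_bounded[B [_ /(_ (`|B| + 1))]] := cK.
have B1 : B < `|B| + 1 by rewrite (le_lt_trans (ler_norm _))// ltrDl.
move=> /(_ B1) KB; exists (`|B| + 2) => [|x Mx]; first by rewrite ltr_wpDl.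
suff cx : ~ closure [set x | f x != 0] x.
  by split=> [|i]; [exact: test_eq0|exact: test_partial_eq0].
by move=> /KB/= xB; have := le_trans Mx xB; rewrite lerD2l; lra.
Qed.

Lemma test_function_sub f g : smooth g -> test_function Om f ->
  (forall x, f x = 0 -> g x = 0) -> test_function Om g.
Proof.
move=> sg [_ cK KOm] fg.
have sub : closure [set x | g x != 0] `<=` closure [set x | f x != 0].
  by apply: closureS => x /=; apply: contra_neq; exact: fg.
split => //; last exact: subset_trans KOm.
by apply: subclosed_compact cK sub; exact: closed_closure.
Qed.

Lemma test_functionM f g : test_function Om f -> test_function Om g ->
  test_function Om (f \* g).
Proof.
move=> tf tg; apply: (test_function_sub _ tf) => [k|x /= ->]; last by rewrite mul0r.
by apply: CkM; exact: test_smooth.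
Qed.

Lemma test_function_softplus f k e : 0 < e -> test_function Om f ->
  test_function Om (fun x => softplus k e (f x) - softplus k e 0).
Proof.
move=> e0 tf; apply: (test_function_sub _ tf) => [j|x ->]; last by rewrite subrr.
apply: (@CkD _ _ _ (softplus k e \o f) (cst (- softplus k e 0))).
  by apply: Ck_softplus => //; exact: test_smooth.
exact: Ck_cst.
Qed.

Lemma test_softplus_partial f k e i x : 0 < e -> test_function Om f ->
  partial i (fun x => softplus k e (f x) - softplus k e 0) x =
  sigmoid k e (f x) * partial i f x.
Proof.
move=> e0 tf.
have H := is_derive_comp1 (is_derive_softplus k e0 (f x)) (test_is_derive i x tf).
have [_ ] := is_deriveB H (is_derive_cst (softplus k e 0) x (delta_mx 0 i)).
by rewrite subr0.
Qed.

Lemma row_of_set_entry (t : tup n) i s :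
  row_of_tuple (set_entry t i s) = s *: delta_mx 0 i + row_of_tuple (set_entry t i 0).
Proof.
apply/rowP => j; rewrite !mxE !tnth_mktuple eqxx/=.
by case: eqP => _; rewrite ?mulr1 ?addr0// mulr0 add0r.
Qed.

Lemma set_entry_id (t : tup n) i : set_entry t i (tnth t i) = t.
Proof.
by apply: eq_from_tnth => j; rewrite tnth_mktuple; case: eqP => // ->.
Qed.

Lemma norm_row_set_entry (t : tup n) i s : `|s| <= `|row_of_tuple (set_entry t i s)|.
Proof.
rewrite [leRHS]/Num.Def.normr/= mx_normrE.
apply: le_trans (le_bigmax _ _ (0, i)) => /=.
by rewrite mxE tnth_mktuple eqxx.
Qed.

Lemma test_line_is_derive f (t : tup n) i (s : R) : test_function Om f ->
  is_derive s (1 : R) (fun s => f (row_of_tuple (set_entry t i s)))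
    (partial i f (row_of_tuple (set_entry t i s))).
Proof.
move=> /(test_smooth 1) Cf; under eq_fun do rewrite row_of_set_entry.
rewrite (row_of_set_entry t i s); apply: is_derive_line; exact: (Ck_derivable Cf).
Qed.

Lemma continuous_row_set_entry (t : tup n) i :
  continuous (fun s : R => row_of_tuple (set_entry t i s)).
Proof.
move=> s; under eq_fun do rewrite row_of_set_entry.
by apply: cvgD; [exact: scalel_continuous|exact: cvg_cst].
Qed.

Lemma test_line_partial_continuous f (t : tup n) i : test_function Om f ->
  continuous (fun s : R => partial i f (row_of_tuple (set_entry t i s))).
Proof.
move=> tf s; apply: continuous_comp; first exact: continuous_row_set_entry.
exact: test_partial_continuous.
Qed.

(** Integrate along the lines parallel to the [i]-th axis first. *)
Lemma integral_partial_test f i : test_function Om f ->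
  \int[mu]_(x in Om) partial i f x = 0.
Proof.
move=> tf; have cp := test_partial_continuous (i := i) tf.
have -> : \int[mu]_(x in Om) partial i f x = \int[mu]_x partial i f x.
  rewrite Rintegral_mkcond; apply: eq_Rintegral => x _.
  rewrite patchE; case: ifPn => // /negP; rewrite inE => nx.
  by rewrite (test_partial_out _ tf).
rewrite /Rintegral integralE.
suff -> : (\int[mu]_x ((fun x => (partial i f x)%:E)^\+ x) =
           \int[mu]_x ((fun x => (partial i f x)%:E)^\- x))%E.
  case: (\int[mu]_x _)%E => [r| |] //=.
  by rewrite subrr.
have mp := continuous_measurable_tuple cp.
have [M M0 fM] := test_support_radius tf.
under eq_integral do rewrite funeposE -EFin_max.
under [RHS]eq_integral do rewrite funenegE -EFinN -EFin_max.
have mpos : measurable_fun [set: tup n]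
    (fun t => (Num.max (partial i f (row_of_tuple t)) 0)%:E).
  by apply/measurable_EFinP; exact: measurable_maxr.
have mneg : measurable_fun [set: tup n]
    (fun t => (Num.max (- partial i f (row_of_tuple t)) 0)%:E).
  by apply/measurable_EFinP; apply: measurable_maxr => //; exact: measurableT_comp.
have max0 (r : R) : (0 <= (Num.max r 0)%:E)%E by rewrite lee_fin le_max lexx orbT.
rewrite !ge0_integral_rV//.
apply: (eq_integral_lines (i := i)) => // t.
apply: (integral_derive_parts (M := M) (fun s => test_line_is_derive t i s tf)) => //.
- exact: test_line_partial_continuous.
- move=> s Ms; have [//|->//] := fM (row_of_tuple (set_entry t i s)).
  exact: le_trans Ms (norm_row_set_entry _ _ _).
- move=> s Ms; have [|_ ->//] := fM (row_of_tuple (set_entry t i s)).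
  exact: le_trans Ms (norm_row_set_entry _ _ _).
Qed.

Hypothesis mOm : measurable Om.
Hypothesis finOm : (mu Om < +oo)%E.

Lemma bounded_integrable f (B : R) : measurable_fun Om f -> (forall x, `|f x| <= B) ->
  mu.-integrable Om (EFin \o f).
Proof.
move=> mf fB; apply: measurable_bounded_integrable => //.
by exists B; split; rewrite ?num_real// => b Bb x _ /=; exact: le_trans (fB x) (ltW Bb).
Qed.

(** The [i]-th partial derivative of the test function [f \* g] integrates to [0]. *)
Lemma test_parts f g i : test_function Om f -> test_function Om g ->
  \int[mu]_(x in Om) (f x * partial i g x) =
  - \int[mu]_(x in Om) (partial i f x * g x).
Proof.
move=> tf tg.
have [Bf Bf0 fB] := test_bounded tf; have [Bg Bg0 gB] := test_bounded tg.
have [Bf' Bf'0 fB'] := test_partial_bounded i tf.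
have [Bg' Bg'0 gB'] := test_partial_bounded i tg.
apply/eqP; rewrite -addr_eq0 -RintegralD//.
- rewrite -[X in _ == X](integral_partial_test i (test_functionM tf tg)).
  apply/eqP; apply: eq_Rintegral => x _; apply/esym.
  by have [_ ] := is_derive_mul (test_is_derive i x tf) (test_is_derive i x tg).
- apply: (@bounded_integrable _ (Bf * Bg')).
    apply: measurable_funTS; apply: measurable_funM; apply: continuous_measurable_rV.
      exact: test_continuous.
    exact: test_partial_continuous.
  by move=> x; rewrite normrM ler_pM.
- apply: (@bounded_integrable _ (Bf' * Bg)).
    apply: measurable_funTS; apply: measurable_funM; apply: continuous_measurable_rV.
      exact: test_partial_continuous.
    exact: test_continuous.
  by move=> x; rewrite normrM ler_pM.
Qed.

End test_functions.

(** * The Sobolev inequality above a level, for test functions *)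

Lemma integral_out d (T : measurableType d) (R : realType)
    (mu : {measure set T -> \bar R}) (D : set T) (h : T -> \bar R) :
  (forall x, ~ D x -> h x = 0%E) -> (\int[mu]_(x in D) h x = \int[mu]_x h x)%E.
Proof.
move=> h0; rewrite integral_mkcond; apply: eq_integral => x _.
by rewrite patchE; case: ifPn => // /negP; rewrite inE => /h0.
Qed.

(** Hoelder's inequality with the exponents [(1 - a^-1)^-1] and [a].  For [a = 1] the
    former is infinite, but then [w] occurs to the power [0]. *)
Lemma hoelder_pow_split d (T : measurableType d) (R : realType)
    (mu : {measure set T -> \bar R}) (w g : T -> R) (gam s a : R) :
  measurable_fun setT w -> measurable_fun setT g ->
  (forall x, 0 <= w x) -> (forall x, 0 <= g x) -> 0 <= gam -> 1 <= a ->
  (a = 1 -> gam = 1) -> (1 < a -> (gam - 1) * (1 - a^-1)^-1 = s) ->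
  (\int[mu]_x (gam * (w x `^ (gam - 1) * g x))%:E <=
   gam%:E * ((\int[mu]_x (w x `^ s)%:E) `^ (1 - a^-1) *
             (\int[mu]_x (g x `^ a)%:E) `^ a^-1))%E.
Proof.
move=> mw mg w0 g0 gam0 a1 gam1 gamE.
have mwp b : measurable_fun setT (fun x => w x `^ b) by exact: measurable_funpow.
under eq_integral do rewrite EFinM.
rewrite ge0_integralZl_EFin//; last 2 first.
- by move=> x _; rewrite lee_fin mulr_ge0 ?powR_ge0.
- by apply/measurable_EFinP; exact: measurable_funM.
apply: lee_wpmul2l; first by rewrite lee_fin.
have [a1'|a1'] := leP a 1.
  have aE : a = 1 by apply/eqP; rewrite eq_le a1' a1.
  rewrite gam1// aE invr1 subrr poweRe0 mul1e poweRe1; last first.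
    by apply: integral_ge0 => x _; rewrite lee_fin powR_ge0.
  rewrite le_eqVlt; apply/orP; left; apply/eqP; apply: eq_integral => x _.
  by rewrite powRr0 mul1r powRr1.
have a0 : 0 < a by exact: lt_trans a1'.
have p0 : 0 < 1 - a^-1 by rewrite subr_gt0 invf_lt1.
have := ge0_hoelder mu (mwp (gam - 1)) mg (fun x => powR_ge0 _ _) g0 (p := (1 - a^-1)^-1) (q := a).
rewrite invrK invr_gt0 subrK => /(_ p0 a0 erefl).
by under [X in (_ <= X `^ _ * _)%E -> _]eq_integral do rewrite -powRrM gamE//.
Qed.

Section sobolev_test.
Context {R : realType} (n : nat).
Variables (Om : set 'rV[R]_n.+2) (a : R).
Hypotheses (mOm : measurable Om) (finOm : (@lebesgue_rV R n.+2 Om < +oo)%E).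
Hypotheses (a1 : 1 <= a) (aN : a < n.+2%:R).
Local Notation mu := (@lebesgue_rV R n.+2).
Local Notation tup n := (n.-tuple (measurableTypeR R)).
Local Notation astar := (sobolev_conj n.+2 a).

Let a0 : 0 < a. Proof. exact: lt_le_trans a1. Qed.

Lemma sobolev_conj_gt0 : 0 < astar.
Proof. by rewrite /sobolev_conj divr_gt0 ?mulr_gt0// subr_gt0. Qed.

(** A power of [y] cancels, as [(1 + n.+1%:R^-1)^-1] is
    [(1 - a^-1) + astar^-1]. *)
Lemma absorb_power (y x c : R) : 0 <= y -> 0 <= x -> 0 < c ->
  y <= (c * (y `^ (1 - a^-1) * x `^ a^-1)) `^ (1 + n.+1%:R^-1) ->
  y <= c `^ astar * x `^ (astar / a).
Proof.
rewrite le_eqVlt => /predU1P[<- _ _ _|y0 x0 c0].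
  by rewrite mulr_ge0 ?powR_ge0.
set q : R := 1 + n.+1%:R^-1.
have q0 : 0 < q by rewrite addr_gt0 ?invr_gt0.
have s0 := sobolev_conj_gt0.
move=> H.
have H1 : y `^ q^-1 <= c * (y `^ (1 - a^-1) * x `^ a^-1).
  have := le_powR (r := q^-1) _ (ltW y0) H; rewrite invr_ge0 (ltW q0) => /(_ isT).
  rewrite -powRrM mulfV ?gt_eqF// powRr1// mulr_ge0 ?(ltW c0)//.
  by rewrite mulr_ge0 ?powR_ge0.
have e1 : q^-1 = (1 - a^-1) + astar^-1.
  have aux (z : R) : 0 < z -> a < z + 1 ->
      (1 + z^-1)^-1 = (1 - a^-1) + (a * (z + 1) / (z + 1 - a))^-1.
    move=> z0 az; have := a0 => ?; field.
    by rewrite !gt_eqF//; lra.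
  by rewrite /q /sobolev_conj -(natr1 n.+1) aux// natr1.
have H2 : y `^ astar^-1 <= c * x `^ a^-1.
  rewrite -(ler_pM2l (powR_gt0 (1 - a^-1) y0)) -powRD; last first.
    by rewrite (gt_eqF y0) implybT.
  by rewrite -e1 (le_trans H1)// mulrCA.
have := le_powR (ltW s0) (powR_ge0 _ _) H2.
rewrite -powRrM mulVf ?gt_eqF// powRr1 ?(ltW y0)//.
by rewrite powRM ?powR_ge0 ?(ltW c0)// -powRrM (mulrC a^-1).
Qed.

Section one_function.
Variables (f : 'rV[R]_n.+2 -> R) (k : R).
Hypotheses (tf : test_function Om f) (k0 : 0 <= k).

(* Chosen so that [gam * (1 + n.+1%:R^-1) = astar]. *)
Let gam : R := a * n.+1%:R / (n.+2%:R - a).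

Let gam1 : 1 <= gam.
Proof.
have aux (z : R) : 1 <= z -> z + 1 - a <= a * z.
  move=> z1; have a1' := a1; have : 0 <= (a - 1) * z by apply: mulr_ge0; lra.
  lra.
rewrite /gam ler_pdivlMr ?subr_gt0// mul1r -(natr1 n.+1) aux//.
by rewrite ler1n.
Qed.

Let gam0 : 0 <= gam. Proof. exact: le_trans ler01 gam1. Qed.

Let F x := Num.max (f x - k) 0 `^ gam.
Let P i x := if k <= f x then gam * Num.max (f x - k) 0 `^ (gam - 1) * `|partial i f x|
             else 0.

Let max0 (r : R) : 0 <= Num.max r 0. Proof. by rewrite le_max lexx orbT. Qed.

Let P0 i x : 0 <= P i x.
Proof.
rewrite /P; case: ifPn => // _; apply: mulr_ge0 => //; apply: mulr_ge0 => //.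
exact: powR_ge0.
Qed.

Let mpospow d (T : measurableType d) (D : set T) (h : T -> R) (b : R) :
  measurable_fun D h -> measurable_fun D (fun x => Num.max (h x - k) 0 `^ b).
Proof.
move=> mh; apply: measurable_funpow; apply: measurable_maxr => //.
exact: measurable_funB.
Qed.

Let mP d (T : measurableType d) (D : set T) (h g : T -> R) : measurable D ->
  measurable_fun D h -> measurable_fun D g ->
  measurable_fun D (fun x => if k <= h x
    then gam * Num.max (h x - k) 0 `^ (gam - 1) * `|g x| else 0).
Proof.
move=> mD mh mg; apply: measurable_if_ge => //.
apply: measurable_funM; last exact: measurableT_comp.
by apply: measurable_funM => //; exact: mpospow.
Qed.

Let F_line_bounded : line_bounded (F \o @row_of_tuple R n.+2)
  (fun i => P i \o @row_of_tuple R n.+2).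
Proof.
have mf := continuous_measurable_tuple (test_continuous tf).
split.
- exact: (mpospow _ mf).
- move=> i; apply: (mP _ mf) => //.
  exact: (continuous_measurable_tuple (test_partial_continuous (i := i) tf)).
- by move=> x; exact: powR_ge0.
- by move=> i x; exact: P0.
- move=> i t; have [M M0 fM] := test_support_radius tf.
  have ex : exists2 s, s <= tnth t i & f (row_of_tuple (set_entry t i s)) <= k.
    (* A point of the line outside the support of [f], where [f = 0 <= k]. *)
    exists (- (`|tnth t i| + M)).
      have := ler_norm (- tnth t i); rewrite normrN; lra.
    have [|-> //] := fM (row_of_tuple (set_entry t i (- (`|tnth t i| + M)))).
    apply: le_trans (norm_row_set_entry _ _ _); rewrite normrN ger0_norm ?lerDr//.
    by rewrite addr_ge0// ltW.
  have := pospow_le_integral (fun s => test_line_is_derive t i s tf)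
    (test_line_partial_continuous (t := t) (i := i) tf) gam1 ex.
  by rewrite set_entry_id.
Qed.

Let Y := (\int[mu]_(x in Om) (Num.max (f x - k) 0 `^ astar)%:E)%E.
Let X i := (\int[mu]_(x in Om) (if k <= f x then `|partial i f x| `^ a else 0)%:E)%E.

Let Y0 : (0 <= Y)%E.
Proof. by apply: integral_ge0 => x _; rewrite lee_fin powR_ge0. Qed.

Let X0 i : (0 <= X i)%E.
Proof.
by apply: integral_ge0 => x _; rewrite lee_fin; case: ifPn => // _; exact: powR_ge0.
Qed.

Let gamE : gam * (1 + n.+1%:R^-1) = astar.
Proof.
have aux (z : R) : 0 < z -> z + 1 - a != 0 ->
    a * z / (z + 1 - a) * (1 + z^-1) = a * (z + 1) / (z + 1 - a).
  by move=> z0 za; field; rewrite za gt_eqF.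
rewrite /gam /sobolev_conj -(natr1 n.+1) aux// natr1.
by rewrite gt_eqF// subr_gt0.
Qed.

Let gamE' : 1 < a -> (gam - 1) * (1 - a^-1)^-1 = astar.
Proof.
move=> a1'.
have aux (z : R) : z + 1 - a != 0 ->
    (a * z / (z + 1 - a) - 1) * (1 - a^-1)^-1 = a * (z + 1) / (z + 1 - a).
  move=> za; have := a0 => ?; field.
  by rewrite za !gt_eqF// subr_gt0.
rewrite /gam /sobolev_conj -(natr1 n.+1) aux// natr1.
by rewrite gt_eqF// subr_gt0.
Qed.

Let Y_full : (Y = \int[mu]_x (Num.max (f x - k) 0 `^ astar)%:E)%E.
Proof.
apply: integral_out => x nx; rewrite (test_out tf nx) sub0r max_r ?oppr_le0//.
by rewrite powR0// gt_eqF// sobolev_conj_gt0.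
Qed.

Let X_full i : (X i = \int[mu]_x ((if k <= f x then `|partial i f x| else 0) `^ a)%:E)%E.
Proof.
rewrite -(@integral_out _ _ _ _ Om).
  apply: eq_integral => x _; case: ifPn => // _.
  by rewrite powR0// gt_eqF.
move=> x nx; rewrite (test_partial_out _ tf nx) normr0 if_same powR0//.
by rewrite gt_eqF.
Qed.

Let P_le i : (\int[mu]_x (P i x)%:E <= gam%:E * (Y `^ (1 - a^-1) * (X i) `^ a^-1))%E.
Proof.
have mf := continuous_measurable_rV (test_continuous tf).
have mp := continuous_measurable_rV (test_partial_continuous (i := i) tf).
pose u2 x := if k <= f x then `|partial i f x| else 0.
have mu2 : measurable_fun setT u2.
  by apply: measurable_if_ge; [exact: measurableT|exact: mf|exact: measurableT_comp].
have u20 x : 0 <= u2 x by rewrite /u2; case: ifPn.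
rewrite Y_full X_full -/u2.
have g1 : a = 1 -> gam = 1.
  by move=> aE; rewrite /gam aE -[n.+2%:R]natr1 addrK mul1r mulfV.
have mw : measurable_fun setT (fun x => Num.max (f x - k) 0).
  apply: measurable_maxr; last exact: measurable_cst.
  by apply: measurable_funB; [exact: mf|exact: measurable_cst].
have H := hoelder_pow_split mu mw mu2 (fun x => max0 _) u20 gam0 a1 g1 gamE'.
apply: le_trans H; rewrite le_eqVlt; apply/orP; left; apply/eqP.
apply: eq_integral => x _; rewrite /P /u2; case: ifPn => _; last by rewrite !mulr0.
by rewrite mulrA.
Qed.

Let Y_fin : Y \is a fin_num.
Proof.
rewrite ge0_fin_numE//.
have [B B0 fB] := test_bounded tf.
apply: (@le_lt_trans _ _ (\int[mu]_(x in Om) (cst ((B `^ astar)%:E) x))%E); last first.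
  by rewrite integral_cst// lte_mul_pinfty// ?lee_fin ?powR_ge0// fin_numE.
apply: le_integral_nonneg => [x _|].
  by rewrite lee_fin powR_ge0.
move=> x _; rewrite lee_fin; apply: le_powR => //; first exact/ltW/sobolev_conj_gt0.
rewrite ge_max (ltW B0) andbT; have := fB x; have := ler_norm (f x); have := k0; lra.
Qed.

Let Xt := (\int[mu]_(x in Om)
  (if k <= f x then \sum_i `|partial i f x| `^ a else 0)%:E)%E.

Let X_le i : (X i <= Xt)%E.
Proof.
apply: le_integral_nonneg => x _; rewrite lee_fin; case: ifPn => // _.
by rewrite (bigD1 i)//= lerDl sumr_ge0// => j _; exact: powR_ge0.
Qed.

(** The Gagliardo-Nirenberg inequality for [Num.max (f - k) 0 `^ gam], followed by
    Hoelder's inequality.  Only the gradient of [f] on the set where [k <= f]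
    enters: that is the localization De Giorgi's method lives on. *)
Lemma sobolev_test : (Y <= ((n.+2%:R * gam) `^ astar)%:E * Xt `^ (astar / a))%E.
Proof.
have Xt0 : (0 <= Xt)%E by exact: le_trans (X0 ord0) (X_le ord0).
have c0 : 0 < n.+2%:R * gam by rewrite mulr_gt0// (lt_le_trans _ gam1).
have G := gagliardo F_line_bounded.
have GY : (\int[lebesgue_tuple n.+2]_x
    ((F \o @row_of_tuple R n.+2) x `^ (1 + n.+1%:R^-1))%:E = Y)%E.
  rewrite Y_full ge0_integral_rV.
  - by apply: eq_integral => t _ /=; rewrite -powRrM gamE.
  - apply/measurable_EFinP; apply: (mpospow astar).
    exact: continuous_measurable_tuple (test_continuous tf).
  - by move=> x; rewrite lee_fin powR_ge0.
rewrite GY in G.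
have [Xty|Xtf] := eqVneq Xt +oo%E.
  rewrite Xty poweRyr; last by rewrite gt_eqF// (divr_gt0 sobolev_conj_gt0 a0).
  by rewrite gt0_muley ?lte_fin ?powR_gt0// leey.
have DX : (total_integral (fun i => P i \o @row_of_tuple R n.+2) <=
    (n.+2%:R * gam)%:E * (Y `^ (1 - a^-1) * Xt `^ a^-1))%E.
  apply: (@le_trans _ _ (\sum_(i < n.+2) gam%:E * (Y `^ (1 - a^-1) * Xt `^ a^-1))%E).
    apply: lee_sum => i _.
    rewrite -(ge0_integral_rV (F := fun x => (P i x)%:E)); last 2 first.
    - apply/measurable_EFinP; apply: (mP measurableT).
        exact: continuous_measurable_tuple (test_continuous tf).
      exact: (continuous_measurable_tuple (test_partial_continuous (i := i) tf)).
    - by move=> x; rewrite lee_fin.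
    apply: (le_trans (P_le i)); apply: lee_wpmul2l; first by rewrite lee_fin.
    apply: lee_wpmul2l; first exact: poweR_ge0.
    by apply: le_poweR => //; rewrite invr_ge0 ltW.
  rewrite -ge0_sume_distrl; last by move=> i _; rewrite lee_fin.
  by rewrite sumEFin sumr_const card_ord mulr_natl.
have {G}G := le_trans G (le_poweR _ _ DX).
have Xt_fin : Xt \is a fin_num by rewrite (ge0_fin_numE Xt0) ltey.
have /fineK YE := Y_fin; have /fineK XE := Xt_fin.
have y0 := fine_ge0 Y0; have x0 := fine_ge0 Xt0.
move: G; rewrite -YE -XE; generalize (fine Y) (fine Xt) y0 x0 => y x y0' x0' H.
rewrite poweR_EFin -EFinM lee_fin; apply: absorb_power => //.
have q0 : 0 <= 1 + n.+1%:R^-1 :> R by rewrite addr_ge0// invr_ge0.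
by rewrite -lee_fin; exact: H q0 (total_integral_ge0 (fun i t => P0 i _)).
Qed.

End one_function.

End sobolev_test.

(** * Doubling Young functions *)

(** The properties of [PhiF phi] that the argument rests on.  [young_scale] is
    what remains of convexity, and [young_growth] makes the gradient of a function
    in the Orlicz-Sobolev space integrable to the power [a], which yields the
    integrability to the conjugate power. *)
Record doubling_young {R : realType} (Phi : R -> R) (a : R) : Prop := DoublingYoung {
  young_norm : forall t, Phi `|t| = Phi t;
  young0 : Phi 0 = 0;
  young_mono : forall s t, 0 <= s -> s <= t -> Phi s <= Phi t;
  young_scale : forall c t, 0 <= c -> c <= 1 -> 0 <= t -> Phi (c * t) <= c * Phi t;
  young_double : exists2 K : R, 0 < K & forall t, 0 <= t -> Phi (2 * t) <= K * Phi t;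
  young_growth : exists2 K : R, 0 < K & forall t, 0 <= t -> t `^ a <= K * (1 + Phi t);
  young_measurable : measurable_fun [set: R] Phi }.

Section power_monotone.
Context {R : realType}.
Implicit Types (f df : R -> R) (b s t : R).

Let is_derive_mulpow f df b s : 0 < s -> is_derive s (1 : R) f (df s) ->
  is_derive s (1 : R) (fun r => f r * r `^ (- b)) (s `^ (- b - 1) * (s * df s - b * f s)).
Proof.
move=> s0 fdf.
have H := is_derive_mul fdf (@is_derive1_powR R (- b) s s0).
apply: (is_derive_eq H).
have -> : s `^ (- b) = s `^ (- b - 1) * s.
  by rewrite -[X in _ * X]powRr1 ?(ltW s0)// -powRD ?subrK// (gt_eqF s0) implybT.
ring.
Qed.

Let MVT_mulpow f df b s t : 0 < s -> s <= t ->
  (forall r : R, 0 < r -> is_derive r (1 : R) f (df r)) ->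
  exists2 c, 0 < c & f t * t `^ (- b) - f s * s `^ (- b) =
    c `^ (- b - 1) * (c * df c - b * f c) * (t - s).
Proof.
move=> s0 st fdf.
have pos (r : R) : r \in `[s, t] -> 0 < r by rewrite in_itv/= => /andP[/(lt_le_trans s0)].
have [||c cst E] := @MVT_segment R (fun r => f r * r `^ (- b))
  (fun r => r `^ (- b - 1) * (r * df r - b * f r)) s t st.
- move=> r rst; have r0 : 0 < r by apply: pos; exact: subset_itv_oo_cc rst.
  by apply: is_derive_mulpow => //; exact: fdf.
- apply: derivable_within_continuous => r rst.
  by case: (is_derive_mulpow b (pos r rst) (fdf r (pos r rst))).
- by exists c => //; exact: pos.
Qed.

(** A lower bound [b] for the logarithmic derivative [s * df s / f s] makes
    [f s * s `^ (- b)] nondecreasing; in [ge_mulpow], an upper bound makes it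
    nonincreasing. *)
Lemma le_mulpow f df b s t : 0 < s -> s <= t ->
  (forall r : R, 0 < r -> is_derive r (1 : R) f (df r)) ->
  (forall r, 0 < r -> b * f r <= r * df r) ->
  f s * s `^ (- b) <= f t * t `^ (- b).
Proof.
move=> s0 st fdf bf; have [c c0 E] := MVT_mulpow b s0 st fdf.
by rewrite -subr_ge0 E !mulr_ge0 ?powR_ge0 ?subr_ge0// bf.
Qed.

Lemma ge_mulpow f df b s t : 0 < s -> s <= t ->
  (forall r : R, 0 < r -> is_derive r (1 : R) f (df r)) ->
  (forall r, 0 < r -> r * df r <= b * f r) ->
  f t * t `^ (- b) <= f s * s `^ (- b).
Proof.
move=> s0 st fdf bf; have [c c0 E] := MVT_mulpow b s0 st fdf.
rewrite -subr_le0 E; apply: mulr_le0_ge0; last by rewrite subr_ge0.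
by apply: mulr_ge0_le0; rewrite ?powR_ge0// subr_le0 bf.
Qed.

End power_monotone.

Section phi_young.
Context {R : realType}.
Variables (N : nat) (phi : R -> R) (l m : R).
Hypotheses (Cphi : C1 phi) (incr_phi : phi2 phi)
  (phi3_phi : phi3 N phi l m).
Local Notation lam := (@lebesgue_measure R).
Local Notation Phi := (PhiF phi).

Let h (s : R) : R := s * phi s.

Let phi_continuous : continuous phi.
Proof. by move=> s; apply: differentiable_continuous; apply/derivable1_diffP; exact: Cphi.1. Qed.

Let h_continuous : continuous h.
Proof. by move=> s; apply: cvgM; [exact: cvg_id|exact: phi_continuous]. Qed.

Let h0 : h 0 = 0. Proof. by rewrite /h mul0r. Qed.

(* Negative values of the increasing [h] would stay away from [h 0 = 0]. *)
Let h_pos t : 0 < t -> 0 < h t.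
Proof.
move=> t0; have hnn s : 0 < s -> 0 <= h s.
  move=> s0; rewrite leNgt; apply/negP => hs.
  have : \forall r \near (0 : R), h s < h r.
    by apply: (cvgr_gt _ (@h_continuous 0)); rewrite h0.
  move=> /nbhs_ballP[e /= e0 eh].
  pose r := Num.min (s / 2) (e / 2).
  have r0 : 0 < r by rewrite lt_min !divr_gt0.
  have rs : r < s by rewrite gt_min ltr_pdivrMr// ltr_pMr// ltr1n.
  have re : r < e by rewrite gt_min [X in _ || X]ltr_pdivrMr// ltr_pMr// ltr1n orbT.
  have : h s < h r by apply: eh; rewrite /ball/= sub0r normrN gtr0_norm.
  by rewrite ltNge ltW//; exact: incr_phi.
have t20 : 0 < t / 2 by rewrite divr_gt0.
apply: (le_lt_trans (hnn _ t20)); apply: incr_phi => //.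
by rewrite ltr_pdivrMr// ltr_pMr// ltr1n.
Qed.

Let h_mono s t : 0 <= s -> s <= t -> h s <= h t.
Proof.
rewrite le_eqVlt => /predU1P[<-|s0].
  by rewrite h0 le_eqVlt => /predU1P[<-|/h_pos/ltW//]; rewrite h0.
by rewrite le_eqVlt => /predU1P[->//|st]; apply/ltW/incr_phi.
Qed.

Let h_ge0 t : 0 <= t -> 0 <= h t.
Proof. by move=> t0; have := h_mono (lexx 0) t0; rewrite h0. Qed.

Let h_integrable (A : set R) : compact A -> lam.-integrable A (EFin \o h).
Proof.
by move=> cA; apply: continuous_compact_integrable => //; exact: continuous_subspaceT.
Qed.

Let PhiE t : 0 <= t -> Phi t = \int[lam]_(s in `[0, t]) h s.
Proof. by move=> t0; rewrite /PhiF ger0_norm. Qed.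

Let Phi_sub s t : 0 <= s -> s <= t -> Phi t - Phi s = \int[lam]_(r in `]s, t]) h r.
Proof.
move=> s0 st; rewrite !PhiE ?(le_trans s0)// Rintegral_itvB ?bnd_simp//.
exact/h_integrable/segment_compact.
Qed.

Let oc_integrable s t (f : R -> R) : continuous f -> lam.-integrable `]s, t] (EFin \o f).
Proof.
move=> cf; have H : lam.-integrable `[s, t] (EFin \o f).
  apply: continuous_compact_integrable; first exact: segment_compact.
  exact: continuous_subspaceT.
by apply: integrableS H => //; exact: subset_itv_oc_cc.
Qed.

Let fine_itv s t : s <= t -> fine (lam `]s, t]%classic) = t - s.
Proof.
move=> st; rewrite lebesgue_measure_itv/= lte_fin; case: ltP => [//|ts] /=.
have -> : t = s by apply/eqP; rewrite eq_le st ts.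
by rewrite subrr.
Qed.

(** [s * phi s] is the derivative of [PhiF phi] and is nondecreasing, so that the
    increments of [PhiF phi] lie between the values of the derivative at the two
    ends. *)
Lemma PhiF_increment_ge s t : 0 <= s -> s <= t -> (t - s) * (s * phi s) <= Phi t - Phi s.
Proof.
move=> s0 st; rewrite Phi_sub// mulrC -(fine_itv st) -Rintegral_cst//.
apply: le_Rintegral => //; [by apply: (@oc_integrable s t (cst (s * phi s))); exact: cst_continuous|exact: oc_integrable|].
by move=> r; rewrite /= in_itv/= => /andP[sr _]; apply: h_mono => //; exact: ltW.
Qed.

Lemma PhiF_increment_le s t : 0 <= s -> s <= t -> Phi t - Phi s <= (t - s) * (t * phi t).
Proof.
move=> s0 st; rewrite Phi_sub// mulrC -(fine_itv st) -Rintegral_cst//.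
apply: le_Rintegral => //; [exact: oc_integrable|by apply: (@oc_integrable s t (cst (t * phi t))); exact: cst_continuous|].
by move=> r; rewrite /= in_itv/= => /andP[sr rt]; apply: h_mono => //; exact: le_trans s0 (ltW sr).
Qed.

Let Phi0 : Phi 0 = 0.
Proof. by rewrite PhiE// set_itv1 Rintegral_set1. Qed.

Let Phi_mono s t : 0 <= s -> s <= t -> Phi s <= Phi t.
Proof.
move=> s0 st; rewrite -subr_ge0; apply: le_trans (PhiF_increment_ge s0 st).
by rewrite mulr_ge0 ?subr_ge0// h_ge0.
Qed.

Let Phi_ge0 t : 0 <= t -> 0 <= Phi t.
Proof. by move=> t0; rewrite -Phi0; exact: Phi_mono. Qed.

(** With [energy_le_PhiF2]: the energy density [phi t * t ^ 2] is comparable to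
    [PhiF phi t]. *)
Lemma PhiF_le_energy t : 0 <= t -> Phi t <= t * (t * phi t).
Proof. by move=> t0; have := PhiF_increment_le (lexx 0) t0; rewrite Phi0 !subr0. Qed.

Lemma energy_le_PhiF2 t : 0 <= t -> t * (t * phi t) <= Phi (2 * t).
Proof.
move=> t0; have t2 : t <= 2 * t by lra.
have := PhiF_increment_ge t0 t2; rewrite (_ : 2 * t - t = t); last by ring.
by have := Phi_ge0 t0; lra.
Qed.

Let dh (s : R) : R := phi s + s * derive1 phi s.

Let h_is_derive s : is_derive s (1 : R) h (dh s).
Proof.
have dphi : is_derive s (1 : R) phi (derive1 phi s).
  by rewrite derive1E; apply/derivableP; exact: Cphi.1.
apply: (is_derive_eq (is_derive_mul (is_derive_id s (1 : R)) dphi)).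
by rewrite /dh mul1r addrC.
Qed.

Let h_bounds s : 0 < s -> (l - 1) * h s <= s * dh s /\ s * dh s <= (m - 1) * h s.
Proof.
move=> s0; have [_ _ _ /(_ s s0)] := phi3_phi.
have phis : 0 < phi s by have := h_pos s0; rewrite /h pmulr_rgt0.
have -> : derive1 (fun s => s * phi s) s = dh s.
  by rewrite derive1E; case: (h_is_derive s).
rewrite ler_pdivlMr// ler_pdivrMr// => /andP[lo hi]; split.
  by rewrite /h mulrCA ler_pM2l.
by rewrite /h [leRHS]mulrCA ler_pM2l.
Qed.

Let h_doubling t : 0 < t -> h (4 * t) <= 4 `^ (m - 1) * h t.
Proof.
move=> t0; have t4 : t <= 4 * t by lra.
have := ge_mulpow t0 t4 (fun r _ => h_is_derive r) (fun r r0 => (h_bounds r0).2).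
rewrite powRM ?(ltW t0)// mulrA ler_pM2r ?powR_gt0// powRN.
by rewrite ler_pdivrMr ?powR_gt0// [leRHS]mulrC.
Qed.

Let h_lower t : 1 <= t -> h 1 * t `^ (l - 1) <= h t.
Proof.
move=> t1; have t0 : 0 < t by exact: lt_le_trans t1.
have := le_mulpow ltr01 t1 (fun r _ => h_is_derive r) (fun r r0 => (h_bounds r0).1).
by rewrite powR1 mulr1 powRN ler_pdivlMr ?powR_gt0.
Qed.

Let Phi_double : exists2 K : R, 0 < K & forall t, 0 <= t -> Phi (2 * t) <= K * Phi t.
Proof.
(* [Phi (2 t) <= 2 t * h (2 t)] and [t / 2 * h (t / 2) <= Phi t], so that [h] is
   compared at two points with ratio [4]. *)
exists (4 * 4 `^ (m - 1)); first by rewrite mulr_gt0 ?powR_gt0.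
move=> t; rewrite le_eqVlt => /predU1P[<-|t0]; first by rewrite mulr0 Phi0 mulr0.
have t20 : 0 < t / 2 by rewrite divr_gt0.
have t2 : t / 2 <= t by lra.
have tt : 2 * t = 4 * (t / 2) by field.
apply: (@le_trans _ _ (2 * t * h (2 * t))); first by apply: PhiF_le_energy; lra.
have H := h_doubling t20.
have H1 : t / 2 * h (t / 2) <= Phi t.
  have := PhiF_increment_ge (ltW t20) t2; have := Phi_ge0 (ltW t20).
  by rewrite (_ : t - t / 2 = t / 2); [rewrite -/(h _); lra|field].
rewrite [X in h X]tt.
apply: (@le_trans _ _ (2 * t * (4 `^ (m - 1) * h (t / 2)))).
  by rewrite ler_pM2l// mulr_gt0.
have -> : 2 * t * (4 `^ (m - 1) * h (t / 2)) = 4 * 4 `^ (m - 1) * (t / 2 * h (t / 2)) by field.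
by rewrite ler_pM2l// mulr_gt0// powR_gt0.
Qed.

Let Phi_scale c t : 0 <= c -> c <= 1 -> 0 <= t -> Phi (c * t) <= c * Phi t.
Proof.
move=> c0 c1 t0; have ct0 : 0 <= c * t by rewrite mulr_ge0.
have ctt : c * t <= t by rewrite ler_piMl.
have lo := PhiF_increment_ge ct0 ctt.
have up := PhiF_le_energy ct0; rewrite -/(h _) in lo up.
have : (1 - c) * Phi (c * t) <= c * (Phi t - Phi (c * t)).
  apply: (@le_trans _ _ ((1 - c) * (c * t * h (c * t)))).
    by rewrite ler_wpM2l ?subr_ge0.
  have -> : (1 - c) * (c * t * h (c * t)) = c * ((t - c * t) * h (c * t)) by ring.
  by rewrite ler_wpM2l.
by lra.
Qed.

Let Phi_measurable : measurable_fun [set: R] Phi.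
Proof.
have mP : measurable_fun [set: R] (fun t => Phi (Num.max t 0)).
  apply: nondecreasing_measurable => // s t st.
  apply: Phi_mono; first by rewrite le_max lexx orbT.
  by rewrite ge_max !le_max st lexx orbT.
rewrite (_ : Phi = (fun t => Phi (Num.max t 0)) \o (fun t : R => `|t|)).
  by apply: measurableT_comp => //; exact: normr_measurable.
by apply/funext => t /=; rewrite max_l// /PhiF normr_id.
Qed.

Let growth_l : exists2 K : R, 0 < K & forall t, 0 <= t -> t `^ l <= K * (1 + Phi t).
Proof.
have [/andP[l1 _] _ _ _] := phi3_phi.
have l0 : 0 < l by exact: lt_le_trans l1.
have h10 : 0 < h 1 by exact: h_pos.
exists (2 `^ l * (1 + (h 1)^-1)).
  by rewrite mulr_gt0 ?powR_gt0// addr_gt0// invr_gt0.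
move=> t t0; have [t2|t2] := leP 2 t; last first.
  apply: (@le_trans _ _ (2 `^ l)); first by apply: le_powR => //; exact: ltW.
  rewrite -mulrA ler_peMr ?powR_ge0//.
  rewrite -[leLHS]mulr1 ler_pM// ?lerDl ?invr_ge0 ?(ltW h10) ?Phi_ge0//.
have t21 : 1 <= t / 2 by lra.
have t20 : 0 <= t / 2 by lra.
have H1 : t / 2 * h (t / 2) <= Phi t.
  have tt : t / 2 <= t by lra.
  have := PhiF_increment_ge t20 tt; have := Phi_ge0 t20.
  by rewrite (_ : t - t / 2 = t / 2); [rewrite -/(h _); lra|field].
have H2 : h 1 * (t / 2) `^ l <= Phi t.
  apply: le_trans H1.
  have pow (x : R) : 0 <= x -> x `^ l = x * x `^ (l - 1).
    move=> x0; rewrite -[X in _ = X * _](powRr1 x0) -powRD ?[1 + _]addrC ?subrK//.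
    by rewrite gt_eqF.
  rewrite (pow _ t20).
  by rewrite mulrCA ler_wpM2l// h_lower.
have -> : t `^ l = 2 `^ l * (t / 2) `^ l.
  by rewrite -powRM// mulrC divfK.
rewrite -mulrA ler_pM2l ?powR_gt0//.
apply: (@le_trans _ _ ((h 1)^-1 * Phi t)); first by rewrite ler_pdivlMl.
by rewrite ler_pM ?invr_ge0 ?(ltW h10) ?Phi_ge0 ?lerDr ?lerDl.
Qed.

Let growth_m : Nequiv Phi (fun t => `|t| `^ m) ->
  exists2 K : R, 0 < K & forall t, 0 <= t -> t `^ m <= K * (1 + Phi t).
Proof.
have [_ /andP[m1 _] _ _] := phi3_phi.
have m0 : 0 < m by exact: lt_trans m1.
move=> [c1 [c2 [t0 [c10 _ t00 H]]]].
exists (t0 `^ m + c1^-1); first by rewrite ltr_wpDl ?powR_ge0// invr_gt0.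
have c1V : 0 <= c1^-1 by rewrite invr_ge0 ltW.
move=> t tp; have P0 := Phi_ge0 tp; have p0 := powR_ge0 t0 m.
have [t0t|tt0] := leP t0 t.
  have /andP[+ _] := H t t0t; rewrite ger0_norm// -ler_pdivlMl// => Hc.
  have : 0 <= t0 `^ m * Phi t by rewrite mulr_ge0.
  by rewrite mulrDl !mulrDr !mulr1; lra.
have : t `^ m <= t0 `^ m by apply: le_powR => //; exact: ltW.
have : 0 <= (t0 `^ m + c1^-1) * Phi t by rewrite mulr_ge0// addr_ge0.
by rewrite mulrDr mulr1; lra.
Qed.

(** The upper bound in [phi3] gives the doubling condition and the lower one the
    growth of order [l].  When [PhiF phi] is equivalent to the power [m], the growth
    is even of order [m]. *)
Lemma PhiF_doubling_young a :
  a = l \/ (Nequiv Phi (fun t => `|t| `^ m) /\ a = m) -> doubling_young Phi a.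
Proof.
move=> ha; split => //.
- by move=> t; rewrite /PhiF normr_id.
- by case: ha => [->|[/growth_m ? ->]].
Qed.

End phi_young.

(** * Modulars *)

Section young_facts.
Context {R : realType}.
Variables (Phi : R -> R) (a : R).
Hypothesis Y : doubling_young Phi a.

Lemma young_ge0 t : 0 <= Phi t.
Proof.
by rewrite -(young_norm Y) -(young0 Y); apply: (young_mono Y).
Qed.

Lemma young_add s t : 0 <= s -> 0 <= t -> Phi (s + t) <= Phi (2 * s) + Phi (2 * t).
Proof.
wlog st : s t / s <= t.
  move=> H s0 t0; have [st|ts] := leP s t; first exact: H.
  by rewrite addrC [leRHS]addrC; apply: H => //; exact: ltW.
move=> s0 t0; apply: (@le_trans _ _ (Phi (2 * t))); last by rewrite lerDr young_ge0.
by apply: (young_mono Y); lra.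
Qed.

Lemma young_dilation c : exists2 K : R, 0 < K & forall t, 0 <= t -> Phi (c * t) <= K * Phi t.
Proof.
have [K K0 dK] := young_double Y.
have dn j t : 0 <= t -> Phi (2 ^+ j * t) <= K ^+ j * Phi t.
  move=> t0; elim: j => [|j IH]; first by rewrite !expr0 !mul1r.
  rewrite !exprS -!mulrA; apply: (le_trans (dK _ _)); first by rewrite mulr_ge0 ?exprn_ge0.
  by rewrite ler_pM2l.
pose j := Num.truncn `|c|.
exists (K ^+ j.+1) => [|t t0]; first exact: exprn_gt0.
apply: le_trans (dn j.+1 t t0); rewrite -(young_norm Y) normrM (ger0_norm t0).
apply: (young_mono Y); first exact: mulr_ge0.
rewrite ler_wpM2r//; apply: (@le_trans _ _ j.+1%:R); first by rewrite ltW// truncnS_gt.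
by rewrite -natrX ler_nat ltnW// ltn_expl.
Qed.

Lemma young_growth1 : 1 <= a -> exists2 K : R, 0 < K & forall t, 0 <= t -> t `^ 1 <= K * (1 + Phi t).
Proof.
move=> a1; have [K K0 HK] := young_growth Y.
exists (1 + K) => [|t t0]; first by rewrite addr_gt0.
have := HK t t0; have P0 := young_ge0 t.
have := mulr_ge0 (ltW K0) P0; rewrite powRr1// mulrDl mul1r => KP.
have [t1|t1] := leP t 1; first by have := powR_ge0 t a; lra.
by have := ler_powR (ltW t1) a1; rewrite powRr1//; lra.
Qed.

End young_facts.

Section modular_integral.
Context d (T : measurableType d) (R : realType).
Variables (mu : {measure set T -> \bar R}) (D : set T).
Hypotheses (mD : measurable D) (finD : (mu D < +oo)%E).
Variables (Phi : R -> R) (a : R).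
Hypothesis Y : doubling_young Phi a.
Implicit Types (f g : T -> R) (e : R).

(** The modular of [f] at scale [e], over an arbitrary measure space. *)
Definition young_integral f e : \bar R := (\int[mu]_(x in D) (Phi (`|f x| / e))%:E)%E.

Lemma measurable_young f e : measurable_fun D f ->
  measurable_fun D (fun x => Phi (`|f x| / e)).
Proof.
move=> mf; apply: (measurableT_comp (young_measurable Y)).
by apply: measurable_funM => //; exact: measurableT_comp.
Qed.

Lemma young_integral_le f g e : 0 < e -> (forall x, D x -> `|f x| <= `|g x|) ->
  (young_integral f e <= young_integral g e)%E.
Proof.
move=> e0 fg; apply: le_integral_nonneg => x Dx; rewrite lee_fin ?(young_ge0 Y)//.
apply: (young_mono Y); first by rewrite divr_ge0// ltW.
by rewrite ler_pM2r ?invr_gt0// fg.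
Qed.

(** [young_scale] under the integral sign: a modular at most [1] at scale [e] is
    small at the scales much larger than [e]. *)
Lemma young_integral_shrink f e e' : measurable_fun D f -> 0 < e -> e <= e' ->
  (young_integral f e <= 1)%E -> (young_integral f e' <= (e / e')%:E)%E.
Proof.
move=> mf e0 ee' H; have e'0 : 0 < e' by exact: lt_le_trans ee'.
apply: (@le_trans _ _ (\int[mu]_(x in D) ((e / e')%:E * (Phi (`|f x| / e))%:E))%E).
  apply: le_integral_nonneg => x _; rewrite lee_fin ?(young_ge0 Y)//.
  have -> : `|f x| / e' = (e / e') * (`|f x| / e).
    by field; rewrite !gt_eqF.
  apply: (young_scale Y); rewrite ?divr_ge0 ?(ltW e0) ?(ltW e'0)//.
  by rewrite ler_pdivrMr// mul1r.
rewrite ge0_integralZl_EFin//; last 3 first.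
- by move=> x _; rewrite lee_fin (young_ge0 Y).
- by apply/measurable_EFinP; exact: measurable_young.
- by rewrite divr_ge0 ?(ltW e0) ?(ltW e'0).
rewrite -[leRHS]mule1; apply: lee_wpmul2l => //.
by rewrite lee_fin divr_ge0 ?(ltW e0) ?(ltW e'0).
Qed.

Lemma young_integral_le1 f e e' : measurable_fun D f -> 0 < e -> e <= e' ->
  (young_integral f e <= 1)%E -> (young_integral f e' <= 1)%E.
Proof.
move=> mf e0 ee' H; apply: (le_trans (young_integral_shrink mf e0 ee' H)).
by rewrite lee_fin ler_pdivrMr ?mul1r// (lt_le_trans e0).
Qed.

(** The price of the triangle inequality for modulars is a doubling of the
    scale. *)
Lemma young_integral_add f g h e : measurable_fun D f -> measurable_fun D g -> 0 < e ->
  (forall x, D x -> `|h x| <= `|f x| + `|g x|) ->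
  (young_integral h (2 * e) <= young_integral f e + young_integral g e)%E.
Proof.
move=> mf mg e0 hfg; rewrite /young_integral -ge0_integralD//; last 4 first.
- by move=> x _; rewrite lee_fin (young_ge0 Y).
- by apply/measurable_EFinP; exact: measurable_young.
- by move=> x _; rewrite lee_fin (young_ge0 Y).
- by apply/measurable_EFinP; exact: measurable_young.
apply: le_integral_nonneg => x Dx; rewrite -?EFinD lee_fin ?(young_ge0 Y)//.
pose s := `|f x| / (2 * e); pose t := `|g x| / (2 * e).
have e20 : 0 < 2 * e by rewrite mulr_gt0.
have s0 : 0 <= s by rewrite divr_ge0// ltW.
have t0 : 0 <= t by rewrite divr_ge0// ltW.
have -> : `|f x| / e = 2 * s by rewrite /s; field; rewrite gt_eqF.
have -> : `|g x| / e = 2 * t by rewrite /t; field; rewrite gt_eqF.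
apply: le_trans (young_add Y s0 t0); apply: (young_mono Y).
  by rewrite divr_ge0// ltW.
by rewrite /s /t -mulrDl ler_pM2r ?invr_gt0// hfg.
Qed.

Lemma young_integral_lty f e e' : measurable_fun D f -> 0 < e -> 0 < e' ->
  (young_integral f e < +oo)%E -> (young_integral f e' < +oo)%E.
Proof.
move=> mf e0 e'0 H; have [K K0 dK] := young_dilation Y (e / e').
apply: (@le_lt_trans _ _ (\int[mu]_(x in D) (K%:E * (Phi (`|f x| / e))%:E))%E).
  apply: le_integral_nonneg => x _; rewrite lee_fin ?(young_ge0 Y)//.
  have -> : `|f x| / e' = (e / e') * (`|f x| / e) by field; rewrite !gt_eqF.
  by apply: dK; rewrite divr_ge0// ltW.
rewrite ge0_integralZl_EFin//; last 3 first.
- by move=> x _; rewrite lee_fin (young_ge0 Y).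
- by apply/measurable_EFinP; exact: measurable_young.
- exact: ltW.
rewrite lte_mul_pinfty// ?lee_fin ?(ltW K0)//.
Qed.

Lemma young_integral_bounded f B e : 0 < e -> (forall x, D x -> `|f x| <= B) ->
  (young_integral f e < +oo)%E.
Proof.
move=> e0 fB; apply: (@le_lt_trans _ _ (\int[mu]_(x in D) (cst (Phi (B / e))%:E x))%E).
  apply: le_integral_nonneg => x Dx; rewrite lee_fin ?(young_ge0 Y)//.
  apply: (young_mono Y); first by rewrite divr_ge0// ltW.
  by rewrite ler_pM2r ?invr_gt0// fB.
by rewrite integral_cst// lte_mul_pinfty ?lee_fin ?(young_ge0 Y).
Qed.

(** The growth condition, applied to [`|f x| / e]. *)
Lemma power_integral_le b K f e : 0 < K -> 0 < b ->
  (forall t, 0 <= t -> t `^ b <= K * (1 + Phi t)) ->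
  measurable_fun D f -> 0 < e -> (young_integral f e <= 1)%E ->
  (\int[mu]_(x in D) (`|f x| `^ b)%:E <= (e `^ b * (K * (fine (mu D) + 1)))%:E)%E.
Proof.
move=> K0 b0 HK mf e0 H.
apply: (@le_trans _ _ (\int[mu]_(x in D)
    ((e `^ b * K)%:E * (1 + (Phi (`|f x| / e))%:E)))%E).
  apply: le_integral_nonneg => x Dx; first by rewrite lee_fin powR_ge0.
  rewrite -EFinD -EFinM lee_fin -mulrA.
  have -> : `|f x| `^ b = e `^ b * (`|f x| / e) `^ b.
    by rewrite -powRM ?(ltW e0) ?divr_ge0 ?(ltW e0)// mulrC divfK// gt_eqF.
  by rewrite ler_pM2l ?powR_gt0// HK// divr_ge0// ltW.
have mY : measurable_fun D (fun x => (Phi (`|f x| / e))%:E).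
  by apply/measurable_EFinP; exact: measurable_young.
have Y0 x : D x -> (0 <= (Phi (`|f x| / e))%:E)%E by rewrite lee_fin (young_ge0 Y).
rewrite ge0_integralZl_EFin//; last 3 first.
- by move=> x Dx; rewrite adde_ge0// Y0.
- exact: emeasurable_funD.
- by rewrite mulr_ge0 ?powR_ge0// ltW.
rewrite ge0_integralD//.
rewrite integral_cst// mul1e mulrA [leRHS]EFinM.
apply: lee_wpmul2l; first by rewrite lee_fin mulr_ge0 ?powR_ge0// ltW.
rewrite EFinD fineK ?ge0_fin_numE//; apply: leeD => //.
Qed.

Lemma power_integral_lty b K f : 0 < K ->
  (forall t, 0 <= t -> t `^ b <= K * (1 + Phi t)) ->
  measurable_fun D f -> (young_integral f 1 < +oo)%E ->
  (\int[mu]_(x in D) (`|f x| `^ b)%:E < +oo)%E.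
Proof.
move=> K0 HK mf H.
apply: (@le_lt_trans _ _ (\int[mu]_(x in D) (K%:E * (1 + (Phi (`|f x| / 1))%:E)))%E).
  apply: le_integral_nonneg => x Dx; first by rewrite lee_fin powR_ge0.
  by rewrite -EFinD -EFinM lee_fin divr1 HK.
have mY : measurable_fun D (fun x => (Phi (`|f x| / 1))%:E).
  by apply/measurable_EFinP; exact: measurable_young.
have Y0 x : D x -> (0 <= (Phi (`|f x| / 1))%:E)%E by rewrite lee_fin (young_ge0 Y).
rewrite ge0_integralZl_EFin//; last 3 first.
- by move=> x Dx; rewrite adde_ge0// Y0.
- exact: emeasurable_funD.
- exact: ltW.
rewrite ge0_integralD// integral_cst// mul1e lte_mul_pinfty ?lee_fin ?(ltW K0)//.
exact: lte_add_pinfty.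
Qed.

(** Modular bounds at geometrically decreasing scales make the integrals of
    [`|w j|] summable, which forces convergence almost everywhere. *)
Lemma ae_cvg_of_young (w : nat -> T -> R) : 1 <= a ->
  (forall j, measurable_fun D (w j)) ->
  (forall j, young_integral (w j) (2^-1 ^+ j) <= 1)%E ->
  {ae mu, forall x, D x -> w j x @[j --> \oo] --> 0}.
Proof.
move=> a1 mw H; have [K K0 HK] := young_growth1 Y a1.
pose C := K * (fine (mu D) + 1).
have C0 : 0 <= C by rewrite mulr_ge0 ?(ltW K0)// addr_ge0// fine_ge0.
have half0 j : 0 < (2^-1 : R) ^+ j by rewrite exprn_gt0.
have L1 j : (\int[mu]_(x in D) `|w j x|%:E <= (2^-1 ^+ j * C)%:E)%E.
  have := power_integral_le K0 ltr01 HK (mw j) (half0 j) (H j).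
  rewrite powRr1 ?(ltW (half0 j))//.
  by under eq_integral do rewrite powRr1//.
have mn j : measurable_fun D (fun x => `|w j x|%:E).
  by apply/measurable_EFinP; exact: measurableT_comp.
pose S x := (\sum_(0 <= j <oo) `|w j x|%:E)%E.
have S0 x : (0 <= S x)%E by apply: nneseries_ge0 => j _ _; rewrite lee_fin.
have mS : measurable_fun D S by apply: ge0_emeasurable_sum => // j x _ _; rewrite lee_fin.
have intS : (\int[mu]_(x in D) S x < +oo)%E.
  rewrite integral_nneseries//.
  apply: (@le_lt_trans _ _ (\sum_(0 <= j <oo) (2^-1 ^+ j * C)%:E)%E).
    by apply: lee_nneseries => [j _ _|j _]; [exact: integral_ge0|exact: L1].
  have gE : (\sum_(0 <= j <oo) (2^-1 ^+ j * C)%:E = (2 * C)%:E)%E.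
    have := @cvg_geometric_eseries_half R (2 * C) 0.
    rewrite expr0 divr1 => /cvg_lim <-//; apply: congr_lim.
    apply/funext => j; rewrite /eseries/=; apply: eq_bigr => i _.
    congr (_%:E); rewrite addn1 expnS natrM natrX exprVn.
    by field; rewrite expf_neq0.
  by rewrite gE ltry.
have : mu.-integrable D S.
  apply/integrableP; split => //.
  by under eq_integral do rewrite gee0_abs//.
move=> /(integrable_ae mD); apply: filterS => x /[apply] Sx.
have Sxy : (S x < +oo)%E by rewrite -ge0_fin_numE.
have w0 k : true -> (0 <= `|w k x|%:E)%E by rewrite lee_fin.
have tail := nneseries_tail_cvg Sxy w0.
have : `|w j x|%:E @[j --> \oo] --> (0 : \bar R).
  apply: squeeze_cvge (cvg_cst _) tail; apply: nearW => j; rewrite lee_fin normr_ge0/=.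
  rewrite (nneseries_split _ 1)//.
  rewrite addn1 big_nat1 leeDl//; apply: nneseries_ge0 => k _ _; exact: w0.
by move=> /fine_cvg; exact: norm_cvg0.
Qed.

(** Dominated convergence, since [young_scale] gives
    [Phi (`|c j x * f x| / e) <= `|c j x| * Phi (`|f x| / e)]. *)
Lemma young_integral_cvg0 (c : nat -> T -> R) f e : 0 < e ->
  (forall j, measurable_fun D (c j)) -> (forall j x, `|c j x| <= 1) ->
  {ae mu, forall x, D x -> c j x @[j --> \oo] --> 0} ->
  measurable_fun D f -> (young_integral f e < +oo)%E ->
  young_integral (fun x => c j x * f x) e @[j --> \oo] --> (0 : \bar R).
Proof.
move=> e0 mc c1 c0 mf fy.
have mF j : measurable_fun D (fun x => (Phi (`|c j x * f x| / e))%:E).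
  by apply/measurable_EFinP; apply: measurable_young; exact: measurable_funM.
have mG : measurable_fun D (fun x => (Phi (`|f x| / e))%:E).
  by apply/measurable_EFinP; exact: measurable_young.
have bnd j x : Phi (`|c j x * f x| / e) <= `|c j x| * Phi (`|f x| / e).
  rewrite normrM -mulrA; apply: (young_scale Y) => //.
  by rewrite divr_ge0// ltW.
have iG : mu.-integrable D (fun x => (Phi (`|f x| / e))%:E).
  apply/integrableP; split => //.
  by under eq_integral do rewrite gee0_abs ?lee_fin ?(young_ge0 Y)//.
have cv : {ae mu, forall x, D x ->
    (Phi (`|c j x * f x| / e))%:E @[j --> \oo] --> (cst 0%E x : \bar R)}.
  apply: filterS c0 => x /[apply] cx; apply: cvg_EFin; first exact: nearW.
  apply: (@squeeze_cvgr _ _ _ _ (cst 0) (fun j => `|c j x| * Phi (`|f x| / e))).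
  - by apply: nearW => j; rewrite (young_ge0 Y) bnd.
  - exact: cvg_cst.
  - rewrite -[X in _ --> X](mul0r (Phi (`|f x| / e))); apply: cvgM; last exact: cvg_cst.
    by rewrite -(normr0 R); exact: cvg_norm.
have dom : {ae mu, forall x j, D x ->
    (`|(Phi (`|c j x * f x| / e))%:E| <= (Phi (`|f x| / e))%:E)%E}.
  apply: aeW => x j _; rewrite gee0_abs ?lee_fin ?(young_ge0 Y)//.
  apply: (le_trans (bnd j x)); rewrite -[leRHS]mul1r.
  by rewrite ler_wpM2r ?(young_ge0 Y).
have m0 : measurable_fun D (cst 0%E : T -> \bar R) by exact: measurable_cst.
have [_ _] := dominated_convergence mD mF m0 cv iG dom.
by rewrite integral0.
Qed.

End modular_integral.

(** * Approximation by test functions in Orlicz-Sobolev spaces *)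

Section small_integrals.
Context d (T : measurableType d) (R : realType).
Variables (mu : {measure set T -> \bar R}) (D : set T).
Hypotheses (mD : measurable D) (finD : (mu D < +oo)%E).
Variables (Phi : R -> R) (a : R).
Hypotheses (Y : doubling_young Phi a) (a1 : 1 <= a).

Lemma le_integral_subset (A B : set T) (f : T -> \bar R) : A `<=` B ->
  (forall x, 0 <= f x)%E -> (\int[mu]_(x in A) f x <= \int[mu]_(x in B) f x)%E.
Proof.
move=> AB f0; rewrite !(integral_mkcond _ f); apply: le_integral_nonneg => x _.
  exact: erestrict_ge0.
rewrite !patchE; case: ifPn => [|_]; last by case: ifPn.
by rewrite inE => /AB xB; rewrite mem_set.
Qed.

(** A small scale [e] makes [f] small in L^1, hence negligible against bounded
    functions. *)
Lemma young_integral_L1 : exists2 C : R, 0 < C & forall (f g : T -> R) (B e : R),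
  measurable_fun D f -> measurable_fun D g -> 0 < B -> (forall x, D x -> `|g x| <= B) ->
  0 < e -> (young_integral mu D Phi f e <= 1)%E ->
  mu.-integrable D (EFin \o (f \* g)) /\
  `|\int[mu]_(x in D) (f x * g x)| <= B * (e * C).
Proof.
have [K K0 HK] := young_growth1 Y a1.
have f0 : 0 <= fine (mu D) by rewrite fine_ge0.
exists (K * (fine (mu D) + 1)) => [|f g B e mf mg B0 gB e0 H].
  by rewrite mulr_gt0// ltr_wpDl.
have := power_integral_le mD finD Y K0 ltr01 HK mf e0 H.
rewrite powRr1 ?(ltW e0)//; under eq_integral do rewrite powRr1//.
move=> L1.
have mfg : measurable_fun D (EFin \o (f \* g)).
  by apply/measurable_EFinP; exact: measurable_funM.
have le : (\int[mu]_(x in D) `|(f x * g x)%:E| <= (B * (e * (K * (fine (mu D) + 1))))%:E)%E.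
  apply: (@le_trans _ _ (\int[mu]_(x in D) (B%:E * `|f x|%:E))%E).
    apply: le_integral_nonneg => x Dx //=.
    by rewrite lee_fin normrM mulrC ler_wpM2r// gB.
  rewrite ge0_integralZl_EFin//; last 2 first.
  - by apply/measurable_EFinP; exact: measurableT_comp.
  - exact: ltW.
  by rewrite [leRHS]EFinM; apply: lee_wpmul2l => //; rewrite lee_fin ltW.
have ifg : mu.-integrable D (EFin \o (f \* g)).
  by apply/integrableP; split => //; apply: le_lt_trans le _; rewrite ltry.
split => //; rewrite -lee_fin; apply: le_trans le.
by rewrite EFin_normr_Rintegral//; apply: le_abse_integral.
Qed.

End small_integrals.

Section orlicz_closure.
Context {R : realType} (n : nat).
Variables (Om : set 'rV[R]_n) (Phi : R -> R) (a : R).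
Hypotheses (mOm : measurable Om) (finOm : (@lebesgue_rV R n Om < +oo)%E).
Hypotheses (Y : doubling_young Phi a) (a1 : 1 <= a).
Local Notation mu := (@lebesgue_rV R n).
Local Notation YI := (young_integral mu Om Phi).
Implicit Types (u v w : 'rV[R]_n -> R) (Du Dv : 'rV[R]_n -> 'rV[R]_n).

(** Membership in [sobolev0] in terms of modulars: these are integrals, which can
    be estimated pointwise, unlike the Luxemburg norm. *)
Definition test_approximable v Dv : Prop := forall e : R, 0 < e ->
  exists2 w, test_function Om w & (YI (v \- w)%R e <= 1)%E /\
    forall i, (YI (fun x => Dv x 0%R i - partial i w x)%R e <= 1)%E.

Lemma luxemburg_ge0 u : (0 <= luxemburg Phi Om u)%E.
Proof. by apply: le_ereal_inf_tmp => _ [r [r0 _] <-]; rewrite lee_fin ltW. Qed.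

Lemma luxemburg_ltP u e : measurable_fun Om u ->
  (luxemburg Phi Om u < e%:E)%E -> (YI u e <= 1)%E.
Proof.
move=> mu' /ereal_inf_lt[_ [r [r0 H] <-]]; rewrite lte_fin => re.
exact: (young_integral_le1 mOm Y mu' r0 (ltW re) H).
Qed.

Lemma luxemburg_le u e : 0 < e -> (YI u e <= 1)%E -> (luxemburg Phi Om u <= e%:E)%E.
Proof. by move=> e0 H; apply: ereal_inf_lbound; exists e. Qed.

Lemma gradE i Du w x : (Du x - grad w x) 0 i = Du x 0 i - partial i w x.
Proof. by rewrite !mxE. Qed.

Lemma test_measurable w : test_function Om w -> measurable_fun Om w.
Proof. by move=> tw; exact: measurable_funTS (continuous_measurable_rV (test_continuous tw)). Qed.

Lemma test_partial_measurable w i : test_function Om w -> measurable_fun Om (partial i w).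
Proof.
move=> tw; apply: measurable_funTS.
exact: (continuous_measurable_rV (test_partial_continuous (i := i) tw)).
Qed.

Lemma sobolev0_approximable u Du : sobolev0 Phi Om u Du -> test_approximable u Du.
Proof.
move=> [[[mu' _] wDu] ap] e e0; have [w tw norm] := ap e e0; exists w => //.
have lux i : (luxemburg Phi Om (fun x => (Du x - grad w x)%R 0%R i) < e%:E)%E.
  apply: le_lt_trans norm; rewrite /sobolev_norm (bigD1 i)//= addeCA leeDl//.
  by rewrite adde_ge0 ?luxemburg_ge0// sume_ge0// => j _; exact: luxemburg_ge0.
split=> [|i].
  apply: luxemburg_ltP; first exact: measurable_funB mu' (test_measurable tw).
  apply: le_lt_trans norm; rewrite /sobolev_norm leeDl//.
  by apply: sume_ge0 => j _; exact: luxemburg_ge0.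
have [_ [mD _]] := wDu i.
have := lux i; under eq_fun do rewrite gradE.
apply: luxemburg_ltP; exact: (measurable_funB mD (test_partial_measurable i tw)).
Qed.

Lemma approximable_norm v Dv e : test_approximable v Dv -> 0 < e ->
  exists2 w, test_function Om w &
    (sobolev_norm Phi Om (fun x => v x - w x)%R (fun x => Dv x - grad w x)%R < e%:E)%E.
Proof.
move=> ap e0; pose r := e / n.+2%:R.
have r0 : 0 < r by rewrite divr_gt0.
have [w tw [H Hi]] := ap r r0; exists w => //.
apply: (@le_lt_trans _ _ (r%:E + \sum_(i < n) r%:E)%E).
  apply: leeD; first exact: luxemburg_le.
  apply: lee_sum => i _; apply: luxemburg_le => //.
  by under eq_fun do rewrite gradE.
rewrite sumEFin sumr_const card_ord -EFinD lte_fin -mulrS -mulr_natr /r mulrAC.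
by rewrite ltr_pdivrMr// ltr_pM2l// ltr_nat.
Qed.

Lemma approximable_orlicz v w e : measurable_fun Om v -> test_function Om w ->
  0 < e -> (YI (v \- w)%R e <= 1)%E -> orlicz Phi Om v.
Proof.
move=> mv tw e0 H; split => //; exists (2 * e); first by rewrite mulr_gt0.
have mw := test_measurable tw.
have [B B0 wB] := test_bounded tw.
have := young_integral_add mu mOm Y (measurable_funB mv mw) mw e0 (h := v).
move=> H2; change (YI v (2 * e) < +oo)%E; apply: le_lt_trans (H2 _) _.
  by move=> x _; rewrite -[X in `|X| <= _](subrK (w x)) ler_normD.
apply: lte_add_pinfty; first by apply: le_lt_trans H _; rewrite ltry.
by apply: (young_integral_bounded mOm finOm Y (B := B)) => // x _.
Qed.

Lemma approximable_integrable (f w h : 'rV[R]_n -> R) (e B : R) : measurable_fun Om f -> measurable_fun Om w ->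
  (exists B' : R, forall x, `|w x| <= B') -> 0 < e -> (YI (f \- w)%R e <= 1)%E ->
  measurable_fun Om h -> 0 < B -> (forall x, `|h x| <= B) ->
  mu.-integrable Om (EFin \o (f \* h)).
Proof.
move=> mf mw [B' wB] e0 H mh B0 hB.
have [C C0 HC] := young_integral_L1 mOm finOm Y a1.
have [i1 _] := HC _ _ _ _ (measurable_funB mf mw) mh B0 (fun x _ => hB x) e0 H.
have i2 : mu.-integrable Om (EFin \o (w \* h)).
  apply: (bounded_integrable mOm finOm (B := B' * B)).
    exact: measurable_funM.
  by move=> x; rewrite normrM ler_pM.
have := integrableD mOm i1 i2.
apply: eq_integrable => // x _ /=.
by rewrite -EFinD -mulrDl subrK.
Qed.

(** The defining identity of weak derivatives holds for the approximating test
    functions and passes to the limit, since the errors are small in L^1 and are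
    integrated against bounded functions. *)
Lemma approximable_weak_partial v Dv i : measurable_fun Om v ->
  (forall i, measurable_fun Om (fun x => Dv x 0 i)) ->
  test_approximable v Dv -> weak_partial Om i v (fun x => Dv x 0 i).
Proof.
move=> mv mDv ap.
have [w1 tw1 [H1 H1i]] := ap 1 ltr01.
have loc (f w : 'rV[R]_n -> R) : measurable_fun Om f -> measurable_fun Om w ->
    (exists B' : R, forall x, `|w x| <= B') -> (YI (f \- w)%R 1 <= 1)%E -> loc_integrable Om f.
  move=> mf mw wB H; split => // K KOm _.
  have m1 : measurable_fun Om (cst 1 : 'rV[R]_n -> R) by exact: measurable_cst.
  have n1 (x : 'rV[R]_n) : `|(cst 1 : 'rV[R]_n -> R) x| <= 1 by rewrite normr1.
  have /integrableP[_] := approximable_integrable mf mw wB ltr01 H m1 ltr01 n1.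
  apply: le_lt_trans.
  apply: (@le_trans _ _ (\int[mu]_(x in Om) (`|f x|%R)%:E)%E).
    by apply: le_integral_subset.
  by apply: le_integral_nonneg => x _ //=; rewrite mulr1.
have [Bw Bw0 wB] := test_bounded tw1.
have [Bi Bi0 wiB] := test_partial_bounded i tw1.
split.
- by apply: (loc v w1) => //; [exact: test_measurable|exists Bw].
- by apply: (loc _ (partial i w1)); [exact: mDv|exact: test_partial_measurable|exists Bi|exact: H1i].
move=> psi tpsi; apply/eqP; rewrite -addr_eq0 -normr_eq0.
have mpsi := test_measurable tpsi; have mpsi' := test_partial_measurable i tpsi.
have [B1 B10 pB1] := test_bounded tpsi.
have [B2 B20 pB2] := test_partial_bounded i tpsi.
have [C C0 HC] := young_integral_L1 mOm finOm Y a1.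
rewrite eq_le normr_ge0 andbT; apply/ler_addgt0Pr => e e0; rewrite add0r.
pose r := e / ((B1 + B2) * C).
have r0 : 0 < r by rewrite divr_gt0// mulr_gt0// addr_gt0.
have [w tw [H Hi]] := ap r r0.
have mw := test_measurable tw; have mw' := test_partial_measurable i tw.
have [Bv _ wBv] := test_bounded tw; have [Bv' _ wBv'] := test_partial_bounded i tw.
have [i1 E1] := HC _ _ _ _ (measurable_funB mv mw) mpsi' B20 (fun x _ => pB2 x) r0 H.
have [i2 E2] := HC _ _ _ _ (measurable_funB (mDv i) mw') mpsi B10 (fun x _ => pB1 x) r0 (Hi i).
have j1 : mu.-integrable Om (EFin \o (w \* partial i psi)).
  apply: (bounded_integrable mOm finOm (B := Bv * B2)); first exact: measurable_funM.
  by move=> x; rewrite normrM ler_pM.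
have j2 : mu.-integrable Om (EFin \o (partial i w \* psi)).
  apply: (bounded_integrable mOm finOm (B := Bv' * B1)); first exact: measurable_funM.
  by move=> x; rewrite normrM ler_pM.
have S1 : \int[mu]_(x in Om) (v x * partial i psi x) =
    \int[mu]_(x in Om) ((v \- w) x * partial i psi x) +
    \int[mu]_(x in Om) (w x * partial i psi x).
  rewrite -RintegralD//; apply: eq_Rintegral => x _ /=.
  by rewrite -mulrDl subrK.
have S2 : \int[mu]_(x in Om) (Dv x 0 i * psi x) =
    \int[mu]_(x in Om) (((fun x => Dv x 0 i) \- partial i w) x * psi x) +
    \int[mu]_(x in Om) (partial i w x * psi x).
  rewrite -RintegralD//; apply: eq_Rintegral => x _ /=.
  by rewrite -mulrDl subrK.
rewrite S1 S2 (test_parts mOm finOm i tw tpsi) addrACA [- _ + _]addrC subrr addr0.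
apply: (le_trans (ler_normD _ _)); apply: (le_trans (lerD E1 E2)).
have -> : e = (B2 + B1) * (r * C).
  rewrite /r; field; rewrite !gt_eqF//; last by rewrite addr_gt0.
by rewrite mulrDl.
Qed.

(** The way to show that a function built from [u] is an admissible test in the
    weak formulation: the approximation also yields the weak derivatives. *)
Lemma approximable_sobolev0 v Dv : measurable_fun Om v ->
  (forall i, measurable_fun Om (fun x => Dv x 0 i)) ->
  test_approximable v Dv -> sobolev0 Phi Om v Dv.
Proof.
move=> mv mDv ap; have [w tw [H Hi]] := ap 1 ltr01.
split; last by move=> e e0; exact: approximable_norm.
split; first exact: (approximable_orlicz mv tw ltr01 H).
move=> i; split; first exact: approximable_weak_partial.
split => //; exists 2 => //.
have mw' := test_partial_measurable i tw.
have [B B0 wB] := test_partial_bounded i tw.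
have := young_integral_add mu mOm Y (measurable_funB (mDv i) mw') mw' ltr01 (h := fun x => Dv x 0 i).
rewrite mulr1 => H2.
apply: le_lt_trans (H2 _) _.
  by move=> x _; rewrite -[X in `|X| <= _](subrK (partial i w x)); exact: ler_normD.
apply: lte_add_pinfty; first by apply: le_lt_trans (Hi i) _; rewrite ltry.
by apply: (young_integral_bounded mOm finOm Y (B := B)) => // x _.
Qed.

End orlicz_closure.

(** * Limits of integrals *)

Lemma ereal_cvg0_lt (R : realType) (f : nat -> \bar R) (e : R) :
  f @ \oo --> (0 : \bar R) -> 0 < e -> \forall j \near \oo, (f j < e%:E)%E.
Proof.
move=> /fine_cvgP[ff fc] e0; have fe := cvgr_lt 0 fc _ e0.
near=> j; have fj : f j \is a fin_num by near: j.
by rewrite -(fineK fj) lte_fin; near: j; exact: fe.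
Unshelve. all: by end_near. Qed.

Section limits.
Context d (T : measurableType d) (R : realType).
Variables (mu : {measure set T -> \bar R}) (D : set T).
Hypothesis mD : measurable D.

Lemma fatou_bound (F : nat -> T -> R) (f : T -> R) (M : \bar R) :
  (forall j, measurable_fun D (F j)) -> measurable_fun D f ->
  (forall j x, 0 <= F j x) -> (forall x, 0 <= f x) ->
  {ae mu, forall x, D x -> F j x @[j --> \oo] --> f x} ->
  (\forall j \near \oo, (\int[mu]_(x in D) (F j x)%:E <= M)%E) ->
  (\int[mu]_(x in D) (f x)%:E <= M)%E.
Proof.
move=> mF mf F0 f0 Ff [J _ FM].
pose G j x := (F (j + J)%N x)%:E.
have mG j : measurable_fun D (G j) by exact/measurable_EFinP.
have G0 j x : D x -> (0 <= G j x)%E by rewrite lee_fin.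
have GM j : (\int[mu]_(x in D) G j x <= M)%E by apply: FM; rewrite /= leq_addl.
have := fatou mu mD mG G0.
have -> : (\int[mu]_(x in D) limn_einf (G ^~ x) = \int[mu]_(x in D) (f x)%:E)%E.
  apply: ge0_ae_eq_integral => //.
  - rewrite (_ : (fun x => _) = (-%E \o (fun x => limn_esup (-%E \o G ^~ x)))); last first.
      by apply/funext => x /=; rewrite limn_esupN oppeK.
    apply: measurableT_comp => //; apply: measurable_fun_limn_esup => j.
    exact: measurableT_comp.
  - exact/measurable_EFinP.
  - move=> x Dx; rewrite limn_einf_lim; apply: lime_ge; first exact: is_cvg_einfs.
    apply: nearW => j; apply: le_ereal_inf_tmp => _ [i _ <-]; exact: G0.
  - by move=> x _; rewrite lee_fin.
  - apply: filterS Ff => x /[apply] Fx.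
    have cv : G ^~ x @ \oo --> (f x)%:E.
      apply: cvg_EFin; first exact: nearW.
      by rewrite -(cvg_shiftn J) in Fx.
    exact: (cvg_limn_einf_sup cv).1.
move=> /le_trans; apply.
rewrite limn_einf_lim; apply: lime_le; first exact: is_cvg_einfs.
apply: nearW => j; apply: ge_ereal_inf; exists (\int[mu]_(x in D) G j x)%E => //.
by exists j => //=.
Qed.

(** Dominated convergence for a fixed function cut off by indicators that tend to
    [0] almost everywhere. *)
Lemma integral_vanishing (b : nat -> T -> bool) (h : T -> R) :
  (forall j, measurable_fun D (b j)) -> measurable_fun D h -> (forall x, 0 <= h x) ->
  (\int[mu]_(x in D) (h x)%:E < +oo)%E ->
  {ae mu, forall x, D x -> \forall j \near \oo, b j x = false} ->
  (\int[mu]_(x in D) (if b j x then h x else 0)%:E)%E @[j --> \oo] --> (0 : \bar R).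
Proof.
move=> mb mh h0 hy b0.
have mF j : measurable_fun D (fun x => (if b j x then h x else 0)%:E).
  apply/measurable_EFinP; apply: measurable_fun_if => //.
  by apply: (measurable_funS mD) => //; exact: subIsetl.
have ih : mu.-integrable D (fun x => (h x)%:E).
  apply/integrableP; split; first exact/measurable_EFinP.
  by under eq_integral do rewrite gee0_abs ?lee_fin//.
have cv : {ae mu, forall x, D x ->
    (if b j x then h x else 0)%:E @[j --> \oo] --> (cst 0%E x : \bar R)}.
  apply: filterS b0 => x /[apply] bx; apply: cvg_near_cst.
  by apply: filterS bx => j ->.
have dom : {ae mu, forall x j, D x -> (`|(if b j x then h x else 0)%:E| <= (h x)%:E)%E}.
  by apply: aeW => x j _; rewrite lee_fin; case: (b j x); rewrite ?normr0// ger0_norm.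
have m0 : measurable_fun D (cst 0%E : T -> \bar R) by exact: measurable_cst.
have [_ _] := dominated_convergence mD mF m0 cv ih dom.
by rewrite integral0.
Qed.

End limits.

(** * Truncation in Orlicz-Sobolev spaces *)

Section orlicz_sobolev_calculus.
Context {R : realType} (n : nat).
Variables (Om : set 'rV[R]_n) (Phi : R -> R) (a : R).
Hypotheses (mOm : measurable Om) (finOm : (@lebesgue_rV R n Om < +oo)%E).
Hypotheses (Y : doubling_young Phi a) (a1 : 1 <= a).
Local Notation mu := (@lebesgue_rV R n).
Local Notation YI := (young_integral mu Om Phi).
Implicit Types (u v w : 'rV[R]_n -> R) (Du Dv : 'rV[R]_n -> 'rV[R]_n).

Lemma sobolev0_measurable u Du : sobolev0 Phi Om u Du ->
  measurable_fun Om u /\ forall i, measurable_fun Om (fun x => Du x 0 i).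
Proof.
move=> [[[mu' _] wDu] _]; split; first exact: mu'.
by move=> i; exact: (wDu i).2.1.
Qed.

Lemma sobolev0_partial_lty u Du i e : sobolev0 Phi Om u Du -> 0 < e ->
  (YI (fun x => Du x 0%R i) e < +oo)%E.
Proof.
move=> [[_ wDu] _] e0; have [_ [mDi [r r0 H]]] := wDu i.
exact: (@young_integral_lty _ _ _ mu Om mOm Phi a Y _ r e mDi r0 e0 H).
Qed.

Lemma sobolev0_sequence u Du : sobolev0 Phi Om u Du ->
  exists psi : nat -> 'rV[R]_n -> R, [/\ forall j, test_function Om (psi j),
    forall j, (YI (u \- psi j)%R (2^-1 ^+ j) <= 1)%E,
    forall j i, (YI (fun x => Du x 0%R i - partial i (psi j) x)%R (2^-1 ^+ j) <= 1)%E &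
    {ae mu, forall x, Om x -> psi j x @[j --> \oo] --> u x}].
Proof.
move=> su; have ap := sobolev0_approximable mOm Y su.
have [mu' mDu] := sobolev0_measurable su.
have half0 j : 0 < (2^-1 : R) ^+ j by rewrite exprn_gt0.
have /choice[psi psiP] : forall j, exists w, test_function Om w /\
    (YI (u \- w)%R (2^-1 ^+ j) <= 1)%E /\
    forall i, (YI (fun x => Du x 0%R i - partial i w x)%R (2^-1 ^+ j) <= 1)%E.
  by move=> j; have [w tw [H Hi]] := ap _ (half0 j); exists w.
exists psi; split=> [j|j|j i|].
- by have [] := psiP j.
- by have [_ []] := psiP j.
- by have [_ []] := psiP j.
have md j : measurable_fun Om (u \- psi j).
  by apply: measurable_funB => //; apply: test_measurable; have [] := psiP j.
have := ae_cvg_of_young mOm finOm Y a1 md (fun j => (psiP j).2.1).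
apply: filterS => x /[apply] c0.
have : (fun j => u x - (u \- psi j) x) @ \oo --> u x - 0.
  by apply: cvgB => //; exact: cvg_cst.
by rewrite subr0; under eq_fun do rewrite /= subKr.
Qed.

Lemma test_functionN w : test_function Om w -> test_function Om (fun x => - w x).
Proof.
move=> tw; apply: (test_function_sub _ tw) => [j|x ->]; last by rewrite oppr0.
rewrite (_ : (fun x => - w x) = cst (- 1) \* w).
  exact: (CkM (@Ck_cst R n j (- 1)) (test_smooth j tw)).
by apply/funext => x /=; rewrite mulN1r.
Qed.

Lemma test_partialN w i x : test_function Om w ->
  partial i (fun x => - w x) x = - partial i w x.
Proof.
by move=> tw; have [_ ] := is_deriveN (test_is_derive i x tw).
Qed.

Lemma sobolev0N u Du : sobolev0 Phi Om u Du ->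
  sobolev0 Phi Om (fun x => - u x) (fun x => - Du x).
Proof.
move=> su; have [mu' mDu] := sobolev0_measurable su.
apply: (approximable_sobolev0 mOm finOm Y a1).
- exact: measurableT_comp.
- move=> i; under eq_fun do rewrite mxE; exact: measurableT_comp.
move=> e e0; have [w tw [H Hi]] := sobolev0_approximable mOm Y su e0.
exists (fun x => - w x); first exact: test_functionN.
split=> [|i].
  apply: le_trans H; apply: (young_integral_le mu Y e0) => x _ /=.
  by rewrite -opprD normrN.
apply: le_trans (Hi i); apply: (young_integral_le mu Y e0) => x _ /=.
by rewrite test_partialN// mxE -opprD normrN.
Qed.

(** The chain rule for the softplus truncation.  Test functions approximating [u]
    are truncated to test functions approximating the truncation of [u].  The
    gradients converge because
    [sigmoid u *: Du - sigmoid psi *: grad psi =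
     (sigmoid u - sigmoid psi) *: Du + sigmoid psi *: (Du - grad psi)], where
    dominated convergence applies to the first term. *)
Lemma sobolev0_softplus u Du k e : 0 < e -> sobolev0 Phi Om u Du ->
  sobolev0 Phi Om (fun x => softplus k e (u x) - softplus k e 0)
    (fun x => sigmoid k e (u x) *: Du x).
Proof.
move=> e0 su; have [mu' mDu] := sobolev0_measurable su.
have [psi [tpsi H Hi cvpsi]] := sobolev0_sequence su.
have ms : measurable_fun setT (sigmoid k e).
  by apply: continuous_measurable_fun; exact: continuous_sigmoid.
have msp : measurable_fun setT (softplus k e).
  by apply: continuous_measurable_fun; exact: continuous_softplus.
have msu : measurable_fun Om (fun x => sigmoid k e (u x)) by exact: measurableT_comp ms mu'.
have mpsi j : measurable_fun Om (psi j) by exact: test_measurable.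
have mspsi j : measurable_fun Om (fun x => sigmoid k e (psi j x)).
  exact: measurableT_comp ms (mpsi j).
apply: (approximable_sobolev0 mOm finOm Y a1).
- apply: measurable_funB; last exact: measurable_cst.
  exact: measurableT_comp msp mu'.
- by move=> i; under eq_fun do rewrite mxE; exact: measurable_funM.
move=> r r0; have r20 : 0 < r / 2 by rewrite divr_gt0.
pose c j x := sigmoid k e (u x) - sigmoid k e (psi j x).
have mc j : measurable_fun Om (c j) by exact: measurable_funB.
have c1 j x : `|c j x| <= 1.
  have := sigmoid_ge0 k e (u x); have := sigmoid_le1 k e (u x).
  have := sigmoid_ge0 k e (psi j x); have := sigmoid_le1 k e (psi j x).
  by rewrite ler_norml /c; lra.
have c0 : {ae mu, forall x, Om x -> c j x @[j --> \oo] --> 0}.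
  apply: filterS cvpsi => x /[apply] px.
  rewrite -[X in _ --> X](subrr (sigmoid k e (u x))); apply: cvgB; first exact: cvg_cst.
  by apply: cvg_comp px _; exact: continuous_sigmoid.
have near1 : \forall j \near \oo, forall i,
    (YI (fun x => c j x * Du x 0 i)%R (r / 2) < (2^-1)%:E)%E.
  apply: filter_forall => i.
  have := young_integral_cvg0 mOm Y r20 mc c1 c0 (mDu i) (sobolev0_partial_lty i su r20).
  by move=> /ereal_cvg0_lt; apply; rewrite invr_gt0.
have near2 : \forall j \near \oo, (2^-1 : R) ^+ j <= r / 4.
  have r4 : 0 < r / 4 by rewrite divr_gt0.
  have hl : `|2^-1 : R| < 1 by rewrite ger0_norm ?invr_ge0// invf_lt1// ltr1n.
  have H4 := cvgr_lt 0 (cvg_expr hl) _ r4.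
  by have [J _ HJ] := H4; exists J => // j /HJ /ltW.
have [j [N1 N2]] : exists j, (forall i, (YI (fun x => c j x * Du x 0 i)%R (r / 2) < (2^-1)%:E)%E) /\
    (2^-1 : R) ^+ j <= r / 4.
  have [j] := filter_ex (filterI near1 near2); by exists j.
exists (fun x => softplus k e (psi j x) - softplus k e 0); first exact: test_function_softplus.
have mpj i : measurable_fun Om (partial i (psi j)) by exact: test_partial_measurable.
have half0 : 0 < (2^-1 : R) ^+ j by rewrite exprn_gt0.
split=> [|i].
  apply: (@le_trans _ _ (YI (u \- psi j)%R r)).
    apply: (young_integral_le mu Y r0) => x _ /=.
    by rewrite opprB addrA subrK; exact: softplus_lipschitz.
  apply: (young_integral_le1 mOm Y (measurable_funB mu' (mpsi j)) half0 _ (H j)).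
  by apply: (le_trans N2); lra.
pose g x := Du x 0 i - partial i (psi j) x.
have mg : measurable_fun Om g by exact: measurable_funB.
have mcD : measurable_fun Om (fun x => c j x * Du x 0 i) by exact: measurable_funM.
have := young_integral_add mu mOm Y mcD mg r20
  (h := fun x => (sigmoid k e (u x) *: Du x) 0 i -
    partial i (fun x => softplus k e (psi j x) - softplus k e 0) x).
rewrite (_ : 2 * (r / 2) = r); last by field.
move=> H2; apply: (le_trans (H2 _)).
  move=> x _; rewrite (@test_softplus_partial _ _ Om (psi j) k e i x e0 (tpsi j)) mxE.
  have -> : sigmoid k e (u x) * Du x 0 i - sigmoid k e (psi j x) * partial i (psi j) x =
     c j x * Du x 0 i + sigmoid k e (psi j x) * g x by rewrite /c /g; ring.
  apply: (le_trans (ler_normD _ _)); rewrite lerD2l normrM ger0_norm ?sigmoid_ge0//.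
  by rewrite -[leRHS]mul1r ler_wpM2r// sigmoid_le1.
have -> : (1 = (2^-1)%:E + (2^-1)%:E :> \bar R)%E by rewrite -EFinD; congr (_%:E); field.
apply: leeD; first exact: ltW (N1 i).
have jr : 2^-1 ^+ j <= r / 2 by apply: (le_trans N2); lra.
apply: (le_trans (young_integral_shrink mOm Y mg half0 jr (Hi j i))).
rewrite lee_fin ler_pdivrMr//; apply: (le_trans N2).
by rewrite le_eqVlt; apply/orP; left; apply/eqP; field.
Qed.

End orlicz_sobolev_calculus.

(** * The Sobolev inequality above a level *)

Section sobolev_level.
Context {R : realType} (n : nat).
Variables (Om : set 'rV[R]_n.+2) (Phi : R -> R) (a : R).
Hypotheses (mOm : measurable Om) (finOm : (@lebesgue_rV R n.+2 Om < +oo)%E).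
Hypotheses (Y : doubling_young Phi a) (a1 : 1 <= a) (aN : a < n.+2%:R).
Local Notation mu := (@lebesgue_rV R n.+2).
Local Notation YI := (young_integral mu Om Phi).
Local Notation astar := (sobolev_conj n.+2 a).
Implicit Types (u : 'rV[R]_n.+2 -> R) (Du : 'rV[R]_n.+2 -> 'rV[R]_n.+2).

Let a0 : 0 < a. Proof. exact: lt_le_trans a1. Qed.

Definition grad_pow Du x : R := \sum_i `|Du x 0 i| `^ a.

Lemma grad_pow_ge0 Du x : 0 <= grad_pow Du x.
Proof. by apply: sumr_ge0 => i _; exact: powR_ge0. Qed.

Lemma measurable_grad_pow Du : (forall i, measurable_fun Om (fun x => Du x 0 i)) ->
  measurable_fun Om (grad_pow Du).
Proof.
move=> mDu; apply: measurable_sum => i; apply: measurable_funpow.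
by apply: measurableT_comp (mDu i); exact: normr_measurable.
Qed.

Lemma grad_pow_integral_lty u Du : sobolev0 Phi Om u Du ->
  (\int[mu]_(x in Om) (grad_pow Du x)%:E < +oo)%E.
Proof.
move=> su; have [_ mDu] := sobolev0_measurable su.
have [K K0 HK] := young_growth Y.
rewrite /grad_pow; under eq_integral do rewrite -sumEFin.
rewrite ge0_integral_sum; last 3 first.
- exact: mOm.
- move=> i; apply/measurable_EFinP; apply: measurable_funpow.
  by apply: measurableT_comp (mDu i); exact: normr_measurable.
- by move=> i x _; rewrite lee_fin powR_ge0.
apply: lte_sum_pinfty => i _.
apply: (power_integral_lty mOm finOm Y K0 HK (mDu i)).
exact: (sobolev0_partial_lty mOm Y i su ltr01).
Qed.

Lemma test_grad_pow w x : \sum_i `|partial i w x| `^ a = grad_pow (grad w) x.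
Proof. by apply: eq_bigr => i _; rewrite /grad mxE. Qed.

Lemma grad_pow_add_le Du Dw x : grad_pow Dw x <=
  2 `^ a * (grad_pow (fun x => Du x - Dw x) x + grad_pow Du x).
Proof.
rewrite /grad_pow -big_split mulr_sumr; apply: ler_sum => i _.
apply: le_trans (powR_add_le (ltW a0) (normr_ge0 _) (normr_ge0 _)).
apply: le_powR => //; first exact: ltW.
have -> : (Du x - Dw x) 0 i = Du x 0 i - Dw x 0 i by rewrite !mxE.
have := ler_normB (Du x 0 i) (Du x 0 i - Dw x 0 i); rewrite subKr => /le_trans; apply.
by rewrite addrC.
Qed.

(** Passage to the limit in [sobolev_test] along test functions [psi j] that tend to
    [u].  On the left this is Fatou's lemma.  On the right, the set where
    [k <= psi j] need not lie in the one where [k <= u], but the gradient of [u] has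
    a vanishing integral over the difference.  The bound [X] is strict to leave
    room for these errors. *)
Lemma sobolev_level : exists2 S : R, 0 < S & forall u Du (k X : R),
  sobolev0 Phi Om u Du -> 0 <= k ->
  (\int[mu]_(x in Om) (if k <= u x then grad_pow Du x else 0)%:E < X%:E)%E ->
  (\int[mu]_(x in Om) (Num.max (u x - k) 0 `^ astar)%:E <= (S * X `^ (astar / a))%:E)%E.
Proof.
have s0 := sobolev_conj_gt0 a1 aN.
have [K K0 HK] := young_growth Y.
pose S0 : R := (n.+2%:R * (a * n.+1%:R / (n.+2%:R - a))) `^ astar.
have S00 : 0 < S0.
  by rewrite powR_gt0// mulr_gt0// divr_gt0 ?mulr_gt0// subr_gt0.
exists (S0 * (2 `^ a) `^ (astar / a)) => [|u Du k X su k0].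
  by rewrite mulr_gt0// !powR_gt0.
set A := (\int[mu]_(x in Om) _)%E => AX.
have A0 : (0 <= A)%E.
  by apply: integral_ge0 => x _; rewrite lee_fin; case: ifPn => // _; exact: grad_pow_ge0.
have Afin : A \is a fin_num by rewrite ge0_fin_numE// (lt_trans AX)// ltry.
have [mu' mDu] := sobolev0_measurable su.
have [psi [tpsi H Hi cvpsi]] := sobolev0_sequence mOm finOm Y a1 su.
have mh := measurable_grad_pow mDu.
have mpsi j : measurable_fun Om (psi j) by exact: test_measurable.
have mpow (f : 'rV[R]_n.+2 -> R) : measurable_fun Om f ->
    measurable_fun Om (fun x => Num.max (f x - k) 0 `^ astar).
  move=> mf; apply: measurable_funpow; apply: measurable_maxr; last exact: measurable_cst.
  by apply: measurable_funB => //; exact: measurable_cst.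
pose del := (X - fine A) / 2.
have del0 : 0 < del by rewrite divr_gt0// subr_gt0 -lte_fin fineK.
(* The part of the superlevel set of [psi j] that is not one of [u]. *)
pose b j x := (k <= psi j x) && (u x < k).
have mb j : measurable_fun Om (b j).
  apply: measurable_and; first by apply: measurable_fun_ler => //; exact: measurable_cst.
  by apply: measurable_fun_ltr => //; exact: measurable_cst.
have b0 : {ae mu, forall x, Om x -> \forall j \near \oo, b j x = false}.
  apply: filterS cvpsi => x /[apply] px.
  have [uk|ku] := ltP (u x) k; last by apply: nearW => j; rewrite /b [X in _ && X]ltNge ku andbF.
  have [J _ HJ] := cvgr_lt _ px _ uk.
  by exists J => // j /HJ pk; rewrite /b leNgt pk.
have E0 := integral_vanishing mOm mb mh (grad_pow_ge0 Du) (grad_pow_integral_lty su) b0.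
have {}E0 := ereal_cvg0_lt E0 del0.
pose C := K * (fine (mu Om) + 1).
have C0 : 0 < C by rewrite mulr_gt0// ltr_wpDl// fine_ge0.
have half0 j : 0 < (2^-1 : R) ^+ j by rewrite exprn_gt0.
have half1 j : (2^-1 : R) ^+ j <= 1 by rewrite exprn_ile1// invf_le1// ler1n.
have mgj j i : measurable_fun Om (fun x => Du x 0 i - partial i (psi j) x).
  by apply: measurable_funB => //; exact: test_partial_measurable.
have mgp j : measurable_fun Om (grad_pow (fun x => Du x - grad (psi j) x)).
  by apply: measurable_grad_pow => i; under eq_fun do rewrite gradE; exact: mgj.
have G j : (\int[mu]_(x in Om) (grad_pow (fun x => Du x - grad (psi j) x) x)%:E <=
    (2^-1 ^+ j * (n.+2%:R * C))%:E)%E.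
  rewrite /grad_pow; under eq_integral do rewrite -sumEFin.
  rewrite ge0_integral_sum; last 3 first.
  - exact: mOm.
  - move=> i; apply/measurable_EFinP; apply: measurable_funpow.
    by apply: measurableT_comp; [exact: normr_measurable|under eq_fun do rewrite gradE; exact: mgj].
  - by move=> i x _; rewrite lee_fin powR_ge0.
  apply: (@le_trans _ _ (\sum_(i < n.+2) (2^-1 ^+ j * C)%:E)%E); last first.
    by rewrite sumEFin sumr_const card_ord lee_fin -[leLHS]mulr_natl [leLHS]mulrCA.
  apply: lee_sum => i _; under eq_integral do rewrite gradE.
  apply: (le_trans (power_integral_le mOm finOm Y K0 a0 HK (mgj j i) (half0 j) (Hi j i))).
  rewrite lee_fin ler_wpM2r ?(ltW C0)//.
  have hj : 0 < (2^-1 : R) ^+ j <= 1 by rewrite half0 half1.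
  by have := ger_powR hj a1; rewrite powRr1 ?(ltW (half0 j)).
have Gn : \forall j \near \oo, (2^-1 : R) ^+ j * (n.+2%:R * C) <= del.
  have d0 : 0 < del / (n.+2%:R * C) by rewrite divr_gt0// mulr_gt0.
  have hl : `|2^-1 : R| < 1 by rewrite ger0_norm ?invr_ge0// invf_lt1// ltr1n.
  have [J _ HJ] := cvgr_lt 0 (cvg_expr hl) _ d0.
  by exists J => // j /HJ /ltW; rewrite ler_pdivlMr// mulr_gt0.
apply: (fatou_bound mOm (F := fun j x => Num.max (psi j x - k) 0 `^ astar)).
- by move=> j; exact: mpow.
- exact: mpow.
- by move=> j x; exact: powR_ge0.
- by move=> x; exact: powR_ge0.
- apply: filterS cvpsi => x /[apply] px.
  apply: (@cvg_comp _ _ _ (fun j => psi j x - k) (fun t : R => Num.max t 0 `^ astar)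
    _ (nbhs (u x - k))); first by apply: cvgB => //; exact: cvg_cst.
  exact: continuous_pospow (ltW s0) _.
near=> j.
have Ej : (\int[mu]_(x in Om) (if b j x then grad_pow Du x else 0)%:E < del%:E)%E.
  by near: j; exact: E0.
have Gj : (2^-1 : R) ^+ j * (n.+2%:R * C) <= del by near: j; exact: Gn.
have ST := sobolev_test mOm finOm a1 aN (tpsi j) k0.
apply: (le_trans ST).
pose gd := grad_pow (fun x => Du x - grad (psi j) x).
have T_le : (\int[mu]_(x in Om)
    (if k <= psi j x then \sum_i `|partial i (psi j) x| `^ a else 0)%:E <= (2 `^ a * X)%:E)%E.
  apply: (@le_trans _ _ (\int[mu]_(x in Om) ((2 `^ a)%:E * ((gd x)%:E +
      ((if k <= u x then grad_pow Du x else 0)%:E + (if b j x then grad_pow Du x else 0)%:E))))%E).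
    apply: le_integral_nonneg => x _; rewrite test_grad_pow.
      by rewrite lee_fin; case: ifPn => // _; exact: grad_pow_ge0.
    rewrite -!EFinD -EFinM lee_fin.
    have g1 := grad_pow_ge0 (fun x => Du x - grad (psi j) x) x.
    have g2 := grad_pow_ge0 Du x.
    have p2 := powR_ge0 2 a.
    rewrite /b; case: ifPn => [kp|_] /=; last first.
      by rewrite mulr_ge0// !addr_ge0//; case: ifPn.
    apply: (le_trans (grad_pow_add_le Du _ x)); rewrite ler_wpM2l// lerD2l.
    by rewrite ltNge; case: (k <= u x); rewrite /= ?addr0 ?add0r.
  have m1 : measurable_fun Om (fun x => (gd x)%:E).
    by apply/measurable_EFinP; exact: mgp.
  have m2 : measurable_fun Om (fun x => (if k <= u x then grad_pow Du x else 0)%:E).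
    by apply/measurable_EFinP; apply: measurable_if_ge; [exact: mOm|exact: mu'|exact: mh].
  have m3 : measurable_fun Om (fun x => (if b j x then grad_pow Du x else 0)%:E).
    apply/measurable_EFinP; apply: measurable_fun_if; [exact: mOm|exact: mb| |exact: measurable_cst].
    by apply: (measurable_funS mOm) => //; exact: subIsetl.
  have p1 x : Om x -> (0 <= (gd x)%:E)%E.
    by rewrite lee_fin grad_pow_ge0.
  have p2 x : Om x -> (0 <= (if k <= u x then grad_pow Du x else 0)%:E)%E.
    by rewrite lee_fin; case: ifPn => // *; exact: grad_pow_ge0.
  have p3 x : Om x -> (0 <= (if b j x then grad_pow Du x else 0)%:E)%E.
    by rewrite lee_fin; case: ifPn => // *; exact: grad_pow_ge0.
  rewrite ge0_integralZl_EFin; last 4 first.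
  - exact: mOm.
  - by move=> x Ox; rewrite !adde_ge0 ?p1 ?p2 ?p3.
  - exact: emeasurable_funD m1 (emeasurable_funD m2 m3).
  - exact: powR_ge0.
  rewrite ge0_integralD; last 5 first.
  - exact: mOm.
  - exact: p1.
  - exact: m1.
  - by move=> x Ox; rewrite adde_ge0 ?p2 ?p3.
  - exact: emeasurable_funD.
  rewrite (ge0_integralD _ mOm p2 m2 p3 m3) -/A EFinM.
  apply: lee_wpmul2l; first by rewrite lee_fin powR_ge0.
  have -> : X = del + (fine A + del) by rewrite /del; field.
  rewrite 2!EFinD fineK//; apply: leeD.
    by apply: (le_trans (G j)); rewrite lee_fin.
  by apply: leeD => //; exact: ltW.
have X0 : 0 <= X by rewrite -lee_fin (le_trans A0)// ltW.
have -> : ((S0 * (2 `^ a) `^ (astar / a)) * X `^ (astar / a))%:E =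
    (S0%:E * ((2 `^ a * X)%:E `^ (astar / a)))%E.
  by rewrite poweR_EFin -EFinM powRM ?powR_ge0// mulrA.
apply: lee_wpmul2l; first by rewrite lee_fin ltW.
apply: le_poweR; [by rewrite divr_ge0// ltW| |exact: T_le].
by apply: integral_ge0 => x _; rewrite lee_fin; case: ifPn => // _; apply: sumr_ge0 => i _; exact: powR_ge0.
Unshelve. all: by end_near. Qed.

End sobolev_level.

(** * De Giorgi's iteration *)

Section level_sets.
Context d (T : measurableType d) (R : realType).
Variables (mu : {measure set T -> \bar R}) (D : set T).

(** The two parts of [f] have integrals at most that of [F].  The function to
    which this is applied is a composition with the nonlinearity of the equation,
    and only its size is under control. *)
Lemma Rintegral_le_dominated (f F : T -> R) :
  (forall x, D x -> `|f x| <= F x) -> (\int[mu]_(x in D) (F x)%:E < +oo)%E ->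
  ((\int[mu]_(x in D) f x)%R%:E <= \int[mu]_(x in D) (F x)%:E)%E.
Proof.
move=> fF Foo; pose g x := (f x)%:E.
have posF : (\int[mu]_(x in D) (g ^\+ x) <= \int[mu]_(x in D) (F x)%:E)%E.
  apply: le_integral_nonneg => x Dx; first exact: funepos_ge0.
  rewrite funeposE ge_max !lee_fin (le_trans (ler_norm _) (fF x Dx)).
  exact: le_trans (normr_ge0 _) (fF x Dx).
have negF : (\int[mu]_(x in D) (g ^\- x) <= \int[mu]_(x in D) (F x)%:E)%E.
  apply: le_integral_nonneg => x Dx; first exact: funeneg_ge0.
  rewrite funenegE ge_max !lee_fin (le_trans (ler_norm _)) ?normrN ?fF//=.
  exact: le_trans (normr_ge0 _) (fF x Dx).
have p0 : (0 <= \int[mu]_(x in D) (g ^\+ x))%E.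
  by apply: integral_ge0 => x _; exact: funepos_ge0.
have n0 : (0 <= \int[mu]_(x in D) (g ^\- x))%E.
  by apply: integral_ge0 => x _; exact: funeneg_ge0.
have pf : (\int[mu]_(x in D) (g ^\+ x))%E \is a fin_num.
  by rewrite ge0_fin_numE// (le_lt_trans posF).
have nf : (\int[mu]_(x in D) (g ^\- x))%E \is a fin_num.
  by rewrite ge0_fin_numE// (le_lt_trans negF).
have -> : (\int[mu]_(x in D) f x)%R%:E =
    (\int[mu]_(x in D) (g ^\+ x) - \int[mu]_(x in D) (g ^\- x))%E.
  by rewrite -integralE fineK// integralE fin_numB pf nf.
apply: le_trans posF.
by rewrite -[leRHS]adde0 leeD2l// oppe_le0.
Qed.

Hypothesis mD : measurable D.
Variables (w : T -> R) (s beta C : R).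
Hypotheses (mw : measurable_fun D w) (s0 : 0 < s) (beta1 : 1 < beta) (C0 : 0 < C).
Hypothesis w_lty : (\int[mu]_(x in D) (`|w x| `^ s)%:E < +oo)%E.

Let V k : \bar R := (\int[mu]_(x in D) (if k <= w x then `|w x| `^ s else 0)%:E)%E.

Hypothesis step : forall k U : R, 1 <= k -> 0 < U -> (V k <= U%:E)%E ->
  (\int[mu]_(x in D) (Num.max (w x - k) 0 `^ s)%:E <= (C * U `^ beta)%:E)%E.

Let V_ge0 k : (0 <= V k)%E.
Proof. by apply: integral_ge0 => x _; rewrite lee_fin; case: ifPn => // _; exact: powR_ge0. Qed.

Let V_mono k k' : k <= k' -> (V k' <= V k)%E.
Proof.
move=> kk'; apply: le_integral_nonneg => x _; rewrite lee_fin.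
  by case: ifPn => // _; exact: powR_ge0.
case: ifPn => [k'w|_]; first by rewrite (le_trans kk' k'w).
by case: ifPn => // _; exact: powR_ge0.
Qed.

Let mpow : measurable_fun D (fun x => `|w x| `^ s).
Proof. by apply: measurable_funpow; exact: measurableT_comp. Qed.

Let V_small e : 0 < e -> exists2 K : R, 1 <= K & (V K <= e%:E)%E.
Proof.
move=> e0; have mb j : measurable_fun D (fun x => (j%:R : R) <= w x).
  by apply: measurable_fun_ler => //; exact: measurable_cst.
have b0 : {ae mu, forall x, D x -> \forall j \near \oo, ((j%:R : R) <= w x) = false}.
  apply: aeW => x _; exists (Num.truncn `|w x|).+1 => //= j /= jw.
  apply/negbTE; rewrite -ltNge (le_lt_trans (ler_norm _))//.
  by rewrite (lt_le_trans (Num.Theory.truncnS_gt _))// ler_nat.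
have := integral_vanishing mD mb mpow (fun x => powR_ge0 _ _) w_lty b0.
move=> /ereal_cvg0_lt /(_ e0) [J _ HJ].
exists J.+1%:R; first by rewrite ler1n.
by apply/ltW/HJ => /=.
Qed.

(** De Giorgi's iteration.  Along the levels [K * (2 - 2^-1 ^+ j)] the gap between
    consecutive levels costs a factor that is geometric in [j], while the exponent
    [beta > 1] makes [V] decay superlinearly.  If [V K] is small, which holds for
    large [K] by integrability, [V] of the [j]-th level is at most a geometric
    sequence; so [V (2 * K)] vanishes. *)
Lemma bounded_of_level_estimate : exists M : R, {ae mu, forall x, D x -> w x <= M}.
Proof.
have sub2 (q : R) : q <= 1 -> 1 <= 2 - q by lra.
have sub4 (q : R) : 1 <= q -> 0 <= 2 * (2 * q) - 1 by lra.
have pw (b t : R) j : 0 <= b -> (b ^+ j) `^ t = (b `^ t) ^+ j.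
  by move=> b0; rewrite -(powR_mulrn j b0) -(powR_mulrn j (powR_ge0 b t)) powRAC.
have b0 : 0 < beta - 1 by rewrite subr_gt0.
(* [r] and [U] are such that the step turns [V <= U * r ^+ j] at the [j]-th level
   into [V <= U * r ^+ j.+1] at the next one. *)
pose r : R := 2 `^ (- s / (beta - 1)).
have r0 : 0 < r by rewrite powR_gt0.
have r1 : r < 1.
  have q0 : 0 < s / (beta - 1) by rewrite divr_gt0.
  rewrite /r mulNr powRN invf_lt1 ?powR_gt0//.
  have : (1 : R) `^ (s / (beta - 1)) < 2 `^ (s / (beta - 1)).
    by apply: gt0_ltr_powR; rewrite ?nnegrE ?ltr1n.
  by rewrite powR1.
have r_beta : 2 `^ s * r `^ beta = r.
  rewrite -[X in r `^ X](subrK 1) powRD ?(gt_eqF r0) ?implybT// powRr1 ?ltW//.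
  rewrite -powRrM divfK ?gt_eqF// mulrA -powRD ?subrr ?powRr0 ?mul1r//.
  by rewrite pnatr_eq0 implybT.
pose U : R := (r / (4 `^ s * C)) `^ (beta - 1)^-1.
have A0 : 0 < r / (4 `^ s * C) by rewrite divr_gt0// mulr_gt0// powR_gt0.
have U0 : 0 < U by rewrite powR_gt0.
have U_beta : 4 `^ s * C * U `^ beta = U * r.
  rewrite -[X in U `^ X](subrK 1) powRD ?(gt_eqF U0) ?implybT// powRr1 ?(ltW U0)//.
  rewrite {1}/U -powRrM mulVf ?gt_eqF// powRr1 ?(ltW A0)//.
  rewrite mulrA mulrCA divff ?mulr1 1?mulrC// gt_eqF// mulr_gt0// powR_gt0//.
have [K K1 VK] := V_small U0.
have K0 : 0 < K by exact: lt_le_trans K1.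
pose k j : R := K * (2 - 2^-1 ^+ j).
have half1 j : (2^-1 : R) ^+ j <= 1 by rewrite exprn_ile1// invf_le1// ler1n.
have k1 j : 1 <= k j.
  by apply: (le_trans K1); rewrite ler_peMr ?(ltW K0) ?sub2.
have decay j : (V (k j) <= (U * r ^+ j)%:E)%E.
  elim: j => [|j IH]; first by rewrite /k !expr0 mulr1 (_ : 2 - 1 = 1) ?mulr1//; ring.
  have Urj : 0 < U * r ^+ j by rewrite mulr_gt0// exprn_gt0.
  have H := step (k1 j) Urj IH.
  pose c : R := (2 ^+ j.+2) `^ s.
  have c0 : 0 <= c by exact: powR_ge0.
  apply: (@le_trans _ _ (\int[mu]_(x in D) (c%:E * (Num.max (w x - k j) 0 `^ s)%:E))%E).
    apply: le_integral_nonneg => x _; rewrite -?EFinM lee_fin.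
      by case: ifPn => // _; exact: powR_ge0.
    case: ifPn => [kw|_]; last by rewrite mulr_ge0// powR_ge0.
    have w1 : 1 <= w x by exact: le_trans (k1 j.+1) kw.
    rewrite ger0_norm; last exact: le_trans w1.
    rewrite -powRM ?exprn_ge0//; last by rewrite le_max lexx orbT.
    apply: le_powR; [exact: ltW|exact: le_trans w1|].
    (* [1 - k j / k j.+1] is at least [2 ^- j.+2]. *)
    apply: (@le_trans _ _ (2 ^+ j.+2 * (w x - k j))); last first.
      by rewrite ler_pM2l ?exprn_gt0// le_max lexx.
    have p0 : 0 < (2 : R) ^+ j by rewrite exprn_gt0.
    have p1 : 1 <= (2 : R) ^+ j by rewrite exprn_ege1// ler1n.
    move: kw; rewrite /k !exprS exprVn.
    set p := (2 : R) ^+ j in p0 p1 *; move=> kw.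
    pose W := K * (2 - 2^-1 * p^-1).
    have WE : 2 * (2 * p) * (W - K * (2 - p^-1)) = W + K / 2 * p^-1.
      by rewrite /W; field; rewrite gt_eqF.
    have H1 : 0 <= (2 * (2 * p) - 1) * (w x - W).
      by rewrite mulr_ge0 ?sub4// subr_ge0.
    have H2 : 0 <= K / 2 * p^-1 by rewrite mulr_ge0 ?invr_ge0 ?divr_ge0 ?(ltW K0) ?(ltW p0).
    have -> : 2 * (2 * p) * (w x - K * (2 - p^-1)) =
      w x + (K / 2 * p^-1 + (2 * (2 * p) - 1) * (w x - W)).
      have -> : 2 * (2 * p) * (w x - K * (2 - p^-1)) =
        2 * (2 * p) * (W - K * (2 - p^-1)) + 2 * (2 * p) * (w x - W) by ring.
      by rewrite WE; ring.
    by rewrite lerDl addr_ge0.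
  rewrite ge0_integralZl_EFin//; last 2 first.
  - by move=> x _; rewrite lee_fin powR_ge0.
  - apply/measurable_EFinP; apply: measurable_funpow; apply: measurable_maxr => //.
    by apply: measurable_funB => //; exact: measurable_cst.
  apply: (le_trans (lee_wpmul2l _ H)); first by rewrite lee_fin.
  rewrite -EFinM lee_fin le_eqVlt; apply/orP; left; apply/eqP.
  rewrite /c (_ : 2 ^+ j.+2 = 4 * 2 ^+ j :> R); last by rewrite !exprS; ring.
  rewrite !powRM ?exprn_ge0 ?(ltW U0) ?(ltW r0)// !pw ?(ltW r0)//.
  have -> : 4 `^ s * (2 `^ s) ^+ j * (C * (U `^ beta * (r `^ beta) ^+ j)) =
    (4 `^ s * C * U `^ beta) * ((2 `^ s) ^+ j * (r `^ beta) ^+ j) by ring.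
  by rewrite -exprMn r_beta U_beta -mulrA -exprS.
have V0 : V (2 * K) = 0%E.
  apply/eqP; rewrite eq_le V_ge0 andbT; apply/lee_addgt0Pr => e e0.
  rewrite add0e.
  have hl : `|r| < 1 by rewrite ger0_norm ?(ltW r0).
  have d0 : 0 < e / U by rewrite divr_gt0.
  have [J _ HJ] := cvgr_lt 0 (cvg_expr hl) _ d0.
  apply: (@le_trans _ _ (V (k J))); first apply: V_mono.
    rewrite mulrC ler_pM2l// gerBl exprn_ge0//.
  apply: (le_trans (decay J)); rewrite lee_fin mulrC -ler_pdivlMr//.
  by apply/ltW/HJ => /=.
exists (2 * K).
have mV : measurable_fun D (fun x => (if 2 * K <= w x then `|w x| `^ s else 0)%:E).
  by apply/measurable_EFinP; apply: measurable_if_ge.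
have : ae_eq mu D (fun x => (if 2 * K <= w x then `|w x| `^ s else 0)%:E) (cst 0%E).
  apply/(ae_eq_integral_abs mu mD mV); rewrite -V0; apply: eq_integral => x _.
  by rewrite gee0_abs// lee_fin; case: ifPn => // _; exact: powR_ge0.
apply: filterS => x /[apply] /=; case: ifPn => [Kw [] /eqP|]; last by rewrite -ltNge => /ltW.
by rewrite powR_eq0 normr_eq0 => /andP[/eqP w0 _]; move: Kw; rewrite w0 leNgt mulr_gt0.
Qed.

End level_sets.

(** * The energy estimate *)

Section enorm.
Context {R : realType} (n : nat).
Implicit Types v w : 'rV[R]_n.

Lemma dot_ge0 v : 0 <= dot v v.
Proof. by apply: sumr_ge0 => i _; exact: sqr_ge0. Qed.

Lemma enorm_sqr v : enorm v * enorm v = dot v v.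
Proof. by rewrite -expr2 sqr_sqrtr// dot_ge0. Qed.

Lemma enorm_ge0 v : 0 <= enorm v.
Proof. exact: sqrtr_ge0. Qed.

Lemma dotZr c v w : dot v (c *: w) = c * dot v w.
Proof. by rewrite /dot mulr_sumr; apply: eq_bigr => i _; rewrite mxE mulrCA. Qed.

Lemma dotNN v w : dot (- v) (- w) = dot v w.
Proof. by apply: eq_bigr => i _; rewrite !mxE mulrNN. Qed.

Lemma enormN v : enorm (- v) = enorm v.
Proof. by rewrite /enorm dotNN. Qed.

Lemma norm_coord_le_enorm v i : `|v 0 i| <= enorm v.
Proof.
rewrite /enorm -sqrtr_sqr; apply: ler_wsqrtr; rewrite /dot (bigD1 i)//= -expr2.
by rewrite lerDl; apply: sumr_ge0 => j _; exact: sqr_ge0.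
Qed.

Lemma enorm_le_sum v : enorm v <= \sum_i `|v 0 i|.
Proof.
have s0 : 0 <= \sum_i `|v 0 i| by exact: sumr_ge0.
rewrite -(ler_pXn2r (n := 2))// ?nnegrE ?enorm_ge0// [leLHS]expr2 enorm_sqr.
rewrite expr2 mulr_suml /dot; apply: ler_sum => i _.
have -> : v 0 i * v 0 i = `|v 0 i| * `|v 0 i| by rewrite -normrM ger0_norm// -expr2 sqr_ge0.
by rewrite ler_wpM2l// (bigD1 i)//= lerDl; exact: sumr_ge0.
Qed.

End enorm.

Section young_enorm.
Context {R : realType} (n : nat).
Variables (Om : set 'rV[R]_n.+1) (Phi : R -> R) (a : R).
Hypotheses (mOm : measurable Om) (Y : doubling_young Phi a).
Local Notation mu := (@lebesgue_rV R n.+1).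
Implicit Types (u : 'rV[R]_n.+1 -> R) (Du : 'rV[R]_n.+1 -> 'rV[R]_n.+1).

(** The Euclidean norm is at most [n.+1] times the largest entry. *)
Lemma young_enorm_le c : 0 <= c -> exists2 K : R, 0 < K & forall v : 'rV[R]_n.+1,
  Phi (c * enorm v) <= K * \sum_i Phi `|v 0 i|.
Proof.
move=> c0; have [K K0 HK] := young_dilation Y (c * n.+1%:R).
exists K => // v; pose i0 := [arg max_(i > (ord0 : 'I_n.+1)) `|v 0 i|]%O.
have max_i0 i : `|v 0 i| <= `|v 0 i0|.
  by rewrite /i0; case: arg_maxP => // j _; exact.
apply: (@le_trans _ _ (Phi (c * n.+1%:R * `|v 0 i0|))).
  apply: (young_mono Y); first by rewrite mulr_ge0// enorm_ge0.
  rewrite -mulrA ler_wpM2l// (le_trans (enorm_le_sum v))//.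
  apply: (@le_trans _ _ (\sum_(i < n.+1) `|v 0 i0|)); first by apply: ler_sum.
  by rewrite sumr_const card_ord mulr_natl.
apply: (le_trans (HK _ (normr_ge0 _))); rewrite ler_pM2l//.
rewrite (bigD1 i0)//= lerDl; apply: sumr_ge0 => i _; exact: (young_ge0 Y).
Qed.

Lemma measurable_enorm Du : (forall i, measurable_fun Om (fun x => Du x 0 i)) ->
  measurable_fun Om (fun x => enorm (Du x)).
Proof.
move=> mD; rewrite (_ : (fun x => _) = (fun x => (\sum_i (Du x 0 i * Du x 0 i)) `^ 2^-1)).
  by apply: measurable_funpow; apply: measurable_sum => i; exact: measurable_funM.
by apply/funext => x; rewrite powR12_sqrt// dot_ge0.
Qed.

Lemma young_enorm_lty u Du c : 0 <= c -> sobolev0 Phi Om u Du ->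
  (\int[mu]_(x in Om) (Phi (c * enorm (Du x)))%:E < +oo)%E.
Proof.
move=> c0 su; have [_ mDu] := sobolev0_measurable su.
have [K K0 HK] := young_enorm_le c0.
have mP i : measurable_fun Om (fun x => (Phi `|Du x 0 i|)%:E).
  apply/measurable_EFinP; apply: (measurableT_comp (young_measurable Y)).
  by apply: measurableT_comp (mDu i); exact: normr_measurable.
have P0 i x : Om x -> (0 <= (Phi `|Du x 0 i|)%:E)%E by rewrite lee_fin (young_ge0 Y).
apply: (@le_lt_trans _ _ (\int[mu]_(x in Om) (K%:E * (\sum_i (Phi `|Du x 0 i|)%:E)))%E).
  apply: le_integral_nonneg => x _; first by rewrite lee_fin (young_ge0 Y).
  by rewrite sumEFin -EFinM lee_fin.
rewrite ge0_integralZl_EFin; last 4 first.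
- exact: mOm.
- by move=> x Ox; apply: sume_ge0 => i _; exact: P0.
- by apply: emeasurable_sum => i; exact: mP.
- exact: ltW.
rewrite lte_mul_pinfty ?lee_fin ?(ltW K0)//.
rewrite ge0_integral_sum; [|exact: mOm|exact: mP|exact: P0].
apply: lte_sum_pinfty => i _.
have := sobolev0_partial_lty mOm Y i su ltr01.
by rewrite /young_integral; under eq_integral do rewrite divr1.
Qed.

End young_enorm.

Section energy.
Context {R : realType} (n : nat).
Variables (Om : set 'rV[R]_n.+1) (phi : R -> R) (a : R).
Hypotheses (mOm : measurable Om) (finOm : (@lebesgue_rV R n.+1 Om < +oo)%E).
Hypotheses (Cphi : C1 phi) (incr_phi : phi2 phi).
Hypotheses (Y : doubling_young (PhiF phi) a) (a1 : 1 <= a).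
Local Notation mu := (@lebesgue_rV R n.+1).
Variables (G B u : 'rV[R]_n.+1 -> R) (Du : 'rV[R]_n.+1 -> 'rV[R]_n.+1).
Hypothesis su : sobolev0 (PhiF phi) Om u Du.
Hypothesis weak : forall v Dv, sobolev0 (PhiF phi) Om v Dv ->
  \int[mu]_(x in Om) (phi (enorm (Du x)) * dot (Du x) (Dv x)) =
  \int[mu]_(x in Om) (G x * v x).
Hypotheses (mB : measurable_fun Om B) (GB : forall x, Om x -> `|G x| <= B x).
Hypothesis B_lty : (\int[mu]_(x in Om) (B x)%:E < +oo)%E.

(** The weak formulation tested with the softplus truncation of [u] at level [k].
    The left-hand side is the integral of [sigmoid k e u * phi (enorm Du) * enorm Du ^+ 2],
    which is at least half the modular of the gradient on the set where [k <= u];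
    then [e] tends to [0]. *)
Lemma energy_level k : 0 <= k ->
  (\int[mu]_(x in Om) (B x * Num.max (u x - k) 0)%:E < +oo)%E ->
  (\int[mu]_(x in Om) (if k <= u x then PhiF phi (enorm (Du x)) else 0)%:E <=
   2%:E * \int[mu]_(x in Om) (B x * Num.max (u x - k) 0)%:E)%E.
Proof.
move=> k0 I_lty; have [mu' mDu] := sobolev0_measurable su.
have B0 x : Om x -> 0 <= B x by move=> /GB; exact: le_trans.
set I := (\int[mu]_(x in Om) (B x * _)%:E)%E in I_lty *.
have m0 (t : R) : 0 <= Num.max t 0 by rewrite le_max lexx orbT.
have mmax : measurable_fun Om (fun x => Num.max (u x - k) 0).
  apply: measurable_maxr; last exact: measurable_cst.
  by apply: measurable_funB; [exact: mu'|exact: measurable_cst].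
set A := (\int[mu]_(x in Om) _)%E.
have half_energy e : 0 < e -> ((2^-1)%:E * A <= I + (e * ln 2)%:E * \int[mu]_(x in Om) (B x)%:E)%E.
  move=> e0; have ln2 : 0 <= e * ln (2 : R) by rewrite mulr_ge0 ?(ltW e0)// ln_ge0// ler1n.
  pose v x := softplus k e (u x) - softplus k e 0.
  pose t x := enorm (Du x).
  pose E x := sigmoid k e (u x) * (t x * (t x * phi (t x))).
  have en0 x : 0 <= t x * (t x * phi (t x)).
    exact: le_trans (young_ge0 Y _) (PhiF_le_energy Cphi incr_phi (enorm_ge0 _)).
  have E_eq x : phi (enorm (Du x)) * dot (Du x) (sigmoid k e (u x) *: Du x) = E x.
    by rewrite dotZr -enorm_sqr /E -/(t x); ring.
  have := weak (sobolev0_softplus mOm finOm Y a1 k e0 su).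
  rewrite (_ : (fun x => phi _ * dot (Du x) _) = E) => [HE|]; last exact/funext.
  (* Without this, the real-valued integral of [E] might be [0] by convention. *)
  have E_lty : (\int[mu]_(x in Om) (E x)%:E < +oo)%E.
    apply: le_lt_trans (young_enorm_lty mOm Y (ler0n R 2) su).
    apply: le_integral_nonneg => x _; rewrite lee_fin.
      by rewrite mulr_ge0 ?en0 ?sigmoid_ge0.
    apply: le_trans (energy_le_PhiF2 Cphi incr_phi (enorm_ge0 _)).
    by rewrite -[leRHS]mul1r ler_wpM2r ?en0 ?sigmoid_le1.
  have E_ge0 : (0 <= \int[mu]_(x in Om) (E x)%:E)%E.
    by apply: integral_ge0 => x _; rewrite lee_fin mulr_ge0 ?en0 ?sigmoid_ge0.
  have EE : (\int[mu]_(x in Om) (E x)%:E)%E = (\int[mu]_(x in Om) E x)%R%:E.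
    by rewrite /Rintegral fineK// ge0_fin_numE.
  (* Both softplus terms of [v] are nonnegative and, since [0 <= k], the second one is
     at most [e * ln 2]. *)
  have v_le x : Om x -> `|v x| <= Num.max (u x - k) 0 + e * ln 2.
    move=> _; have := softplus_le k e0 (u x); have := softplus_le k e0 0.
    have := softplus_ge0 k e0 (u x); have := softplus_ge0 k e0 0.
    rewrite [Num.max (0 - k) 0]max_r ?sub0r ?oppr_le0// add0r.
    have := m0 (u x - k); rewrite ler_norml /v.
    move: (softplus _ _ _) (softplus _ _ _) (Num.max _ _) (e * ln 2) ln2 => p q r s.
    move=> {}; lra.
  have mBmax : measurable_fun Om (fun x => (B x * Num.max (u x - k) 0)%:E).
    by apply/measurable_EFinP; exact: measurable_funM.
  have RHS : (\int[mu]_(x in Om) (B x * (Num.max (u x - k) 0 + e * ln 2))%:E =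
      I + (e * ln 2)%:E * \int[mu]_(x in Om) (B x)%:E)%E.
    rewrite -ge0_integralZl_EFin; last 4 first.
    - exact: mOm.
    - by move=> x Ox; rewrite lee_fin B0.
    - by apply/measurable_EFinP; exact: mB.
    - exact: ln2.
    rewrite -ge0_integralD; last 5 first.
    - exact: mOm.
    - by move=> x Ox; rewrite lee_fin mulr_ge0 ?B0 ?m0.
    - exact: mBmax.
    - by move=> x Ox; rewrite mule_ge0// lee_fin ?B0.
    - by apply: emeasurable_funM; [exact: measurable_cst|apply/measurable_EFinP; exact: mB].
    by apply: eq_integral => x _; rewrite -EFinM -EFinD; congr (_%:E); ring.
  apply: (@le_trans _ _ (\int[mu]_(x in Om) (E x)%:E)%E).
    rewrite -ge0_integralZl_EFin; last 4 first.
    - exact: mOm.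
    - by move=> x _; rewrite lee_fin; case: ifPn => // _; exact: (young_ge0 Y).
    - apply/measurable_EFinP; apply: measurable_if_ge; [exact: mOm|exact: mu'|].
      exact: measurableT_comp (young_measurable Y) (measurable_enorm mDu).
    - by rewrite invr_ge0.
    apply: le_integral_nonneg => x _; rewrite -EFinM lee_fin.
      by rewrite mulr_ge0 ?invr_ge0//; case: ifPn => // _; exact: (young_ge0 Y).
    case: ifPn => [ku|_]; last by rewrite mulr0 mulr_ge0 ?en0 ?sigmoid_ge0.
    apply: ler_pM.
    - by rewrite invr_ge0.
    - exact: (young_ge0 Y).
    - exact: sigmoid_ge_half.
    - rewrite /t; exact: (PhiF_le_energy Cphi incr_phi (enorm_ge0 (Du x))).
  rewrite EE HE -RHS; apply: Rintegral_le_dominated => [x Ox|].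
    by rewrite normrM; apply: ler_pM => //; [exact: GB|exact: v_le].
  by rewrite RHS lte_add_pinfty// lte_mul_pinfty ?lee_fin.
have I0 : (0 <= I)%E.
  by apply: integral_ge0 => x Ox; rewrite lee_fin mulr_ge0 ?B0.
have J0 : (0 <= \int[mu]_(x in Om) (B x)%:E)%E.
  by apply: integral_ge0 => x Ox; rewrite lee_fin B0.
rewrite -[A]mul1e (_ : 1 = 2%:E * (2^-1)%:E)%E; last first.
  by rewrite -EFinM divff.
rewrite -muleA; apply: lee_wpmul2l => //.
apply/lee_addgt0Pr => e e0.
have ln2 : 0 < ln (2 : R) by rewrite ln_gt0// ltr1n.
have J_lty := B_lty; set J := (\int[mu]_(x in Om) (B x)%:E)%E in J_lty J0 half_energy.
have Jf : J \is a fin_num by rewrite ge0_fin_numE.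
have j0 : 0 <= fine J by exact: fine_ge0.
have d0 : 0 < ln 2 * (fine J + 1) by rewrite mulr_gt0// ltr_wpDl.
apply: (le_trans (half_energy _ (divr_gt0 e0 d0))).
rewrite -(fineK Jf) -EFinM; apply: leeD2l; rewrite lee_fin.
rewrite -mulrA mulrAC ler_pdivrMr// ler_pM2l// ler_pM2l//.
by rewrite lerDl.
Qed.

End energy.

(** * Boundedness of solutions with critical growth *)

Section bounded_solutions.
Context {R : realType} (n : nat).
Variables (Om : set 'rV[R]_n.+2) (phi : R -> R) (a : R).
Hypotheses (mOm : measurable Om) (finOm : (@lebesgue_rV R n.+2 Om < +oo)%E).
Hypotheses (Cphi : C1 phi) (incr_phi : phi2 phi).
Hypotheses (Y : doubling_young (PhiF phi) a) (a1 : 1 <= a) (aN : a < n.+2%:R).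
Local Notation mu := (@lebesgue_rV R n.+2).
Local Notation astar := (sobolev_conj n.+2 a).
Implicit Types (u : 'rV[R]_n.+2 -> R) (Du : 'rV[R]_n.+2 -> 'rV[R]_n.+2).

Let a0 : 0 < a. Proof. exact: lt_le_trans a1. Qed.

Lemma sobolev_conj_gt : a < astar.
Proof.
have Na : 0 < n.+2%:R - a by rewrite subr_gt0.
by rewrite /sobolev_conj ltr_pdivlMr// ltr_pM2l// gtrBl.
Qed.

Let astar1 : 1 <= astar. Proof. exact: le_trans a1 (ltW sobolev_conj_gt). Qed.

Let astar0 : 0 < astar. Proof. exact: lt_le_trans astar1. Qed.

(** The level estimate at [k = 0], for [u] and for [- u]. *)
Lemma sobolev0_power_lty u Du : sobolev0 (PhiF phi) Om u Du ->
  (\int[mu]_(x in Om) (`|u x| `^ astar)%:E < +oo)%E.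
Proof.
move=> su; have [S S0 HS] := sobolev_level mOm finOm Y a1 aN.
have pos w Dw : sobolev0 (PhiF phi) Om w Dw ->
    (\int[mu]_(x in Om) (Num.max (w x) 0 `^ astar)%:E < +oo)%E.
  move=> sw; have gy := grad_pow_integral_lty mOm finOm Y sw.
  have g0 : (0 <= \int[mu]_(x in Om) (grad_pow a Dw x)%:E)%E.
    by apply: integral_ge0 => x _; rewrite lee_fin grad_pow_ge0.
  set I := (\int[mu]_(x in Om) _)%E in gy g0.
  have If : I \is a fin_num by rewrite ge0_fin_numE.
  have X_lt : (\int[mu]_(x in Om) (if (0 : R) <= w x then grad_pow a Dw x else 0)%:E <
      (fine I + 1)%:E)%E.
    apply: (@le_lt_trans _ _ I); last by rewrite EFinD fineK// lteDl// lte_fin.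
    apply: le_integral_nonneg => x _; rewrite lee_fin; case: ifPn => // _; exact: grad_pow_ge0.
  have := HS _ _ _ _ sw (lexx 0) X_lt.
  under eq_integral do rewrite subr0.
  by move=> /le_lt_trans; apply; rewrite ltry.
have [mu' _] := sobolev0_measurable su.
have mp (w : 'rV[R]_n.+2 -> R) : measurable_fun Om w -> measurable_fun Om (fun x => (Num.max (w x) 0 `^ astar)%:E).
  move=> mw; apply/measurable_EFinP; apply: measurable_funpow.
  by apply: measurable_maxr; [exact: mw|exact: measurable_cst].
apply: (@le_lt_trans _ _ (\int[mu]_(x in Om) ((Num.max (u x) 0 `^ astar)%:E +
    (Num.max (- u x)%R 0 `^ astar)%:E))%E).
  apply: le_integral_nonneg => x _; rewrite -?EFinD lee_fin ?powR_ge0//.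
  have [u0|u0] := leP 0 (u x).
    by rewrite ger0_norm// lerDl powR_ge0.
  by rewrite ltr0_norm// [Num.max (- u x) 0]max_l ?oppr_ge0 ?(ltW u0)// lerDr powR_ge0.
rewrite ge0_integralD; last 5 first.
- exact: mOm.
- by move=> x _; rewrite lee_fin powR_ge0.
- exact: mp mu'.
- by move=> x _; rewrite lee_fin powR_ge0.
- by apply: (mp (fun x => - u x)); exact: measurableT_comp mu'.
apply: lte_add_pinfty; first exact: pos su.
exact: pos (sobolev0N mOm finOm Y a1 su).
Qed.

Variables (C : R) (C0 : 0 < C).

Let B u x : R := C * (`|u x| `^ (a - 1) + `|u x| `^ (astar - 1)).

(** At a level [k >= 1], and where [k <= u], all powers of [u] in the energy estimate
    are at most [`|u| `^ astar].  The integral [V k] of the latter over this set thus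
    bounds the energy above [k], hence the gradient to the power [a] above [k].  The
    Sobolev inequality turns this into the hypothesis of De Giorgi's iteration,
    with exponent [astar / a > 1]. *)
Lemma bounded_above_of_critical_growth (G : 'rV[R]_n.+2 -> R) u Du :
  (forall x, Om x -> `|G x| <= B u x) ->
  sobolev0 (PhiF phi) Om u Du ->
  (forall v Dv, sobolev0 (PhiF phi) Om v Dv ->
    \int[mu]_(x in Om) (phi (enorm (Du x)) * dot (Du x) (Dv x)) =
    \int[mu]_(x in Om) (G x * v x)) ->
  exists M : R, {ae mu, forall x, Om x -> u x <= M}.
Proof.
move=> GB su weak; have [mu' mDu] := sobolev0_measurable su.
have us := sobolev0_power_lty su.
have [S S0 HS] := sobolev_level mOm finOm Y a1 aN.
have [K K0 HK] := young_growth Y.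
have beta1 : 1 < astar / a by rewrite ltr_pdivlMr// mul1r sobolev_conj_gt.
have mabs p : measurable_fun Om (fun x => `|u x| `^ p).
  by apply: measurable_funpow; apply: measurableT_comp mu'; exact: normr_measurable.
have mB : measurable_fun Om (B u).
  by apply: measurable_funM; [exact: measurable_cst|apply: measurable_funD; exact: mabs].
have B0 x : 0 <= B u x by rewrite mulr_ge0 ?(ltW C0)// addr_ge0 ?powR_ge0.
have powMabs p (t : R) : 0 < p -> `|t| `^ (p - 1) * `|t| = `|t| `^ p.
  by move=> p0; rewrite mulrC mulr_powRB1.
have Bu x : B u x * `|u x| = C * (`|u x| `^ a + `|u x| `^ astar).
  by rewrite /B -mulrA mulrDl !powMabs.
(* An integrable bound for all the products of powers of [u] below. *)
pose F x : \bar R := ((2 * C)%:E * (1%:E + (`|u x| `^ astar)%:E))%E.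
have mF0 : measurable_fun Om (fun x => (`|u x| `^ astar)%:E) by apply/measurable_EFinP; exact: mabs.
have F_lty : (\int[mu]_(x in Om) F x < +oo)%E.
  rewrite ge0_integralZl_EFin; last 4 first.
  - exact: mOm.
  - by move=> x _; rewrite adde_ge0// lee_fin powR_ge0.
  - by apply: emeasurable_funD; [exact: measurable_cst|exact: mF0].
  - by rewrite mulr_ge0// ltW.
  rewrite ge0_integralD; last 5 first.
  - exact: mOm.
  - by [].
  - exact: measurable_cst.
  - by move=> x _; rewrite lee_fin powR_ge0.
  - exact: mF0.
  rewrite lte_mul_pinfty ?lee_fin ?mulr_ge0 ?(ltW C0)//.
  by rewrite integral_cst// mul1e lte_add_pinfty.
have F_ge (p q : R) x : 0 <= p <= astar -> 0 <= q <= astar ->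
    ((C * (`|u x| `^ p + `|u x| `^ q))%:E <= F x)%E.
  move=> /andP[p0 ps] /andP[q0 qs]; rewrite /F -EFinD -EFinM lee_fin.
  rewrite [2 * C]mulrC -mulrA ler_pM2l// [2 * _]mulr_natl mulr2n.
  by apply: lerD; exact: powR_le1D.
have B_lty : (\int[mu]_(x in Om) (B u x)%:E < +oo)%E.
  apply: le_lt_trans F_lty; apply: le_integral_nonneg => x _; first by rewrite lee_fin.
  apply: F_ge; rewrite subr_ge0 ?a1 ?astar1/= lerBlDr.
    by rewrite (le_trans (ltW sobolev_conj_gt))// lerDl.
  by rewrite lerDl.
have max_le (k t : R) : 0 <= k -> Num.max (t - k) 0 <= `|t|.
  by move=> k0; rewrite ge_max normr_ge0 andbT (le_trans _ (ler_norm t))// gerBl.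
have max0 (t : R) : 0 <= Num.max t 0 by rewrite le_max lexx orbT.
have I_lty k : 0 <= k -> (\int[mu]_(x in Om) (B u x * Num.max (u x - k) 0)%:E < +oo)%E.
  move=> k0; apply: le_lt_trans F_lty; apply: le_integral_nonneg => x _.
    by rewrite lee_fin mulr_ge0.
  apply: (@le_trans _ _ (B u x * `|u x|)%:E); first by rewrite lee_fin ler_wpM2l// max_le.
  by rewrite Bu; apply: F_ge; rewrite (ltW a0, ltW astar0) ?lexx ?(ltW sobolev_conj_gt).
pose V k := (\int[mu]_(x in Om) (if k <= u x then `|u x| `^ astar else 0)%:E)%E.
have mV k : measurable_fun Om (fun x => (if k <= u x then `|u x| `^ astar else 0)%:E).
  by apply/measurable_EFinP; apply: measurable_if_ge; [exact: mOm|exact: mu'|exact: mabs].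
have V0 k x : Om x -> (0 <= (if k <= u x then `|u x| `^ astar else 0)%:E)%E.
  by rewrite lee_fin; case: ifPn => // *; exact: powR_ge0.
have energy k : 1 <= k ->
    (\int[mu]_(x in Om) (if k <= u x then PhiF phi (enorm (Du x)) else 0)%:E <=
     (4 * C)%:E * V k)%E.
  move=> k1; have k0 : 0 <= k by exact: le_trans k1.
  apply: (le_trans (energy_level mOm finOm Cphi incr_phi Y a1 su weak mB GB B_lty k0 (I_lty k k0))).
  rewrite (_ : 4 * C = 2 * (2 * C)); last by ring.
  rewrite EFinM -muleA; apply: lee_wpmul2l => //.
  rewrite -ge0_integralZl_EFin; last 4 first.
  - exact: mOm.
  - exact: V0.
  - exact: mV.
  - by rewrite mulr_ge0// ltW.
  apply: le_integral_nonneg => x _; first by rewrite lee_fin mulr_ge0.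
  rewrite -EFinM lee_fin; case: ifPn => [ku|].
    apply: (@le_trans _ _ (B u x * `|u x|)); first by rewrite ler_wpM2l// max_le.
    rewrite Bu [2 * C]mulrC -mulrA ler_pM2l// [2 * _]mulr_natl mulr2n lerD2r.
    apply: ler_powR (ltW sobolev_conj_gt).
    exact: le_trans k1 (le_trans ku (ler_norm _)).
  by rewrite -ltNge => /ltW uk; rewrite mulr0 max_r ?mulr0// subr_le0.
pose C' := n.+2%:R * K * (1 + 4 * C).
have C'0 : 0 < C' by rewrite !mulr_gt0// addr_gt0// mulr_gt0.
have mPhi k : measurable_fun Om
    (fun x => (if k <= u x then PhiF phi (enorm (Du x)) else 0)%:E).
  apply/measurable_EFinP; apply: measurable_if_ge; [exact: mOm|exact: mu'|].
  exact: measurableT_comp (young_measurable Y) (measurable_enorm mDu).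
have Phi0 k x : Om x -> (0 <= (if k <= u x then PhiF phi (enorm (Du x)) else 0)%:E)%E.
  by rewrite lee_fin; case: ifPn => // *; exact: (young_ge0 Y).
have grad_le k : 1 <= k ->
    (\int[mu]_(x in Om) (if k <= u x then grad_pow a Du x else 0)%:E <= C'%:E * V k)%E.
  move=> k1.
  apply: (@le_trans _ _ ((n.+2%:R * K)%:E * (V k +
    \int[mu]_(x in Om) (if k <= u x then PhiF phi (enorm (Du x)) else 0)%:E))%E); last first.
    apply: (@le_trans _ _ ((n.+2%:R * K)%:E * (V k + (4 * C)%:E * V k))%E).
      apply: lee_wpmul2l; first by rewrite lee_fin mulr_ge0// ltW.
      by apply: leeD2l; exact: energy.
    have VE : (V k + (4 * C)%:E * V k = (1 + 4 * C)%:E * V k)%E.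
      by rewrite EFinD ge0_muleDl ?mul1e// lee_fin mulr_ge0// ltW.
    by rewrite VE muleA -EFinM.
  rewrite -ge0_integralD; last 5 first.
  - exact: mOm.
  - exact: V0.
  - exact: mV.
  - exact: Phi0.
  - exact: mPhi.
  rewrite -ge0_integralZl_EFin; last 4 first.
  - exact: mOm.
  - by move=> x Ox; rewrite adde_ge0 ?V0 ?Phi0.
  - by apply: emeasurable_funD; [exact: mV|exact: mPhi].
  - by rewrite mulr_ge0// ltW.
  apply: le_integral_nonneg => x _; first by rewrite lee_fin; case: ifPn => // _; exact: grad_pow_ge0.
  rewrite -EFinD -EFinM lee_fin; case: ifPn => [ku|_]; last by rewrite addr0 mulr0.
  apply: (@le_trans _ _ (\sum_(i < n.+2) enorm (Du x) `^ a)).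
    by apply: ler_sum => i _; apply: le_powR; rewrite ?(ltW a0)// norm_coord_le_enorm.
  rewrite sumr_const card_ord -[leLHS]mulr_natl -mulrA ler_pM2l//.
  apply: (le_trans (HK _ (enorm_ge0 _))); rewrite ler_pM2l// lerD2r.
  rewrite -[leLHS](powRr0 `|u x|); apply: ler_powR (ltW astar0).
  exact: le_trans k1 (le_trans ku (ler_norm _)).
apply: (bounded_of_level_estimate mOm mu' astar0 beta1 (C := S * (2 * C') `^ (astar / a))) => //.
  by rewrite mulr_gt0// powR_gt0// mulr_gt0.
move=> k U k1 U0 VU; have k0 : 0 <= k by exact: le_trans k1.
have := HS u Du k (2 * C' * U) su k0.
have C'2 : 0 <= 2 * C' by rewrite mulr_ge0// ltW.
rewrite (powRM _ C'2 (ltW U0)) mulrA; apply.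
apply: (le_lt_trans (grad_le k k1)).
apply: (@le_lt_trans _ _ (C' * U)%:E); first by rewrite (EFinM C' U) lee_wpmul2l// lee_fin ltW.
by rewrite lte_fin -mulrA ltr_pMl ?ltr1n// mulr_gt0.
Qed.

(** The hypotheses are symmetric under [u, Du, G |-> - u, - Du, - G]. *)
Lemma Linfty_of_critical_growth (G : 'rV[R]_n.+2 -> R) u Du :
  (forall x, Om x -> `|G x| <= B u x) ->
  sobolev0 (PhiF phi) Om u Du ->
  (forall v Dv, sobolev0 (PhiF phi) Om v Dv ->
    \int[mu]_(x in Om) (phi (enorm (Du x)) * dot (Du x) (Dv x)) =
    \int[mu]_(x in Om) (G x * v x)) ->
  Linfty Om u.
Proof.
move=> GB su weak; split; first by have [] := sobolev0_measurable su.
have [M1 u_le] := bounded_above_of_critical_growth GB su weak.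
have [|||M2 Nu_le] := @bounded_above_of_critical_growth (fun x => - G x)
    (fun x => - u x) (fun x => - Du x).
- by move=> x Ox; rewrite /B !normrN; exact: GB.
- exact: (sobolev0N mOm finOm Y a1 su).
- move=> v Dv sv; have := weak _ _ (sobolev0N mOm finOm Y a1 sv).
  rewrite (_ : (fun x => phi _ * dot (Du x) _) =
    (fun x => phi (enorm (- Du x)) * dot (- Du x) (Dv x))); last first.
    by apply/funext => x; rewrite enormN -[dot (- _) (Dv x)]dotNN opprK.
  by move=> ->; congr Rintegral; apply/funext => x; rewrite mulrN mulNr.
exists (Num.max M1 M2); apply: filterS2 u_le Nu_le => x u_le Nu_le Ox.
by rewrite ler_norml lerNl !le_max u_le// Nu_le// orbT.
Qed.

End bounded_solutions.

Theorem theorem1p6 (R : realType) (N : nat) (Om : set 'rV[R]_N)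
    (phi : R -> R) (l m : R) (g : 'rV[R]_N -> R -> R) (alpha : R)
    (u : 'rV[R]_N -> R) :
  (2 <= N)%N ->
  bounded_domain Om -> smooth_boundary Om ->
  C1 phi -> phi1 phi -> phi2 phi -> phi3 N phi l m ->
  caratheodory_function Om g ->
  alpha = l \/ alpha = m ->
  (exists2 C : R, 0 < C &
    (exists2 r : R, alpha < r < sobolev_conj N alpha &
       forall x t, Om x ->
         `|g x t| <= C * (`|t| `^ (alpha - 1) + `|t| `^ (r - 1))) \/
    (forall x t, Om x ->
       `|g x t| <=
         C * (`|t| `^ (alpha - 1) + `|t| `^ (sobolev_conj N alpha - 1)))) ->
  (~ Nequiv (PhiF phi) (fun t => `|t| `^ m) /\ alpha = l) \/
  (Nequiv (PhiF phi) (fun t => `|t| `^ m) /\ alpha = m) ->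
  weak_solution Om phi g u ->
  Linfty Om u.
Proof.
case: N Om g u => [|[|n]] Om g u // _ [_ oOm _ bOm] _ Cphi _ incr_phi phi3P _
  alpha_lm [C C0 growth] cases [Du su weak].
have mOm := open_measurable_rV oOm.
have finOm := bounded_lebesgue_lty mOm bOm.
have [/andP[l1 lN] /andP[m1 mN] _ _] := phi3P.
have [a1 aN] : 1 <= alpha /\ alpha < n.+2%:R.
  by case: alpha_lm => ->; split=> //; exact: ltW.
have Y : doubling_young (PhiF phi) alpha.
  apply: (PhiF_doubling_young Cphi incr_phi phi3P).
  by case: cases => [[_ ->]|]; [left|right].
have [C' C'0 gC'] : exists2 C' : R, 0 < C' & forall x t, Om x ->
    `|g x t| <= C' * (`|t| `^ (alpha - 1) + `|t| `^ (sobolev_conj n.+2 alpha - 1)).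
  (* Subcritical growth is critical, with twice the constant. *)
  case: growth => [[r /andP[ar rs] gr]|gC]; last by exists C.
  exists (2 * C) => [|x t Ox]; first by rewrite mulr_gt0.
  apply: (le_trans (gr x t Ox)); rewrite [2 * C]mulrC -mulrA ler_pM2l//.
  have := @powR_le_add R (alpha - 1) (sobolev_conj n.+2 alpha - 1) (r - 1) `|t|.
  rewrite subr_ge0 ltrD2r lerD2r => /(_ a1 ar (ltW rs) (normr_ge0 t)).
  have := powR_ge0 `|t| (sobolev_conj n.+2 alpha - 1).
  move: (_ `^ _) (_ `^ _) (_ `^ _) => p q s; lra.
apply: (Linfty_of_critical_growth mOm finOm Cphi incr_phi Y a1 aN C'0 _ su weak).
by move=> x Ox; exact: gC'.
Qed.
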